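(* Let $A=T(V)/\langle R\rangle$ be a multi-Koszul algebra, and let $\{J_i\}_{i\in\mathbb{N}_0}$ be the associated collection of graded vector subspaces of $T(V)$. Use the identification $\mathcal{E}xt_A^{i}(k,k)\simeq J_i^{\#}$, for $i\in\mathbb{N}_0$, coming from the multi-Koszul resolution $K(A)_\bullet$ of $k$. Given $i,i'\in\mathbb{N}_0$, let $\iota_{i,i'}:J_{i+i'}\to J_i\otimes J_{i'}$ be the map of graded vector spaces defined in the context, and let $c_{J_i,J_{i'}}:J_i^{\#}\otimes J_{i'}^{\#}\to (J_i\otimes J_{i'})^{\#}$ be the canonical isomorphism. Then the restriction of the Yoneda product of $\mathcal{E}xt_A^{\bullet}(k,k)$ to $J_i^{\#}\otimes J_{i'}^{\#}$ is given by $\iota_{i,i'}^{\#}\circ c_{J_i,J_{i'}}$.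
   Context: Setting. $k$ is a field. $A=\bigoplus_{n\ge 0}A_n$ is a locally finite dimensional nonnegatively graded connected algebra ($A_0=k$, $\dim A_n<\infty$), written $A=T(V)/\langle R\rangle$, where $V\simeq A_{>0}/(A_{>0}\cdot A_{>0})$ is a positively graded vector space with finite dimensional components, $T(V)$ is its tensor algebra with the grading induced from $V$, and $R\subseteq \bigoplus_{n\ge2}V^{\otimes n}$ is a space of relations: a graded subspace with $R\cap(T(V)_{>0}\otimes R\otimes T(V)+T(V)\otimes R\otimes T(V)_{>0})=0$, $T(V)_{>0}=\bigoplus_{n\ge1}V^{\otimes n}$. $\pi:T(V)\to A$ is the projection. $V^{(n)}=V^{\otimes n}$, $V^{(0)}=k$. For subspaces $W_1,\dots,W_m$ of $T(V)$, $W_1\otimes\dots\otimes W_m$ denotes the subspace of $T(V)$ spanned by products $w_1\cdots w_m$, $w_l\in W_l$; $R^{(i)}=R\otimes\dots\otimes R$ ($i$ factors), $R^{(0)}=k$. The spaces $J_i\subseteq T(V)$. $J_0=k$, $J_2=R$, $J_{2i+1}=(V\otimes J_{2i})\cap(J_{2i}\otimes V)$ for $i\ge0$ (so $J_1=V$), and for $i\ge1$ $$J_{2(i+1)}=\Big(\sum_{N\ge1}\ \bigcap_{\bar n,\bar m}V^{(m_1)}\otimes J_{2n_1}\otimes\dots\otimes V^{(m_i)}\otimes J_{2n_i}\otimes V^{(m_{i+1})}\Big)\cap R^{(i+1)},$$ where $\bar n=(n_1,\dots,n_i)$ runs over $i$-tuples of nonnegative integers with sum $i$ and $\bar m=(m_1,\dots,m_{i+1})$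 over $(i+1)$-tuples of nonnegative integers with sum $N$. (The product subspaces $J_i\otimes J_{i'}$ and $T(V)\otimes J_i\otimes J_{i'}$ of $T(V)$ are canonically isomorphic to the abstract tensor products.) Multi-Koszul complexes. $K_{L-R}(A)_i=A\otimes J_i\otimes A$, with $A$-bimodule maps $\delta_i^b:K_{L-R}(A)_i\to K_{L-R}(A)_{i-1}$: if $i=2j+1$ and $\omega=\sum\bar\omega_{(1)}\omega_{(2)}=\sum\omega'_{(1)}\bar\omega'_{(2)}\in J_{2j+1}$ with $\bar\omega_{(1)},\bar\omega'_{(2)}\in V$, $\omega_{(2)},\omega'_{(1)}\in J_{2j}$, then $\delta_i^b(1\otimes\omega\otimes1)=\sum\bar\omega_{(1)}\otimes\omega_{(2)}\otimes1-\sum1\otimes\omega'_{(1)}\otimes\bar\omega'_{(2)}$; if $i=2j\ge2$, then $J_{2j}\subseteq\bigoplus_{N\ge0}\bigcap_{l=0}^N V^{(l)}\otimes J_{2j-1}\otimes V^{(N-l)}$, and writing $\omega=\sum_N\omega^N$ accordingly and $\omega^N=\sum\omega^{N,l}_{(1)}\omega^{N,l}_{(2)}\omega^{N,l}_{(3)}\in V^{(l)}\otimes J_{2j-1}\otimes V^{(N-l)}$ for each $0\le l\le N$, $\delta_i^b(1\otimes\omega\otimes1)=\sum_N\sum_{l=0}^N\sum\pi(\omega^{N,l}_{(1)})\otimes\omega^{N,l}_{(2)}\otimes\pi(\omega^{N,l}_{(3)})$. The left multi-Koszul complex is $K(A)_\bullet=K_{L-R}(A)_\bullet\otimes_A k$,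 i.e. $K(A)_i=A\otimes J_i$, $\delta_i=\delta_i^b\otimes_A\mathrm{id}_k$, augmented by the augmentation $\delta_0:A\to k$; the right one is $k\otimes_A K_{L-R}(A)_\bullet$. $A$ is multi-Koszul if $K(A)_\bullet$ is a resolution of the trivial left module $k$ (equivalently, the right complex is a resolution of the trivial right module $k$). In that case $K(A)_\bullet$ is a minimal projective resolution. Ext and the Yoneda product. $\mathcal{H}om_A(N,N')=\bigoplus_{d\in\mathbb{Z}}\hom_A(N,N'[d])$, where $\hom_A$ denotes degree-preserving $A$-linear maps and $N'[d]_n=N'_{n+d}$; $\mathcal{E}xt$ is its derived functor. $\mathcal{E}nd_A(K(A)_\bullet)$ is the dg algebra with $\mathcal{E}nd^i_A=\prod_j\mathcal{H}om_A(K(A)_j,K(A)_{j-i})$, product given by composition, and differential sending $(f_j)_j$ of degree $i$ to $(\delta_{j-i}\circ f_j-(-1)^if_{j-1}\circ\delta_j)_j$ (here $\delta_l=0$ for $l\le 0$). The Yoneda algebra $\mathcal{E}xt_A^\bullet(k,k)$ is its cohomology algebra. The complex $\mathcal{H}om_A(K(A)_\bullet,k)$ has zero differential and $\mathcal{H}om_A(K(A)_i,k)\simeq J_i^{\#}$ by restriction to $1\otimes J_i$. The identification $\mathcal{E}xt^i_A(k,k)\simeq J_i^{\#}$ is induced by the quasi-isomorphism $\mathcal{E}nd_A(K(A)_\bullet)\to\mathcal{H}om_A(K(A)_\bullet,k)$ sending $(f_j)_j$ of degree $i$ to $(-1)^i\delta_0\circ f_i$. Duals and signs. $W^{\#}$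 is the graded dual. $J_i$ sits in homological degree $i$, $J_i^{\#}$ in cohomological degree $i$; the grading coming from $V$ (Adams grading) contributes no signs. $c_{J_i,J_{i'}}(f\otimes g)(v\otimes w)=(-1)^{\deg(v)\deg(g)}f(v)g(w)=(-1)^{ii'}f(v)g(w)$. $\iota_{i,i'}^{\#}$ is the transpose, $\lambda\mapsto\lambda\circ\iota_{i,i'}$. The maps $\iota_{i,i'}$. If $i$ or $i'$ is even, then $J_{i+i'}\subseteq J_i\otimes J_{i'}$ and $\iota_{i,i'}$ is this inclusion. If $i$ and $i'$ are both odd, then $J_{i+i'}\subseteq T(V)\otimes J_i\otimes J_{i'}$ and $\iota_{i,i'}$ is this inclusion followed by $\epsilon_{T(V)}\otimes\mathrm{id}_{J_i}\otimes\mathrm{id}_{J_{i'}}$, where $\epsilon_{T(V)}:T(V)\to k$ is the augmentation. *)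

(* Defs.v *)
From HB Require Import structures.
From mathcomp Require Import all_boot all_order all_algebra.
From mathcomp Require Import boolp classical_sets.

Set Implicit Arguments.
Unset Strict Implicit.
Unset Printing Implicit Defensive.

Import GRing.Theory.
Local Open Scope ring_scope.
Local Open Scope quotient_scope.

Section Subspaces.
Variables (k : fieldType) (M : lmodType k).

Record lsubspace := LSubspace {
  lsub_mem :> M -> Prop;
  lsub0 : lsub_mem 0;
  lsubL : forall (a : k) (u v : M),
    lsub_mem u -> lsub_mem v -> lsub_mem (a *: u + v) }.

Definition lspan_mem (S : M -> Prop) (x : M) : Prop :=
  exists2 s : seq (k * M),
    (forall p, p \in s -> S p.2) & x = \sum_(p <- s) p.1 *: p.2.

Fact lspan0 S : lspan_mem S 0.
Proof. by exists [::] => //; rewrite big_nil. Qed.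

Fact lspanL S (a : k) (u v : M) :
  lspan_mem S u -> lspan_mem S v -> lspan_mem S (a *: u + v).
Proof.
move=> [s Ss ->] [t St ->]; exists ([seq (a * p.1, p.2) | p <- s] ++ t).
  by move=> p; rewrite mem_cat => /orP[/mapP[q /Ss Sq ->]|/St].
rewrite big_cat big_map scaler_sumr; congr (_ + _).
by apply: eq_bigr => p _; rewrite scalerA.
Qed.

Definition lspan (S : M -> Prop) : lsubspace :=
  @LSubspace (lspan_mem S) (lspan0 S) (@lspanL S).

Definition lfull : lsubspace :=
  @LSubspace (fun _ => True) I (fun _ _ _ _ _ => I).

Fact lcap0 (W1 W2 : lsubspace) : W1 0 /\ W2 0.
Proof. by split; apply: lsub0. Qed.

Fact lcapL (W1 W2 : lsubspace) (a : k) (u v : M) :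
  W1 u /\ W2 u -> W1 v /\ W2 v -> W1 (a *: u + v) /\ W2 (a *: u + v).
Proof. by move=> [? ?] [? ?]; split; apply: lsubL. Qed.

Definition lcap (W1 W2 : lsubspace) : lsubspace :=
  @LSubspace (fun x => W1 x /\ W2 x) (lcap0 W1 W2) (@lcapL W1 W2).

Definition finite_dim (W : lsubspace) : Prop :=
  exists s : seq M, forall x, W x -> lspan (fun v => v \in s) x.

Definition is_grading (G : nat -> lsubspace) : Prop :=
  (forall v, exists (n : nat) (a : nat -> M),
      (forall i, G i (a i)) /\ v = \sum_(i < n) a i) /\
  (forall (n : nat) (a : nat -> M), (forall i, G i (a i)) ->
      \sum_(i < n) a i = 0 -> forall i, (i < n)%N -> a i = 0).

Definition in_lsub (W : lsubspace) : {pred M} := fun x => `[< W x >].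

Fact in_lsub_closed W : submod_closed (in_lsub W).
Proof.
split=> [|a u v]; rewrite !unfold_in; first exact/asboolP/lsub0.
by move=> /asboolP Wu /asboolP Wv; apply/asboolP/lsubL.
Qed.

HB.instance Definition _ W :=
  GRing.isSubmodClosed.Build k M (in_lsub W) (in_lsub_closed W).

Record lsub_type (W : lsubspace) := LSub {
  lsub_val : M;
  lsub_valP : lsub_val \in in_lsub W }.

HB.instance Definition _ W := [isSub for @lsub_val W].
HB.instance Definition _ W := [Choice of lsub_type W by <:].
HB.instance Definition _ W := [SubChoice_isSubLmodule of lsub_type W by <:].

End Subspaces.

(* Tensor products of vector spaces: formal sums of pairs, two of them being *)
(* identified when all bilinear maps agree on them.                          *)

Definition bilinear_map (k : fieldType) (U W P : lmodType k)
    (b : U -> W -> P) : Prop :=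
  (forall (a : k) u v w, b (a *: u + v) w = a *: b u w + b v w) /\
  (forall (a : k) u w z, b u (a *: w + z) = a *: b u w + b u z).

Section Tensor.
Variables (k : fieldType) (U W : lmodType k).

Definition tensor_rel (s t : seq (U * W)) : bool :=
  `[< forall (P : lmodType k) (b : U -> W -> P), bilinear_map b ->
      \sum_(p <- s) b p.1 p.2 = \sum_(p <- t) b p.1 p.2 >].

Fact tensor_rel_equiv : equiv_class_of tensor_rel.
Proof.
split=> [s|s t|t s r].
- exact/asboolP.
- by apply/asboolP/asboolP => e P b hb; rewrite e.
- by move=> /asboolP e1 /asboolP e2; apply/asboolP => P b hb; rewrite e1 ?e2.
Qed.

Canonical tensor_equiv := EquivRelPack tensor_rel_equiv.
Canonical tensor_encModRel := defaultEncModRel tensor_rel.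

Definition tensor := {eq_quot tensor_rel}.
HB.instance Definition _ := EqQuotient.on tensor.
HB.instance Definition _ := Choice.on tensor.

Definition tlift (P : lmodType k) (b : U -> W -> P) (x : tensor) : P :=
  \sum_(p <- repr x) b p.1 p.2.

Definition tpure (u : U) (w : W) : tensor := \pi_tensor [:: (u, w)].

Lemma tlift_pi (P : lmodType k) (b : U -> W -> P) s : bilinear_map b ->
  tlift b (\pi_tensor s) = \sum_(p <- s) b p.1 p.2.
Proof.
move=> hb; rewrite /tlift; case: piP => t.
by move/eqmodP/asboolP => /(_ P b hb) ->.
Qed.

Lemma tlift_pure (P : lmodType k) (b : U -> W -> P) u w : bilinear_map b ->
  tlift b (tpure u w) = b u w.
Proof. by move=> hb; rewrite tlift_pi // big_seq1. Qed.

Lemma tensor_ext (x y : tensor) :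
  (forall (P : lmodType k) (b : U -> W -> P), bilinear_map b ->
    tlift b x = tlift b y) -> x = y.
Proof.
move=> h; rewrite -[x]reprK -[y]reprK; apply/eqmodP/asboolP => P b hb.
by have := h P b hb.
Qed.

Definition tensor_zero : tensor := \pi_tensor [::].
Definition tensor_add (x y : tensor) : tensor := \pi_tensor (repr x ++ repr y).
Definition tensor_scale (a : k) (x : tensor) : tensor :=
  \pi_tensor [seq (a *: p.1, p.2) | p <- repr x].
Definition tensor_opp : tensor -> tensor := tensor_scale (-1).

Fact tlift_zero (P : lmodType k) (b : U -> W -> P) :
  bilinear_map b -> tlift b tensor_zero = 0.
Proof. by move=> hb; rewrite tlift_pi // big_nil. Qed.

Fact tlift_add (P : lmodType k) (b : U -> W -> P) x y :
  bilinear_map b -> tlift b (tensor_add x y) = tlift b x + tlift b y.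
Proof. by move=> hb; rewrite tlift_pi // big_cat. Qed.

Lemma bilinear0l (P : lmodType k) (b : U -> W -> P) w :
  bilinear_map b -> b 0 w = 0.
Proof.
by move=> [h _]; have := h (-1) 0 0 w; rewrite scaler0 addr0 scaleN1r addNr.
Qed.

Lemma bilinear0r (P : lmodType k) (b : U -> W -> P) u :
  bilinear_map b -> b u 0 = 0.
Proof.
by move=> [_ h]; have := h (-1) u 0 0; rewrite scaler0 addr0 scaleN1r addNr.
Qed.

Lemma bilinearZl (P : lmodType k) (b : U -> W -> P) a u w :
  bilinear_map b -> b (a *: u) w = a *: b u w.
Proof.
move=> hb; have [h _] := hb.
by rewrite -[a *: u]addr0 h (bilinear0l _ hb) addr0.
Qed.

Fact tlift_scale (P : lmodType k) (b : U -> W -> P) a x :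
  bilinear_map b -> tlift b (tensor_scale a x) = a *: tlift b x.
Proof.
move=> hb; rewrite tlift_pi // big_map scaler_sumr.
by apply: eq_bigr => p _; rewrite bilinearZl.
Qed.

Fact tensor_addA : associative tensor_add.
Proof.
by move=> x y z; apply: tensor_ext => P b hb; rewrite !tlift_add // addrA.
Qed.
Fact tensor_addC : commutative tensor_add.
Proof.
by move=> x y; apply: tensor_ext => P b hb; rewrite !tlift_add // addrC.
Qed.
Fact tensor_add0 : left_id tensor_zero tensor_add.
Proof.
by move=> x; apply: tensor_ext => P b hb; rewrite tlift_add // tlift_zero // add0r.
Qed.
Fact tensor_addN : left_inverse tensor_zero tensor_opp tensor_add.
Proof.
move=> x; apply: tensor_ext => P b hb.
by rewrite tlift_add // tlift_scale // tlift_zero // scaleN1r addNr.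
Qed.

HB.instance Definition _ :=
  GRing.isZmodule.Build tensor tensor_addA tensor_addC tensor_add0 tensor_addN.

Fact tensor_scaleA a b v :
  tensor_scale a (tensor_scale b v) = tensor_scale (a * b) v.
Proof.
by apply: tensor_ext => P f hf; rewrite !tlift_scale // scalerA.
Qed.
Fact tensor_scale1 : left_id 1 tensor_scale.
Proof. by move=> v; apply: tensor_ext => P f hf; rewrite tlift_scale // scale1r. Qed.
Fact tensor_scaleDr : right_distributive tensor_scale +%R.
Proof.
move=> a u v; apply: tensor_ext => P f hf.
by rewrite [RHS]tlift_add // !tlift_scale // tlift_add // scalerDr.
Qed.
Fact tensor_scaleDl v : {morph tensor_scale^~ v : a b / a + b}.
Proof.
move=> a b; apply: tensor_ext => P f hf.
by rewrite [RHS]tlift_add // !tlift_scale // scalerDl.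
Qed.

HB.instance Definition _ := GRing.Zmodule_isLmodule.Build k tensor
  tensor_scaleA tensor_scale1 tensor_scaleDr tensor_scaleDl.

Lemma tlift_linear (P : lmodType k) (b : U -> W -> P) :
  bilinear_map b -> linear (tlift b).
Proof.
by move=> hb a u v; rewrite [LHS]tlift_add // [X in X + _]tlift_scale.
Qed.

Lemma tpure_bilinear : bilinear_map tpure.
Proof.
split=> a u v w; apply: tensor_ext => P b hb; have [hl hr] := hb.
  by rewrite tlift_linear // !tlift_pure // hl.
by rewrite tlift_linear // !tlift_pure // hr.
Qed.

Lemma tensor_sum_pure (x : tensor) :
  x = \sum_(p <- repr x) tpure p.1 p.2.
Proof.
apply: tensor_ext => P b hb; rewrite {1}/tlift.
have: linear (tlift b) := tlift_linear hb; elim: (repr x) => [|p s IH] hl.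
  by rewrite !big_nil tlift_zero.
by rewrite !big_cons [RHS]tlift_add // tlift_pure // IH.
Qed.

End Tensor.

(* The tensor algebra T(V): formal linear combinations of words in V, two of *)
(* them being identified when they have the same value under every linear   *)
(* map from V to a k-algebra.                                                *)

Section TensorAlgebra.
Variables (k : fieldType) (V : lmodType k).

Definition word_eval (B : algType k) (f : V -> B) (s : seq (k * seq V)) : B :=
  \sum_(p <- s) p.1 *: \prod_(v <- p.2) f v.

Definition talg_rel (s t : seq (k * seq V)) : bool :=
  `[< forall (B : algType k) (f : {linear V -> B}),
      word_eval f s = word_eval f t >].

Fact talg_rel_equiv : equiv_class_of talg_rel.
Proof.
split=> [s|s t|t s r].
- exact/asboolP.
- by apply/asboolP/asboolP => e B f; rewrite e.
- by move=> /asboolP e1 /asboolP e2; apply/asboolP => B f; rewrite e1 ?e2.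
Qed.

Canonical talg_equiv := EquivRelPack talg_rel_equiv.
Canonical talg_encModRel := defaultEncModRel talg_rel.

Definition talg := {eq_quot talg_rel}.
HB.instance Definition _ := EqQuotient.on talg.
HB.instance Definition _ := Choice.on talg.

Definition talg_lift (B : algType k) (f : V -> B) (x : talg) : B :=
  word_eval f (repr x).

Definition tinj (v : V) : talg := \pi_talg [:: (1, [:: v])].

Lemma talg_lift_pi (B : algType k) (f : {linear V -> B}) s :
  talg_lift f (\pi_talg s) = word_eval f s.
Proof. by rewrite /talg_lift; case: piP => t /eqmodP/asboolP ->. Qed.

Lemma talg_lift_tinj (B : algType k) (f : {linear V -> B}) v :
  talg_lift f (tinj v) = f v.
Proof. by rewrite talg_lift_pi /word_eval !big_seq1 scale1r. Qed.

Lemma talg_ext (x y : talg) :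
  (forall (B : algType k) (f : {linear V -> B}),
    talg_lift f x = talg_lift f y) -> x = y.
Proof.
by move=> h; rewrite -[x]reprK -[y]reprK; apply/eqmodP/asboolP => B f; apply: h.
Qed.

Definition talg_zero : talg := \pi_talg [::].
Definition talg_one : talg := \pi_talg [:: (1, [::])].
Definition talg_add (x y : talg) : talg := \pi_talg (repr x ++ repr y).
Definition talg_scale (a : k) (x : talg) : talg :=
  \pi_talg [seq (a * p.1, p.2) | p <- repr x].
Definition talg_opp : talg -> talg := talg_scale (-1).
Definition talg_mul (x y : talg) : talg :=
  \pi_talg [seq (p.1 * q.1, p.2 ++ q.2) | p <- repr x, q <- repr y].

Section Lift.
Variables (B : algType k) (f : {linear V -> B}).

Fact talg_lift0 : talg_lift f talg_zero = 0.
Proof. by rewrite talg_lift_pi /word_eval big_nil. Qed.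
Fact talg_lift1 : talg_lift f talg_one = 1.
Proof. by rewrite talg_lift_pi /word_eval big_seq1 big_nil scale1r. Qed.
Fact talg_liftD x y :
  talg_lift f (talg_add x y) = talg_lift f x + talg_lift f y.
Proof. by rewrite talg_lift_pi /word_eval big_cat. Qed.
Fact talg_liftZ a x : talg_lift f (talg_scale a x) = a *: talg_lift f x.
Proof.
rewrite talg_lift_pi /talg_lift /word_eval big_map scaler_sumr.
by apply: eq_bigr => p _; rewrite scalerA.
Qed.
Fact talg_liftN x : talg_lift f (talg_opp x) = - talg_lift f x.
Proof. by rewrite talg_liftZ scaleN1r. Qed.
Fact talg_liftM x y :
  talg_lift f (talg_mul x y) = talg_lift f x * talg_lift f y.
Proof.
rewrite talg_lift_pi /talg_lift /word_eval big_allpairs_dep /= mulr_suml.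
apply: eq_bigr => p _; rewrite mulr_sumr; apply: eq_bigr => q _.
by rewrite big_cat /= -scalerAl -scalerAr scalerA.
Qed.
End Lift.

Definition talg_liftE :=
  (talg_lift0, talg_lift1, talg_liftD, talg_liftN, talg_liftZ, talg_liftM).

Fact talg_addA : associative talg_add.
Proof. by move=> x y z; apply: talg_ext => B f; rewrite !talg_liftE addrA. Qed.
Fact talg_addC : commutative talg_add.
Proof. by move=> x y; apply: talg_ext => B f; rewrite !talg_liftE addrC. Qed.
Fact talg_add0 : left_id talg_zero talg_add.
Proof. by move=> x; apply: talg_ext => B f; rewrite !talg_liftE add0r. Qed.
Fact talg_addN : left_inverse talg_zero talg_opp talg_add.
Proof. by move=> x; apply: talg_ext => B f; rewrite !talg_liftE addNr. Qed.

HB.instance Definition _ :=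
  GRing.isZmodule.Build talg talg_addA talg_addC talg_add0 talg_addN.

Fact talg_mulA : associative talg_mul.
Proof. by move=> x y z; apply: talg_ext => B f; rewrite !talg_liftE mulrA. Qed.
Fact talg_mul1 : left_id talg_one talg_mul.
Proof. by move=> x; apply: talg_ext => B f; rewrite !talg_liftE mul1r. Qed.
Fact talg_mulr1 : right_id talg_one talg_mul.
Proof. by move=> x; apply: talg_ext => B f; rewrite !talg_liftE mulr1. Qed.
Fact talg_mulDl : left_distributive talg_mul +%R.
Proof.
move=> x y z; apply: talg_ext => B f.
by rewrite [RHS]talg_liftD !talg_liftM talg_liftD mulrDl.
Qed.
Fact talg_mulDr : right_distributive talg_mul +%R.
Proof.
move=> x y z; apply: talg_ext => B f.
by rewrite [RHS]talg_liftD !talg_liftM talg_liftD mulrDr.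
Qed.
Fact talg_one_neq0 : talg_one != 0.
Proof.
apply/eqP => /(congr1 (talg_lift (\0 : {linear V -> k^o}))).
by rewrite talg_lift1 [RHS]talg_lift0 => /eqP; rewrite oner_eq0.
Qed.

HB.instance Definition _ := GRing.Zmodule_isNzRing.Build talg
  talg_mulA talg_mul1 talg_mulr1 talg_mulDl talg_mulDr talg_one_neq0.

Fact talg_scaleA a b v : talg_scale a (talg_scale b v) = talg_scale (a * b) v.
Proof. by apply: talg_ext => B f; rewrite !talg_liftZ scalerA. Qed.
Fact talg_scale1 : left_id 1 talg_scale.
Proof. by move=> v; apply: talg_ext => B f; rewrite !talg_liftZ scale1r. Qed.
Fact talg_scaleDr : right_distributive talg_scale +%R.
Proof.
move=> a u v; apply: talg_ext => B f.
by rewrite [RHS]talg_liftD !talg_liftZ talg_liftD scalerDr.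
Qed.
Fact talg_scaleDl v : {morph talg_scale^~ v : a b / a + b}.
Proof.
move=> a b; apply: talg_ext => B f.
by rewrite [RHS]talg_liftD !talg_liftZ scalerDl.
Qed.

HB.instance Definition _ := GRing.Zmodule_isLmodule.Build k talg
  talg_scaleA talg_scale1 talg_scaleDr talg_scaleDl.

Fact talg_scaleAl (a : k) (u v : talg) : a *: (u * v) = a *: u * v.
Proof.
apply: talg_ext => B f.
by rewrite [LHS]talg_liftZ [RHS]talg_liftM talg_liftZ talg_liftM scalerAl.
Qed.

HB.instance Definition _ := GRing.Lmodule_isLalgebra.Build k talg talg_scaleAl.

Fact talg_scaleAr (a : k) (u v : talg) : a *: (u * v) = u * (a *: v).
Proof.
apply: talg_ext => B f.
by rewrite [LHS]talg_liftZ [RHS]talg_liftM talg_liftZ talg_liftM scalerAr.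
Qed.

HB.instance Definition _ := GRing.Lalgebra_isAlgebra.Build k talg talg_scaleAr.

Lemma tinj_linear : linear tinj.
Proof.
move=> a u v; apply: talg_ext => B f.
by rewrite [RHS]talg_liftD talg_liftZ !talg_lift_tinj linearP.
Qed.

Lemma talg_lift_linear (B : algType k) (f : {linear V -> B}) :
  linear (talg_lift f).
Proof. by move=> a u v; rewrite [LHS]talg_liftD talg_liftZ. Qed.

Lemma talg_lift_monoid (B : algType k) (f : {linear V -> B}) :
  monoid_morphism (talg_lift f).
Proof. by split=> [|x y]; [exact: talg_lift1|exact: talg_liftM]. Qed.

Lemma talg_sum_words (x : talg) :
  x = \sum_(p <- repr x) p.1 *: \prod_(v <- p.2) tinj v.
Proof.
apply: talg_ext => B f; rewrite {1}/talg_lift /word_eval.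
elim: (repr x) => [|p s IH]; first by rewrite !big_nil [RHS]talg_lift0.
rewrite !big_cons IH [RHS]talg_liftD talg_liftZ; congr (_ *: _ + _).
elim: p.2 => [|v w IHw]; first by rewrite !big_nil [RHS]talg_lift1.
by rewrite !big_cons IHw [RHS]talg_liftM talg_lift_tinj.
Qed.

End TensorAlgebra.

Section MultiKoszul.
Variables (k : fieldType) (V : lmodType k).
Local Notation T := (talg V).

(* W1 W2, written as a tensor product when the multiplication is injective on *)
(* the abstract tensor product of W1 and W2.                                  *)
Definition sprod (W1 W2 : lsubspace T) : lsubspace T :=
  lspan (fun x => exists u v, [/\ W1 u, W2 v & x = u * v]).

Definition scalars : lsubspace T := lspan (fun x => x = 1).

Fixpoint spow (W : lsubspace T) (n : nat) : lsubspace T :=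
  if n is n'.+1 then sprod W (spow W n') else scalars.

Definition Vsub : lsubspace T := lspan (fun x => exists v : V, x = tinj v).

Definition Tge (m : nat) : lsubspace T :=
  lspan (fun x => exists2 n, (m <= n)%N & spow Vsub n x).

Definition eps_T : T -> k := @talg_lift k V k^o \0.

Definition pos_graded_lfd (Vdeg : nat -> lsubspace V) : Prop :=
  [/\ is_grading Vdeg, (forall v, Vdeg 0%N v -> v = 0)
    & forall n, finite_dim (Vdeg n)].

Definition Tdeg (Vdeg : nat -> lsubspace V) (n : nat) : lsubspace T :=
  lspan (fun x => exists s : seq (nat * V),
    [/\ forall p, p \in s -> Vdeg p.1 p.2, sumn [seq p.1 | p <- s] = n
      & x = \prod_(p <- s) tinj p.2]).

Definition relation_space (Vdeg : nat -> lsubspace V) (R : lsubspace T) :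
    Prop :=
  [/\ forall r, R r -> Tge 2 r,
      forall r, R r -> lspan (fun x => R x /\ exists n, Tdeg Vdeg n x) r
    & forall r, R r ->
        lspan (fun x => sprod (Tge 1) (sprod R (lfull T)) x \/
                        sprod (lfull T) (sprod R (Tge 1)) x) r ->
        r = 0].

(* A = T(V)/<R>, with p the projection. *)
Definition is_presentation (R : lsubspace T) (A : algType k)
    (p : {lrmorphism T -> A}) : Prop :=
  (forall a, exists t, p t = a) /\
  (forall t, p t = 0 <-> sprod (lfull T) (sprod R (lfull T)) t).

Section Spaces.
Variable R : lsubspace T.

Fixpoint interleave (Je : nat -> lsubspace T) (n m : seq nat) : lsubspace T :=
  match n, m with
  | n1 :: n', m1 :: m' =>
      sprod (spow Vsub m1) (sprod (Je n1) (interleave Je n' m'))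
  | [::], m1 :: _ => spow Vsub m1
  | _, [::] => scalars
  end.

(* J_{2(i+1)} in terms of Je n = J_{2n}, for n <= i. *)
Definition Jstep (Je : nat -> lsubspace T) (i : nat) : lsubspace T :=
  lcap
    (lspan (fun x => exists2 N, (1 <= N)%N &
       forall (n : i.-tuple nat) (m : i.+1.-tuple nat),
         sumn n = i -> sumn m = N -> interleave Je n m x))
    (spow R i.+1).

(* Course-of-values recursion: Jtable i n is J_{2n} for n <= i + 1. *)
Fixpoint Jtable (i n : nat) : lsubspace T :=
  if i is i'.+1 then
    if (n <= i)%N then Jtable i' n else Jstep (Jtable i') i
  else if n is 0%N then scalars else R.

Definition Jeven (n : nat) : lsubspace T := Jtable n n.

Definition J (i : nat) : lsubspace T :=
  if odd i then lcap (sprod Vsub (Jeven i./2)) (sprod (Jeven i./2) Vsub)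
  else Jeven i./2.

Fact Jtable_Jeven i n : (n <= i.+1)%N -> Jtable i n = Jeven n.
Proof.
elim: i n => [|i IH] n; first by case: n => [|[]].
rewrite leq_eqVlt => /orP[/eqP ->|]; last first.
  by rewrite ltnS => le_n /=; rewrite le_n IH.
by rewrite /Jeven -[RHS]/(if (i.+2 <= i.+2)%N then _ else _) leqnn.
Qed.

Fact interleave_ext Je Je' n m :
  (forall a, (a <= sumn n)%N -> Je a = Je' a) ->
  interleave Je n m = interleave Je' n m.
Proof.
elim: n m => [|a n IH] [|b m] //= h; rewrite h ?leq_addr // IH // => c le_c.
by apply/h/(leq_trans le_c)/leq_addl.
Qed.

Lemma Jeven0 : Jeven 0 = scalars. Proof. by []. Qed.
Lemma Jeven1 : Jeven 1 = R. Proof. by []. Qed.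

Lemma JevenSS i : Jeven i.+2 = Jstep Jeven i.+1.
Proof.
rewrite {1}/Jeven -[LHS]/(if (i.+2 <= i.+2)%N then
  if (i.+2 <= i.+1)%N then _ else Jstep (Jtable i) i.+1 else _) leqnn ltnn.
rewrite /Jstep; congr lcap; congr lspan; apply/funext => x; apply/propext.
have e (n : i.+1.-tuple nat) m : sumn n = i.+1 ->
    interleave (Jtable i) n m = interleave Jeven n m.
  by move=> sn; apply: interleave_ext => a; rewrite sn; apply: Jtable_Jeven.
by split=> -[N N1 h]; exists N => // n m sn sm; move: (h n m sn sm); rewrite e.
Qed.

Definition Jt (i : nat) : lmodType k := lsub_type (J i).

End Spaces.

Definition tmap (U W U' W' : lmodType k) (f : U -> U') (g : W -> W')
    (x : tensor U W) : tensor U' W' :=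
  tlift (fun u w => tpure (f u) (g w)) x.

Fact tmap_bilinear (U W U' W' : lmodType k) (f : U -> U') (g : W -> W') :
  linear f -> linear g -> bilinear_map (fun u w => tpure (f u) (g w)).
Proof.
have [hl hr] := tpure_bilinear U' W'.
by move=> hf hg; split=> [a u v w|a u w z]; rewrite ?hf ?hg ?hl ?hr.
Qed.

Section Complex.
Variables (R : lsubspace T) (A : algType k) (prA : {lrmorphism T -> A}).
Local Notation J := (J R).
Local Notation Jt := (Jt R).

Definition eps_A : A -> k :=
  xget (fun=> 0) [set e : A -> k^o |
    linear e /\ forall t, e (prA t) = eps_T t]%classic.

Definition KLR (i : nat) : lmodType k := tensor A (tensor (Jt i) A).
Definition KLR_pure i (a : A) (w : Jt i) (c : A) : KLR i :=
  tpure a (tpure w c).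
Definition KLR_lact i (a : A) : KLR i -> KLR i := tmap (fun b => a * b) idfun.
Definition KLR_ract i (c : A) : KLR i -> KLR i :=
  tmap idfun (tmap idfun (fun b => b * c)).

Definition bimodule_map i j (f : KLR i -> KLR j) : Prop :=
  [/\ linear f, forall a x, f (KLR_lact a x) = KLR_lact a (f x)
    & forall c x, f (KLR_ract c x) = KLR_ract c (f x)].

(* Here i + 1 is odd. *)
Definition deltab_odd_spec i (f : KLR i.+1 -> KLR i) : Prop :=
  forall (w : Jt i.+1) (s : seq (V * Jt i)) (t : seq (Jt i * V)),
    lsub_val w = \sum_(p <- s) tinj p.1 * lsub_val p.2 ->
    lsub_val w = \sum_(p <- t) lsub_val p.1 * tinj p.2 ->
    f (KLR_pure 1 w 1) =
      \sum_(p <- s) KLR_pure (prA (tinj p.1)) p.2 1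
      - \sum_(p <- t) KLR_pure 1 p.1 (prA (tinj p.2)).

(* Here i + 1 is even; wN N is the component of w indexed by N (there are no *)
(* components for N >= M), and s N l is a decomposition of it in             *)
(* V^(l) (x) J_i (x) V^(N - l).                                              *)
Definition deltab_even_spec i (f : KLR i.+1 -> KLR i) : Prop :=
  forall (w : Jt i.+1) (M : nat) (wN : nat -> T)
         (s : nat -> nat -> seq (T * Jt i * T)),
    lsub_val w = \sum_(N < M) wN N ->
    (forall N l, (N < M)%N -> (l <= N)%N ->
      (forall p, p \in s N l ->
         spow Vsub l p.1.1 /\ spow Vsub (N - l) p.2) /\
      wN N = \sum_(p <- s N l) p.1.1 * lsub_val p.1.2 * p.2) ->
    f (KLR_pure 1 w 1) =
      \sum_(N < M) \sum_(l < N.+1) \sum_(p <- s N l)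
        KLR_pure (prA p.1.1) p.1.2 (prA p.2).

(* deltab i is the differential of degree i + 1; the specification determines *)
(* it, as the bimodule KLR i.+1 is generated by the elements 1 (x) w (x) 1.    *)
Definition deltab_spec i (f : KLR i.+1 -> KLR i) : Prop :=
  bimodule_map f /\
  (if odd i then deltab_even_spec f else deltab_odd_spec f).

Definition deltab i : KLR i.+1 -> KLR i :=
  xget (fun=> 0) [set f | deltab_spec f]%classic.

(* The left complex: KLR i (x)_A k is identified with A (x) J_i by means of   *)
(* a (x) w (x) c |-> eps(c) a (x) w, which KLR_of_K is a section of.          *)

Definition K (i : nat) : lmodType k := tensor A (Jt i).
Definition K_lact i (a : A) : K i -> K i := tmap (fun b => a * b) idfun.

Definition K_of_KLR i (x : KLR i) : K i :=
  tlift (fun a y => tlift (fun w c => eps_A c *: tpure a w) y) x.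
Definition KLR_of_K i (x : K i) : KLR i := tlift (fun a w => KLR_pure a w 1) x.

Definition delta i (x : K i.+1) : K i := K_of_KLR (deltab (KLR_of_K x)).

Definition delta0 (x : K 0) : k :=
  @tlift k A (Jt 0) k^o (fun a w => eps_A a * eps_T (lsub_val w)) x.

Definition multi_koszul : Prop :=
  [/\ forall c : k, exists x, delta0 x = c,
      forall x, delta0 x = 0 <-> exists y, x = delta y
    & forall i (x : K i.+1), delta x = 0 <-> exists y, x = delta y].

End Complex.
End MultiKoszul.

Section Linearity.
Variables (k : fieldType) (V : lmodType k) (R : lsubspace (talg V)).
Variables (A : algType k) (prA : {lrmorphism talg V -> A}).
Local Notation KLR := (KLR R A).
Local Notation K := (K R A).

Fact eps_A_linear : linear (eps_A prA : A -> k^o).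
Proof.
rewrite /eps_A; case: xgetP => [e _ [] //|_] a u v.
by rewrite /= scaler0 addr0.
Qed.

Fact deltab_linear i : linear (@deltab _ _ R _ prA i).
Proof.
rewrite /deltab; case: xgetP => [f _ [[] //]|_] a u v.
by rewrite scaler0 addr0.
Qed.

Fact KLR_of_K_bilinear i :
  bilinear_map (fun (a : A) (w : Jt R i) => KLR_pure a w (1 : A)).
Proof.
have [hl hr] := tpure_bilinear A (tensor (Jt R i) A).
have [hl' hr'] := tpure_bilinear (Jt R i) A.
by split=> [a u v w|a u w z]; rewrite /KLR_pure ?hl' ?hl ?hr.
Qed.

Fact K_of_KLR_inner i (a : A) :
  bilinear_map (fun (w : Jt R i) (c : A) => eps_A prA c *: tpure a w).
Proof.
have [_ hr] := tpure_bilinear A (Jt R i).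
split=> [b u v w|b u w z]; first by rewrite hr scalerDr !scalerA mulrC.
by rewrite eps_A_linear scalerDl scalerA.
Qed.

Fact K_of_KLR_outer i :
  bilinear_map (fun (a : A) (y : tensor (Jt R i) A) =>
    tlift (fun w c => eps_A prA c *: tpure a w) y).
Proof.
have [hl _] := tpure_bilinear A (Jt R i).
split=> [a u v y|a u y z]; last by rewrite tlift_linear //; apply: K_of_KLR_inner.
rewrite /tlift scaler_sumr -big_split; apply: eq_bigr => p _ /=.
by rewrite hl scalerDr !scalerA mulrC.
Qed.

Fact delta_linear i : linear (@delta _ _ R _ prA i).
Proof.
move=> a u v; rewrite /delta /KLR_of_K tlift_linear; last exact: KLR_of_K_bilinear.
by rewrite deltab_linear /K_of_KLR tlift_linear //; apply: K_of_KLR_outer.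
Qed.

HB.instance Definition _ i :=
  GRing.isLinear.Build k (K i.+1) (K i) _ (@delta _ _ R _ prA i)
    (@delta_linear i).

End Linearity.

Section Cohomology.
Variables (k : fieldType) (V : lmodType k) (Vdeg : nat -> lsubspace V).
Variables (R : lsubspace (talg V)).
Variables (A : algType k) (prA : {lrmorphism talg V -> A}).
Local Notation T := (talg V).
Local Notation J := (J R).
Local Notation Jt := (Jt R).
Local Notation K := (K R A).
Local Notation delta := (delta prA).

Definition Adeg (n : nat) : lsubspace A :=
  lspan (fun a => exists2 t, Tdeg Vdeg n t & a = prA t).

Definition Kdeg i (n : int) : lsubspace (K i) :=
  lspan (fun x => exists (p q : nat) (a : A) (w : Jt i),
    [/\ Adeg p a, Tdeg Vdeg q (lsub_val w), n = (p + q)%N%:Z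
      & x = tpure a w]).

Definition A_linear i j (f : K i -> K j) : Prop :=
  linear f /\ forall a x, f (K_lact a x) = K_lact a (f x).

(* hom_A(K i, (K j)[d]) *)
Definition hom_deg i j (d : int) (f : K i -> K j) : Prop :=
  A_linear f /\ forall n x, Kdeg i n x -> Kdeg j (n + d) (f x).

Definition graded_hom i j (f : K i -> K j) : Prop :=
  exists2 s : seq (int * (K i -> K j)),
    (forall p, p \in s -> hom_deg p.1 p.2)
    & forall x, f x = \sum_(p <- s) p.2 x.

(* The cochains of the complex End_A(K): a family (f_j : K_j -> K_{j-i})_j is *)
(* encoded as a matrix F j l : K j -> K l vanishing unless j - l = i.         *)

Definition matrices : Type := forall j l, K j -> K l.

HB.instance Definition _ := gen_eqMixin matrices.
HB.instance Definition _ := gen_choiceMixin matrices.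

Definition mx0 : matrices := fun j l x => 0.
Definition mxopp (F : matrices) : matrices := fun j l x => - F j l x.
Definition mxadd (F G : matrices) : matrices := fun j l x => F j l x + G j l x.

Fact matrices_ext (F G : matrices) : (forall j l x, F j l x = G j l x) -> F = G.
Proof.
move=> h; apply: functional_extensionality_dep => j.
by apply: functional_extensionality_dep => l; apply/funext/h.
Qed.

Fact mxaddA : associative mxadd.
Proof. by move=> F G H; apply: matrices_ext => j l x; apply: addrA. Qed.
Fact mxaddC : commutative mxadd.
Proof. by move=> F G; apply: matrices_ext => j l x; apply: addrC. Qed.
Fact mxadd0 : left_id mx0 mxadd.
Proof. by move=> F; apply: matrices_ext => j l x; apply: add0r. Qed.
Fact mxaddN : left_inverse mx0 mxopp mxadd.
Proof. by move=> F; apply: matrices_ext => j l x; apply: addNr. Qed.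

HB.instance Definition _ :=
  GRing.isZmodule.Build matrices mxaddA mxaddC mxadd0 mxaddN.

Definition cochain (i : int) (F : matrices) : Prop :=
  (forall j l, graded_hom (F j l)) /\
  (forall j l, j%:Z - l%:Z <> i -> forall x, F j l x = 0).

(* F j.-1 l \o delta_j, where delta_0 = 0 *)
Definition precomp_delta (F : matrices) (j l : nat) : K j -> K l :=
  match j return K j -> K l with
  | 0 => fun=> 0
  | j'.+1 => fun x => F j' l (delta x)
  end.
Arguments precomp_delta F j l _ : clear implicits.

Definition cdiff (i : int) (F : matrices) : matrices :=
  fun j l x => delta (F j l.+1 x) - (-1) ^ i *: precomp_delta F j l x.

(* G is of degree i'. *)
Definition ccomp (i' : nat) (F G : matrices) : matrices :=
  fun j l x => F (j - i')%N l (G j (j - i')%N x).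

Arguments cdiff i F j l _ : clear implicits.
Arguments ccomp i' F G j l _ : clear implicits.

Definition is_cocycle (i : int) (F : matrices) : Prop :=
  cochain i F /\ cdiff i F = 0.

Definition is_coboundary (i : int) (F : matrices) : Prop :=
  exists2 H, cochain (i - 1) H & F = cdiff (i - 1) H.

Fact hom_deg0 i j d : hom_deg d (fun _ : K i => 0 : K j).
Proof.
have [_ hr] := tpure_bilinear A (Jt j).
split; last by move=> n x _; apply: lsub0.
split=> [a u v|a x]; first by rewrite scaler0 addr0.
have hb := tmap_bilinear (f := fun b : A => a * b) (g := @idfun (Jt j)).
rewrite -[0]/(tensor_zero A (Jt j)) /K_lact /tmap tlift_zero //; apply: hb => //.
by move=> b u v; rewrite mulrDr scalerAr.
Qed.

Fact K_lact_linear i (a : A) : linear (@K_lact _ _ R A i a).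
Proof.
apply: tlift_linear; apply: tmap_bilinear => // b u v.
by rewrite mulrDr scalerAr.
Qed.

Fact hom_degN i j d (f : K i -> K j) : hom_deg d f -> hom_deg d (fun x => - f x).
Proof.
move=> [[fl fA] fd]; split; last first.
  move=> n x /fd h; rewrite -[- _]addr0 -scaleN1r.
  by apply: lsubL => //; apply: lsub0.
split=> [a u v|a x]; first by rewrite fl opprD scalerN.
have hN (y : K j) : K_lact a (- y) = - K_lact a y.
  have := K_lact_linear (i := j) a (-1) y 0; rewrite addr0 !scaleN1r => ->.
  have := K_lact_linear (i := j) a (-1) 0 0.
  by rewrite addr0 scaler0 scaleN1r addNr => ->; rewrite addr0.
by rewrite fA hN.
Qed.

Fact graded_hom0 i j : graded_hom (fun _ : K i => 0 : K j).
Proof. by exists [::] => // x; rewrite big_nil. Qed.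

Fact graded_homB i j (f g : K i -> K j) :
  graded_hom f -> graded_hom g -> graded_hom (fun x => f x - g x).
Proof.
move=> [s hs fs] [t ht gt].
exists (s ++ [seq (p.1, fun x => - p.2 x) | p <- t]) => [p|x].
  by rewrite mem_cat => /orP[/hs //|/mapP[q /ht hq ->]]; apply: hom_degN.
by rewrite big_cat big_map /= fs gt sumrN.
Qed.

Fact hom_deg_comp i j l d e (f : K j -> K l) (g : K i -> K j) :
  hom_deg d f -> hom_deg e g -> hom_deg (e + d) (fun x => f (g x)).
Proof.
move=> [[fl fA] fd] [[gl gA] gd]; split.
  by split=> [a u v|a x]; rewrite ?gl ?fl ?gA ?fA.
by move=> n x /gd /fd; rewrite addrA.
Qed.

Fact graded_hom_linear i j (f : K i -> K j) : graded_hom f -> linear f.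
Proof.
move=> [s hs fs] a u v; rewrite !fs scaler_sumr -big_split.
rewrite big_seq [RHS]big_seq; apply: eq_bigr => p /hs [[pl _] _] /=.
exact: pl.
Qed.

Fact graded_hom_comp i j l (f : K j -> K l) (g : K i -> K j) :
  graded_hom f -> graded_hom g -> graded_hom (fun x => f (g x)).
Proof.
move=> hf hg; have [s hs fs] := hf; have [t ht gt] := hg.
exists [seq (q.1 + p.1, fun x => p.2 (q.2 x)) | p <- s, q <- t].
  by move=> _ /allpairsP[[p q] [/hs hp /ht hq ->]]; apply: hom_deg_comp.
move=> x; rewrite big_allpairs_dep fs /=.
rewrite big_seq [RHS]big_seq; apply: eq_bigr => p /hs [[pl _] _].
pose pL := GRing.isLinear.Build k (K j) (K l) _ p.2 pl.
pose pA : {linear K j -> K l} := HB.pack p.2 pL.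
by rewrite gt -[p.2]/(pA : K j -> K l) linear_sum.
Qed.

Fact graded_hom_eq0 i j (f : K i -> K j) : graded_hom f -> f 0 = 0.
Proof.
move=> /graded_hom_linear /(_ (-1) 0 0).
by rewrite scaler0 addr0 scaleN1r addNr.
Qed.

Fact graded_homZ i j (f : K i -> K j) a x : graded_hom f -> f (a *: x) = a *: f x.
Proof.
move=> hf; have := graded_hom_linear hf a x 0.
by rewrite addr0 (graded_hom_eq0 hf) addr0.
Qed.

Fact cochain0 i : cochain i 0.
Proof. by split=> // j l; apply: graded_hom0. Qed.

Fact cochainB i F G : cochain i F -> cochain i G -> cochain i (F - G).
Proof.
move=> [hF dF] [hG dG]; split=> [j l|j l ne x]; first exact: graded_homB.
by rewrite -[LHS]/(F j l x - G j l x) dF // dG // subr0.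
Qed.

Fact cdiffB i F G : cdiff i (F - G) = cdiff i F - cdiff i G.
Proof.
apply: matrices_ext => j l x.
rewrite -[RHS]/(cdiff i F j l x - cdiff i G j l x) /cdiff.
rewrite -[(F - G) j l.+1 x]/(F j l.+1 x - G j l.+1 x) linearB /=.
have -> : precomp_delta (F - G) j l x = precomp_delta F j l x - precomp_delta G j l x.
  by case: j x => //= x; rewrite subr0.
by rewrite scalerBr !opprB addrACA [RHS]addrACA; congr (_ + _); apply: addrC.
Qed.

Fact cdiff0 i : cdiff i 0 = 0.
Proof. by rewrite -[X in cdiff i X](subrr 0) cdiffB subrr. Qed.

Fact ccomp_cochain (i i' : nat) F G :
  cochain i%:Z F -> cochain i'%:Z G -> cochain (i + i')%N%:Z (ccomp i' F G).
Proof.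
move=> [hF dF] [hG dG]; split=> [j l|j l ne x]; first exact: graded_hom_comp.
rewrite /ccomp; case: (leqP i' j) => [le_j|lt_j].
  by apply: dF => e; apply: ne; rewrite PoszD -e -subzn // addrAC subrK.
rewrite dG; first exact: graded_hom_eq0.
move: lt_j => /[dup] /ltnW; rewrite -subn_eq0 => /eqP -> lt_j e.
by move: e; rewrite subr0 => -[e]; rewrite e ltnn in lt_j.
Qed.

Fact ccomp_cocycle (i i' : nat) F G :
  is_cocycle i%:Z F -> is_cocycle i'%:Z G ->
  is_cocycle (i + i')%N%:Z (ccomp i' F G).
Proof.
move=> [cF dF] [cG dG]; split; first exact: ccomp_cochain.
have {}dF j l x : delta (F j l.+1 x) = (-1) ^ i%:Z *: precomp_delta F j l x.
  by apply/eqP; rewrite -subr_eq0 -[X in X == _]/(cdiff i%:Z F j l x) dF.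
have {}dG j l x : delta (G j l.+1 x) = (-1) ^ i'%:Z *: precomp_delta G j l x.
  by apply/eqP; rewrite -subr_eq0 -[X in X == _]/(cdiff i'%:Z G j l x) dG.
have [hF _] := cF; have [hG gG] := cG.
apply: matrices_ext => j l x; apply/eqP; rewrite subr_eq0; apply/eqP.
rewrite /ccomp dF; case: (leqP j i') => [le_j|].
  have := le_j; rewrite -subn_eq0 => /eqP -> /=; rewrite scaler0.
  case: j le_j x => [|j] lt_j x /=; first by rewrite scaler0.
  have := ltnW lt_j; rewrite -subn_eq0 => /eqP ->.
  rewrite gG ?(graded_hom_eq0 (hF _ _)) ?scaler0 //.
  by rewrite subr0 => -[e]; rewrite e ltnn in lt_j.
case: j x => [//|j] x lt_j; rewrite (subSn (lt_j : (i' <= j)%N)) /= dG /=.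
by rewrite graded_homZ // scalerA -exprD.
Qed.

Definition in_cocycles (i : int) : {pred matrices} :=
  fun F => `[< is_cocycle i F >].

Fact in_cocycles_closed i : zmod_closed (in_cocycles i).
Proof.
split=> [|F G]; rewrite !unfold_in.
  by apply/asboolP; split; [apply: cochain0|apply: cdiff0].
move=> /asboolP[cF dF] /asboolP[cG dG]; apply/asboolP; split.
  exact: cochainB.
by rewrite cdiffB dF dG subrr.
Qed.

HB.instance Definition _ i :=
  GRing.isZmodClosed.Build matrices (in_cocycles i) (in_cocycles_closed i).

Record cocycle (i : int) := Cocycle {
  cocycle_val : matrices;
  cocycle_valP : cocycle_val \in in_cocycles i }.
Arguments cocycle_val {i} _ _ _ _.

HB.instance Definition _ i := [isSub for @cocycle_val i].
HB.instance Definition _ i := [Choice of cocycle i by <:].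
HB.instance Definition _ i := [SubChoice_isSubZmodule of cocycle i by <:].

Definition in_coboundaries (i : int) : {pred cocycle i} :=
  fun F => `[< is_coboundary i (cocycle_val F) >].
Arguments in_coboundaries i _ : clear implicits.

Fact in_coboundaries_closed i : zmod_closed (in_coboundaries i).
Proof.
split=> [|F G]; rewrite !unfold_in.
  by apply/asboolP; exists 0; [apply: cochain0|rewrite cdiff0].
move=> /asboolP[H cH FE] /asboolP[H' cH' GE]; apply/asboolP.
exists (H - H'); first exact: cochainB.
by rewrite cdiffB -FE -GE.
Qed.

HB.instance Definition _ i :=
  GRing.isZmodClosed.Build (cocycle i) (in_coboundaries i)
    (in_coboundaries_closed i).

(* Ext^i_A(k, k), as the cohomology of End_A(K) *)
Definition Ext (i : nat) := Quotient.quot (in_coboundaries i%:Z).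
HB.instance Definition _ i := EqQuotient.on (Ext i).
HB.instance Definition _ i := GRing.Zmodule.on (Ext i).

Fact cocycle_comp_subproof (i i' : nat) (F : cocycle i%:Z) (G : cocycle i'%:Z) :
  ccomp i' (cocycle_val F) (cocycle_val G) \in in_cocycles (i + i')%N%:Z.
Proof.
have /asboolP hF := cocycle_valP F; have /asboolP hG := cocycle_valP G.
exact/asboolP/ccomp_cocycle.
Qed.

Definition cocycle_comp (i i' : nat) (F : cocycle i%:Z) (G : cocycle i'%:Z) :
    cocycle (i + i')%N%:Z :=
  Cocycle (cocycle_comp_subproof F G).

Definition yoneda (i i' : nat) (x : Ext i) (y : Ext i') : Ext (i + i') :=
  \pi_(Ext (i + i')) (cocycle_comp (repr x) (repr y)).

(* (J_i)^# is the direct sum of the duals of the components of J_i. *)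
Definition graded_dual (i : nat) (f : Jt i -> k) : Prop :=
  linear (f : Jt i -> k^o) /\
  exists N, forall n w, (N <= n)%N -> Tdeg Vdeg n (lsub_val w) -> f w = 0.

(* (f_j)_j |-> (-1)^i delta_0 f_i, restricted to 1 (x) J_i; for multi-Koszul *)
(* algebras it is a bijection from Ext i to the graded dual of J_i, whose     *)
(* inverse is dual_to_ext.                                                    *)
Definition ext_to_dual (i : nat) (x : Ext i) : Jt i -> k :=
  fun w => (-1) ^+ i *
    delta0 prA (cocycle_val (repr x : cocycle i%:Z) i 0%N (tpure 1 w)).

Definition dual_to_ext (i : nat) (f : Jt i -> k) : Ext i :=
  xget 0 [set x | ext_to_dual x = f]%classic.

Definition yoneda_dual (i i' : nat) (f : Jt i -> k) (g : Jt i' -> k) :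
    Jt (i + i') -> k :=
  ext_to_dual (yoneda (dual_to_ext f) (dual_to_ext g)).

End Cohomology.

Section Iota.
Variables (k : fieldType) (V : lmodType k) (R : lsubspace (talg V)).
Local Notation T := (talg V).
Local Notation Jt := (Jt R).

(* The multiplication is injective on the abstract tensor products below;    *)
(* split2 and split3 are its inverse on its image.                            *)
Definition split2 i i' (w : T) : tensor (Jt i) (Jt i') :=
  xget 0 [set t | tlift (fun u v => lsub_val u * lsub_val v) t = w]%classic.

Definition split3 i i' (w : T) : tensor T (tensor (Jt i) (Jt i')) :=
  xget 0 [set t | tlift (fun x =>
    tlift (fun u v => x * (lsub_val u * lsub_val v))) t = w]%classic.

Definition iota_J (i i' : nat) (w : Jt (i + i')) : tensor (Jt i) (Jt i') :=
  if odd i && odd i' then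
    tlift (fun x y => eps_T x *: y) (split3 i i' (lsub_val w))
  else split2 i i' (lsub_val w).

(* The value of c_{J_i, J_i'} on f (x) g *)
Definition canon (i i' : nat) (f : Jt i -> k) (g : Jt i' -> k)
    (y : tensor (Jt i) (Jt i')) : k :=
  @tlift k (Jt i) (Jt i') k^o (fun v w => (-1) ^+ (i * i') * (f v * g w)) y.

End Iota.

(* Main.v *)
(* The minimality of R makes the multiplications T (x) R -> T and R (x) T -> T injective, and the same then holds with V or any J_i in place of R. All intersections and splittings of products are governed by this injectivity, and the left differential becomes a (x) w |-> sum a pi(t) (x) u, where w = sum t u in T J_{i-1}. For g in the dual of J_d, the maps a (x) w |-> g(v) a pi(t) (x) u with w = sum t u v in T J_l J_d commute with the differentials, hence form, up to signs, a cocycle lifting g; its reduction modulo the augmentation ideal is (id (x) g) o iota. Any other cocycle representing g differs from it by a null-homotopic one, which vanishes modulo the augmentation ideal. *)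
From HB Require Import structures.
From mathcomp Require Import all_boot all_order all_algebra.
From mathcomp Require Import boolp classical_sets functions.
Require Import Defs.

Set Implicit Arguments.
Unset Strict Implicit.
Unset Printing Implicit Defensive.

Import GRing.Theory.
Local Open Scope ring_scope.

(** * Linear algebra *)

Section LinearAlgebra.
Variable k : fieldType.
Implicit Types M N L : lmodType k.

(** The main obstacle is that [R] need not be homogeneous for word length, whereas the sum over N in
    the definition of J_{2(i+1)} splits an element by the number of letters outside the factors J.
    The components so obtained lie in the intersections, but in general not in R^(i+1). Memberships
    involving R are therefore known only for the whole element, the others only for its components.
    The two are combined by maps id (x) P on products with a free factor, P being a projection; this
    is why injectivity of a multiplication is recorded as a linear left inverse. A second constraint
    is that [eps_A], [deltab], [split2], [split3] and [dual_to_ext] are selected by [xget]. For each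
    of them either a witness is produced or the default value is shown to be harmless, and the
    statements are arranged to hold for whichever witness was selected. Finally, Ext is built from
    finite sums of homogeneous maps. So the J_i must be shown to be graded for the grading coming
    from V, and a functional must be cut into finitely many homogeneous ones before it is lifted. *)

Definition mklin M N (f : M -> N) (h : linear f) : {linear M -> N} :=
  HB.pack f (GRing.isLinear.Build k M N _ f h).

Lemma lsub_val_linear M (W : lsubspace M) : linear (@lsub_val _ _ W).
Proof. by move=> a u v; apply: (linearP (\val : {linear lsub_type W -> M})). Qed.

HB.instance Definition _ M (W : lsubspace M) :=
  GRing.isLinear.Build k (lsub_type W) M _ (@lsub_val _ _ W)
    (@lsub_val_linear M W).

Lemma lsub_val0 M (W : lsubspace M) : lsub_val (0 : lsub_type W) = 0.
Proof. exact: (linear0 (\val : {linear lsub_type W -> M})). Qed.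

Lemma lsub_inj M (W : lsubspace M) (u v : lsub_type W) :
  lsub_val u = lsub_val v -> u = v.
Proof. exact: val_inj. Qed.

Lemma lsub_valE M (W : lsubspace M) (u : lsub_type W) : W (lsub_val u).
Proof. by have := lsub_valP u; rewrite unfold_in => /asboolP. Qed.

Lemma lsub_lift M (W : lsubspace M) x : W x -> exists u : lsub_type W, lsub_val u = x.
Proof.
move=> Wx; have h : x \in in_lsub W by rewrite unfold_in; apply/asboolP.
by exists (LSub h).
Qed.

(** Equality instead of equivalence lets identities between products of subspaces, such as
    associativity, be used by rewriting. *)
Lemma lsub_eq M (W W' : lsubspace M) : (forall x, W x <-> W' x) -> W = W'.
Proof.
case: W W' => [W W0 WL] [W' W0' WL'] /= h.
have e : W = W' by apply/funext => x; apply/propext.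
by case: W' / e W0' WL' h => W0' WL' _; congr LSubspace; apply: Prop_irrelevance.
Qed.

Section Closure.
Variables (M : lmodType k) (W : lsubspace M).

Lemma lsubD u v : W u -> W v -> W (u + v).
Proof. by move=> Wu Wv; rewrite -[u]scale1r; apply: lsubL. Qed.
Lemma lsubZ a u : W u -> W (a *: u).
Proof. by move=> Wu; rewrite -[_ *: _]addr0; apply: lsubL => //; apply: lsub0. Qed.
Lemma lsubB u v : W u -> W v -> W (u - v).
Proof. by move=> Wu Wv; rewrite addrC -scaleN1r; apply: lsubL. Qed.
Lemma lsub_sum (I : Type) (s : seq I) (P : pred I) (F : I -> M) :
  (forall i, P i -> W (F i)) -> W (\sum_(i <- s | P i) F i).
Proof.
by move=> h; elim/big_ind: _ => //; [apply: lsub0|apply: lsubD].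
Qed.
End Closure.

Lemma lspan_in M (S : M -> Prop) x : S x -> lspan S x.
Proof.
move=> Sx; exists [:: (1, x)]; last by rewrite big_seq1 scale1r.
by move=> p; rewrite inE => /eqP ->.
Qed.

Lemma lspan_min M (S : M -> Prop) (W : lsubspace M) :
  (forall x, S x -> W x) -> forall x, lspan S x -> W x.
Proof.
move=> h x [s Ss ->]; rewrite big_seq; apply: lsub_sum => p /Ss Sp.
exact/lsubZ/h.
Qed.

Lemma lspan_morph M N (f : M -> N) (S : M -> Prop) (W : lsubspace N) x :
  linear f -> (forall x, S x -> W (f x)) -> lspan S x -> W (f x).
Proof.
move=> fL h [s Ss ->]; rewrite -[f _]/(mklin fL _) linear_sum big_seq.
apply: lsub_sum => p /Ss Sp; rewrite linearZ_LR.
exact/lsubZ/h.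
Qed.

Lemma lspan_mono M (S S' : M -> Prop) :
  (forall x, S x -> S' x) -> forall x, lspan S x -> lspan S' x.
Proof. by move=> h; apply: lspan_min => x /h; apply: lspan_in. Qed.

Fact eqz0 M N (f g : {linear M -> N}) : f 0 = g 0.
Proof. by rewrite !linear0. Qed.
Fact eqzL M N (f g : {linear M -> N}) a u v :
  f u = g u -> f v = g v -> f (a *: u + v) = g (a *: u + v).
Proof. by rewrite !linearP => -> ->. Qed.
(** The equalizer as a subspace: inductions stated for subspaces thereby prove identities between
    linear maps. *)
Definition leqz M N (f g : {linear M -> N}) : lsubspace M :=
  @LSubspace k M (fun x => f x = g x) (eqz0 f g) (@eqzL M N f g).

Fact image0 M N (f : {linear M -> N}) : exists x, 0 = f x.
Proof. by exists 0; rewrite linear0. Qed.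
Fact imageL M N (f : {linear M -> N}) a u v :
  (exists x, u = f x) -> (exists x, v = f x) -> exists x, a *: u + v = f x.
Proof. by move=> [x ->] [y ->]; exists (a *: x + y); rewrite linearP. Qed.
Definition limage M N (f : {linear M -> N}) : lsubspace N :=
  @LSubspace k N (fun y => exists x, y = f x) (image0 f) (@imageL M N f).

Section Eventually.
Variables (M N : lmodType k) (f g : nat -> {linear M -> N}).
Fact eventually0 : exists n, forall m, (n <= m)%N -> f m 0 = g m 0.
Proof. by exists 0%N => m _; rewrite !linear0. Qed.
Fact eventuallyL a u v :
  (exists n, forall m, (n <= m)%N -> f m u = g m u) ->
  (exists n, forall m, (n <= m)%N -> f m v = g m v) ->
  exists n, forall m, (n <= m)%N -> f m (a *: u + v) = g m (a *: u + v).
Proof.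
move=> [n hn] [n' hn']; exists (maxn n n') => m; rewrite geq_max => /andP[nm n'm].
by rewrite !linearP hn ?hn'.
Qed.
(** The threshold may depend on the vector. This serves approximations that become exact on each
    element, but not uniformly. *)
Definition leventually : lsubspace M :=
  @LSubspace k M _ eventually0 eventuallyL.
End Eventually.

Lemma lspan_eqz M N (f g : {linear M -> N}) (S : M -> Prop) :
  (forall x, S x -> f x = g x) -> forall x, lspan S x -> f x = g x.
Proof. by move=> h; apply: (@lspan_min M S (leqz f g)). Qed.

(** Zorn's lemma for the sets whose span meets [W] only in 0: a maximal one spans a complement,
    since a vector outside [C + W] could be adjoined to it. *)
Lemma complement M (W : lsubspace M) :
  exists2 C : lsubspace M, forall x, C x -> W x -> x = 0
    & forall x, exists2 c, C c & W (x - c).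
Proof.
pose indep (S : set M) := forall x, lspan (S : M -> Prop) x -> W x -> x = 0.
have [F FP Ftot|S [iS maxS]] := @Zorn_bigcup M (fun S => indep S).
  move=> x [s sF ->] Wx.
  (* A finite combination of vectors from the union of a chain already lives in one member of the
     chain. *)
  have [s0|[S FS sS]] : s = [::] \/ exists2 S, F S & forall p, p \in s -> S p.2.
  - elim: s sF {Wx} => [|p s IH] sF; [by left|right].
    have [S0 FS0 Sp] := sF p (mem_head _ _).
    have [q qs|s0|[S FS sS]] := IH; first by apply: sF; rewrite inE qs orbT.
      by exists S0 => // q; rewrite s0 inE => /eqP ->.
    have [le|le] := Ftot _ _ FS0 FS.
      by exists S => // q; rewrite inE => /orP[/eqP ->|/sS //]; apply: le.
    by exists S0 => // q; rewrite inE => /orP[/eqP -> //|/sS]; apply: le.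
  - by rewrite s0 big_nil.
  - by apply: (FP S) Wx => //; exists s.
exists (lspan (S : M -> Prop)) => [//|x].
have [[c Cc Wc]|nex] := EM (exists2 c, lspan (S : M -> Prop) c & W (x - c)).
  by exists c.
exfalso; apply: (maxS (fun y => S y \/ y = x)).
  split=> [y|le]; first by left.
  apply: nex; exists x; last by rewrite subrr; apply: lsub0.
  by apply: lspan_in; apply: le; right.
have split_x y : lspan (fun y => S y \/ y = x) y ->
    exists a, lspan (S : M -> Prop) (y - a *: x).
  move=> [s sS ->]; elim: s sS => [|p s IH] sS.
    by exists 0; rewrite big_nil scale0r subr0; apply: lspan0.
  have [q qs|a Ca] := IH; first by apply: sS; rewrite inE qs orbT.
  rewrite big_cons; have [Sp|->] := sS p (mem_head _ _).
    by exists a; rewrite -addrA; apply: lspanL => //; apply: lspan_in.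
  by exists (p.1 + a); rewrite scalerDl opprD addrACA subrr add0r.
move=> y /split_x [a Ca] Wy.
(* For nonzero [a], the vector [y] of [W] expresses [x] modulo [W] through the span of [S], against
   the choice of [x]. *)
have [a0|a0] := eqVneq a 0; first by apply: iS Wy; move: Ca; rewrite a0 scale0r subr0.
case: nex; exists (x - a^-1 *: y); last first.
  by rewrite opprB addrC addrNK; apply: lsubZ.
have -> : x - a^-1 *: y = - a^-1 *: (y - a *: x).
  by rewrite scalerBr scalerA mulNr mulVf // scaleN1r opprK addrC scaleNr.
exact: (@lsubZ _ (lspan (S : M -> Prop))).
Qed.

(** Uniqueness of the chosen value forces the choice function to be linear. *)
Lemma linear_choice M N (G : M -> N -> Prop) :
  (forall x, exists y, G x y) -> (forall x y z, G x y -> G x z -> y = z) ->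
  (forall a u v y z, G u y -> G v z -> G (a *: u + v) (a *: y + z)) ->
  exists f : {linear M -> N}, forall x, G x (f x).
Proof.
move=> /choice[f Gf] uG lG.
have fL : linear f by move=> a u v; apply: uG (Gf _) (lG _ _ _ _ _ (Gf u) (Gf v)).
by exists (mklin fL).
Qed.

Lemma projection M (W : lsubspace M) :
  exists P : {linear M -> M}, (forall x, W (P x)) /\ (forall x, W x -> P x = x).
Proof.
have [C CW hC] := complement W.
have [||a u v y z [Wy Cy] [Wz Cz]|P hP] :=
  @linear_choice M M (fun x y => W y /\ C (x - y)).
- by move=> x; have [c Cc Wc] := hC x; exists (x - c); rewrite subKr.
- move=> x y z [Wy Cy] [Wz Cz]; apply/eqP; rewrite -subr_eq0; apply/eqP.
  apply: CW; last exact: lsubB.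
  have -> : y - z = (x - z) - (x - y) by rewrite opprB [RHS]addrC addrA subrK.
  exact: lsubB.
- split; first exact: lsubL.
  have -> : a *: u + v - (a *: y + z) = a *: (u - y) + (v - z).
    by rewrite scalerBr opprD addrACA.
  exact: lsubL.
exists P; split=> [x|x Wx]; first by have [] := hP x.
have [WP CP] := hP x; apply/esym/eqP; rewrite -subr_eq0; apply/eqP/CW => //.
exact: lsubB.
Qed.

(** Preimages of the projection of [u] to the image of [f] differ by kernel elements; subtracting
    the projection to the kernel makes them unique. The result provides retractions, left inverses
    of injective maps, and preimages under [delta] that depend linearly on the element. *)
Lemma generalized_inverse M N (f : {linear M -> N}) :
  exists g : {linear N -> M}, forall x, f (g (f x)) = f x.
Proof.
have [p [Kp pK]] := projection (leqz f \0).
have [q [Iq qI]] := projection (limage f).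
have [||a u v _ _ [x [fx ->]] [y [fy ->]]|g hg] :=
  @linear_choice N M (fun u y => exists x, f x = q u /\ y = x - p x).
- by move=> u; have [x qx] := Iq u; exists (x - p x), x.
- move=> u _ _ [x [fx ->]] [y [fy ->]]; apply/eqP.
  have e : x - y = p x - p y by rewrite -(linearB p) pK //= linearB fx fy subrr.
  by rewrite subr_eq -addrA [- p y + _]addrC -e addrC subrK.
- exists (a *: x + y); rewrite (linearP f) (linearP p) (linearP q) fx fy.
  by split=> //; rewrite scalerBr addrACA opprD.
exists g => x; have [y [fy ->]] := hg (f x).
by rewrite linearB (Kp y) subr0 fy; apply: qI; exists x.
Qed.

Lemma lsub_retraction M (W : lsubspace M) :
  exists r : {linear M -> lsub_type W}, forall u, r (lsub_val u) = u.
Proof.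
have [r hr] := generalized_inverse (@lsub_val _ _ W : {linear _ -> _}).
by exists r => u; apply/lsub_inj/hr.
Qed.

(** A projection onto [W] need not preserve [Z]. Instead, an element of [Z] with the same residue
    [x - q x] is subtracted from [x], found by a generalized inverse on [Z]. On [W] the residue is
    0, and for [x] in [Z] the difference lies in [Z] and has residue 0. *)
Lemma projection_cap M (Z W : lsubspace M) :
  exists P : {linear M -> M}, (forall x, W x -> P x = x) /\
    (forall x, Z x -> Z (P x) /\ W (P x)).
Proof.
have [q [Wq qW]] := projection W.
have nL : linear (fun z : lsub_type Z => lsub_val z - q (lsub_val z)).
  by move=> a u v; rewrite lsub_val_linear (linearP q) opprD addrACA scalerBr.
have [s hs] := generalized_inverse (mklin nL).
have PL : linear (fun x => x - lsub_val (s (x - q x))).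
  move=> a u v; rewrite (linearP q) opprD addrACA -scalerBr (linearP s).
  by rewrite lsub_val_linear opprD addrACA scalerBr.
exists (mklin PL); split=> [x Wx|x /lsub_lift[z <-]] /=.
  by rewrite qW // subrr (linear0 s) lsub_val0 subr0.
split; first by apply: lsubB; apply: lsub_valE.
have := hs z; rewrite /= => /eqP; set y := s _ => /eqP h.
have -> : lsub_val z - lsub_val y = q (lsub_val z - lsub_val y).
  by rewrite linearB; apply/eqP; rewrite subr_eq addrAC -addrA h addrC subrK.
exact: Wq.
Qed.
End LinearAlgebra.

(** * Linear maps out of tensor products *)

Section TensorMaps.
Variable k : fieldType.
Implicit Types U W P : lmodType k.

Definition tliftL U W P (b : U -> W -> P) (hb : bilinear_map b) :
  {linear tensor U W -> P} := mklin (tlift_linear hb).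

Lemma tensor_ext_linear U W P (f g : {linear tensor U W -> P}) :
  (forall u w, f (tpure u w) = g (tpure u w)) -> f =1 g.
Proof.
move=> h x; rewrite (tensor_sum_pure x) !linear_sum.
by apply: eq_bigr => p _; apply: h.
Qed.

Lemma bilinear_comp U W P P' (f : {linear P -> P'}) (b : U -> W -> P) :
  bilinear_map b -> bilinear_map (fun u w => f (b u w)).
Proof. by move=> [bl br]; split=> a u v w; rewrite ?bl ?br (linearP f). Qed.

Lemma bilinear_pre U W U' W' P (g : {linear U' -> U}) (h : {linear W' -> W})
    (b : U -> W -> P) :
  bilinear_map b -> bilinear_map (fun u w => b (g u) (h w)).
Proof.
by move=> [bl br]; split=> a u v w; rewrite ?(linearP g) ?(linearP h) ?bl ?br.
Qed.

Lemma bilinear_mul (B : algType k) : bilinear_map (fun x y : B => x * y).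
Proof. by split=> a u v w; rewrite ?mulrDl -?scalerAl ?mulrDr -?scalerAr. Qed.

Lemma bilinear_scale U : bilinear_map (fun (c : k^o) (u : U) => (c : k) *: u).
Proof.
split=> a u v w; first by rewrite scalerDl scalerA.
by rewrite scalerDr !scalerA mulrC.
Qed.

Lemma bilinear_flip U W P (b : U -> W -> P) :
  bilinear_map b -> bilinear_map (fun w u => b u w).
Proof. by move=> [bl br]; split=> a u v w; rewrite ?bl ?br. Qed.

Lemma linear_left U W P (b : U -> W -> P) w : bilinear_map b -> linear (b^~ w).
Proof. by move=> [bl _] a u v; apply: bl. Qed.
Lemma linear_right U W P (b : U -> W -> P) u : bilinear_map b -> linear (b u).
Proof. by move=> [_ br] a w z; apply: br. Qed.

Lemma bilinear_suml U W P (b : U -> W -> P) (hb : bilinear_map b)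
    (I : Type) (s : seq I) (Q : pred I) (F : I -> U) w :
  b (\sum_(i <- s | Q i) F i) w = \sum_(i <- s | Q i) b (F i) w.
Proof. exact: (linear_sum (mklin (linear_left w hb))). Qed.
Lemma bilinear_sumr U W P (b : U -> W -> P) (hb : bilinear_map b)
    (I : Type) (s : seq I) (Q : pred I) (F : I -> W) u :
  b u (\sum_(i <- s | Q i) F i) = \sum_(i <- s | Q i) b u (F i).
Proof. exact: (linear_sum (mklin (linear_right u hb))). Qed.

Lemma lspan_bilinear U W P (b : U -> W -> P) (S : U -> Prop) (S' : W -> Prop)
    (Z : lsubspace P) u w : bilinear_map b ->
  (forall x y, S x -> S' y -> Z (b x y)) -> lspan S u -> lspan S' w -> Z (b u w).
Proof.
move=> hb h [s Ss ->] [t St ->].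
rewrite (bilinear_suml hb) big_seq; apply: lsub_sum => p /Ss Sp.
rewrite (bilinear_sumr hb) big_seq; apply: lsub_sum => q /St Sq.
rewrite bilinearZl //; apply: lsubZ.
by rewrite (bilinearZl _ _ _ (bilinear_flip hb)); apply/lsubZ/h.
Qed.

Definition tmapL U W U' W' (f : {linear U -> U'}) (g : {linear W -> W'}) :
    {linear tensor U W -> tensor U' W'} :=
  tliftL (tmap_bilinear (linearP f) (linearP g)).

Lemma tmapL_pure U W U' W' (f : {linear U -> U'}) (g : {linear W -> W'}) u w :
  tmapL f g (tpure u w) = tpure (f u) (g w).
Proof. exact: (tlift_pure _ _ (tmap_bilinear (linearP f) (linearP g))). Qed.

Lemma tliftL_pure U W P (b : U -> W -> P) (hb : bilinear_map b) u w :
  tliftL hb (tpure u w) = b u w.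
Proof. exact: tlift_pure. Qed.

Lemma tensor_ind U W (Z : lsubspace (tensor U W)) :
  (forall u w, Z (tpure u w)) -> forall x, Z x.
Proof. by move=> h x; rewrite (tensor_sum_pure x); apply: lsub_sum. Qed.

Lemma tpure0l U W w : tpure 0 w = 0 :> tensor U W.
Proof. exact: bilinear0l (tpure_bilinear U W). Qed.
End TensorMaps.

(** * Endomorphism algebras and recursion on words *)

Section Endomorphisms.
Variables (k : fieldType) (M : lmodType k).
(* Adjoining k to M makes the endomorphism ring nontrivial. *)
Local Notation N := (k^o * M)%type.

Record endo := Endo { endo_fun : N -> N; endo_lin : linear endo_fun }.

HB.instance Definition _ := gen_eqMixin endo.
HB.instance Definition _ := gen_choiceMixin endo.

Lemma endo_ext (f g : endo) : endo_fun f =1 endo_fun g -> f = g.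
Proof.
case: f g => [f fl] [g gl] /= /funext e; case: g / e gl => gl.
by congr Endo; apply: Prop_irrelevance.
Qed.

Fact endo0_lin : linear (fun _ : N => 0 : N).
Proof. by move=> a u v; rewrite scaler0 addr0. Qed.
Fact endo1_lin : linear (fun x : N => x).
Proof. by []. Qed.
Fact endoD_lin (f g : endo) : linear (fun x => endo_fun f x + endo_fun g x).
Proof. by move=> a u v; rewrite !endo_lin scalerDr addrACA. Qed.
Fact endoZ_lin a (f : endo) : linear (fun x => a *: endo_fun f x).
Proof. by move=> b u v; rewrite endo_lin scalerDr !scalerA mulrC. Qed.
Fact endoM_lin (f g : endo) : linear (fun x => endo_fun f (endo_fun g x)).
Proof. by move=> a u v; rewrite !endo_lin. Qed.

Definition endo0 := Endo endo0_lin.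
Definition endo1 := Endo endo1_lin.
Definition endoD f g := Endo (endoD_lin f g).
Definition endoZ a f := Endo (endoZ_lin a f).
Definition endoN f := endoZ (-1) f.
Definition endoM f g := Endo (endoM_lin f g).

Fact endoDA : associative endoD.
Proof. by move=> f g h; apply: endo_ext => x; apply: addrA. Qed.
Fact endoDC : commutative endoD.
Proof. by move=> f g; apply: endo_ext => x; apply: addrC. Qed.
Fact endoD0 : left_id endo0 endoD.
Proof. by move=> f; apply: endo_ext => x; apply: add0r. Qed.
Fact endoDN : left_inverse endo0 endoN endoD.
Proof. by move=> f; apply: endo_ext => x; rewrite /= scaleN1r addNr. Qed.
HB.instance Definition _ :=
  GRing.isZmodule.Build endo endoDA endoDC endoD0 endoDN.

Fact endoMA : associative endoM. Proof. by move=> f g h; apply: endo_ext. Qed.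
Fact endoM1 : left_id endo1 endoM. Proof. by move=> f; apply: endo_ext. Qed.
Fact endoM1r : right_id endo1 endoM. Proof. by move=> f; apply: endo_ext. Qed.
Fact endoMDl : left_distributive endoM endoD.
Proof. by move=> f g h; apply: endo_ext. Qed.
Fact endoMDr : right_distributive endoM endoD.
Proof.
move=> f g h; apply: endo_ext => x /=.
by rewrite -[endo_fun g x]scale1r endo_lin !scale1r.
Qed.
Fact endo1_neq0 : endo1 != endo0.
Proof.
apply/eqP => /(congr1 (fun f => (endo_fun f (1, 0)).1)) /= /eqP.
by rewrite oner_eq0.
Qed.
HB.instance Definition _ := GRing.Zmodule_isNzRing.Build endo
  endoMA endoM1 endoM1r endoMDl endoMDr endo1_neq0.

Fact endoZA a b f : endoZ a (endoZ b f) = endoZ (a * b) f.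
Proof. by apply: endo_ext => x; apply: scalerA. Qed.
Fact endoZ1 : left_id 1 endoZ.
Proof. by move=> f; apply: endo_ext => x; apply: scale1r. Qed.
Fact endoZDr : right_distributive endoZ +%R.
Proof. by move=> a f g; apply: endo_ext => x; apply: scalerDr. Qed.
Fact endoZDl f : {morph endoZ^~ f : a b / a + b}.
Proof. by move=> a b; apply: endo_ext => x; apply: scalerDl. Qed.
HB.instance Definition _ := GRing.Zmodule_isLmodule.Build k endo
  endoZA endoZ1 endoZDr endoZDl.

Fact endoZAl (a : k) (f g : endo) : a *: (f * g) = a *: f * g.
Proof. exact: endo_ext. Qed.
HB.instance Definition _ := GRing.Lmodule_isLalgebra.Build k endo endoZAl.
Fact endoZAr (a : k) (f g : endo) : a *: (f * g) = f * (a *: g).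
Proof.
apply: endo_ext => x /=.
have := endo_lin f a (endo_fun g x) 0.
have -> : endo_fun f 0 = 0.
  by have := endo_lin f (-1) 0 0; rewrite scaler0 addr0 scaleN1r addNr.
by rewrite !addr0.
Qed.
HB.instance Definition _ := GRing.Lalgebra_isAlgebra.Build k endo endoZAr.

End Endomorphisms.

Section TensorAlgebraRec.
Variables (k : fieldType) (V : lmodType k).
Local Notation T := (talg V).

HB.instance Definition _ :=
  GRing.isLinear.Build k V T _ (@tinj k V) (@tinj_linear k V).

Lemma talg_ind (W : lsubspace T) :
  W 1 -> (forall v t, W t -> W (tinj v * t)) -> forall t, W t.
Proof.
move=> W1 Wv t; rewrite (talg_sum_words t); apply: lsub_sum => p _.
apply: lsubZ; elim: p.2 => [|v s IH]; first by rewrite big_nil.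
by rewrite big_cons; apply: Wv.
Qed.

Lemma talg_ext_linear (M : lmodType k) (f g : {linear T -> M}) :
  f 1 = g 1 -> (forall v t, f t = g t -> f (tinj v * t) = g (tinj v * t)) ->
  f =1 g.
Proof. exact: (@talg_ind (leqz f g)). Qed.

(* The universal property of T, applied to an endomorphism algebra: letting v act by act v makes M a T-module. *)
Lemma talg_rec (M : lmodType k) (act : V -> M -> M) (m0 : M) :
  bilinear_map act ->
  exists f : {linear T -> M}, f 1 = m0 /\ forall v t, f (tinj v * t) = act v (f t).
Proof.
move=> bact; have [actl actr] := bact.
have aL v : linear (fun x : k^o * M => (0 : k^o, act v x.2)).
  move=> a x y; rewrite /= actr; congr (_, _); rewrite /=.
  by rewrite scaler0 addr0.
pose e v := Endo (aL v).
have eL : linear e.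
  move=> a u v; apply: endo_ext => x /=; congr pair => //=.
  by rewrite scaler0 addr0.
pose phi x := talg_lift (mklin eL) x.
have fL : linear (fun t => (endo_fun (phi t) (0, m0)).2).
  by move=> a u v; rewrite /phi talg_liftD talg_liftZ.
exists (mklin fL); split=> [|v t] /=; first by rewrite /phi talg_lift1.
by rewrite /phi talg_liftM talg_lift_tinj.
Qed.

End TensorAlgebraRec.

(** All components of an element at once, as a target for a single linear map; finiteness of the
    support is stated separately by [fin_sum]. *)
Definition sequences (k : fieldType) (M : lmodType k) : lmodType k := (nat -> M).

(** * Gradings *)

Section Gradings.
Variables (k : fieldType) (M : lmodType k).

Definition fin_sum (x : M) (a : nat -> M) (n : nat) : Prop :=
  (forall i, (n <= i)%N -> a i = 0) /\ x = \sum_(i < n) a i.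

Lemma fin_sum_widen x a n m : (n <= m)%N -> fin_sum x a n -> fin_sum x a m.
Proof.
move=> nm [a0 ->]; split=> [i mi|]; first exact/a0/(leq_trans nm).
rewrite (big_ord_widen m a nm) [RHS](bigID (fun i : 'I_m => (i < n)%N)) /=.
rewrite [X in _ = _ + X]big1 ?addr0 // => i.
by rewrite -leqNgt; apply: a0.
Qed.

Lemma fin_sum_linear c x y a b n m : fin_sum x a n -> fin_sum y b m ->
  fin_sum (c *: x + y) (fun i => c *: a i + b i) (maxn n m).
Proof.
move=> /(fin_sum_widen (leq_maxl n m))[a0 ->].
move=> /(fin_sum_widen (leq_maxr n m))[b0 ->]; split=> [i mi|].
  by rewrite a0 // b0 // scaler0 addr0.
by rewrite scaler_sumr -big_split.
Qed.

Lemma fin_sum_single x n : fin_sum x (fun m => if m == n then x else 0) n.+1.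
Proof.
split=> [i ni|]; first by rewrite gtn_eqF.
rewrite (bigD1 ord_max) //= eqxx big1 ?addr0 // => i.
by rewrite -val_eqE /= => /negbTE ->.
Qed.

Definition graded_by (G : nat -> lsubspace M) (pr : {linear M -> sequences M}) :=
  [/\ forall n x, G n (pr x n),
      forall n m x, G n x -> pr x m = if m == n then x else 0
    & forall x, exists n, fin_sum x (pr x) n].

Lemma grading_projections (G : nat -> lsubspace M) :
  is_grading G -> exists pr, graded_by G pr.
Proof.
move=> [Gsum Guniq].
pose dec x (a : nat -> M) := (forall i, G i (a i)) /\ exists n, fin_sum x a n.
have decU x a b : dec x a -> dec x b -> a = b.
  move=> [Ga [n an]] [Gb [m bm]]; apply/funext => i.
  have [_ e] := fin_sum_linear (-1) an bm.
  have [im|mi] := ltnP i (maxn n m).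
    apply/esym/eqP; rewrite -subr_eq0; apply/eqP.
    rewrite addrC -scaleN1r.
    apply: (Guniq _ (fun i => -1 *: a i + b i) _ _ _ im) => [j|].
      exact: lsubL.
    by rewrite -e scaleN1r addNr.
  have [a0 _] := fin_sum_widen (leq_maxl n m) an.
  have [b0 _] := fin_sum_widen (leq_maxr n m) bm.
  by rewrite a0 ?b0.
have [|//|c x y a b|pr hpr] := @linear_choice k M (sequences M) dec.
- move=> x; have [n [a [Ga ->]]] := Gsum x.
  exists (fun i => if (i < n)%N then a i else 0); split.
    by move=> i; case: ifP => // _; apply: lsub0.
  exists n; split=> [i|]; first by rewrite ltnNge => ->.
  by apply: eq_bigr => i _; rewrite ltn_ord.
- move=> [Ga [n an]] [Gb [m bm]]; split=> [i|]; first exact: lsubL.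
  by exists (maxn n m); apply: fin_sum_linear.
exists pr; split=> [n x|n m x Gx|x]; try by have [] := hpr x.
have /(decU _ _ _ (hpr x)) -> // : dec x (fun m => if m == n then x else 0).
split=> [i|]; first by case: eqP => [->|_] //; apply: lsub0.
by exists n.+1; apply: fin_sum_single.
Qed.

Lemma graded_by_span (G : nat -> lsubspace M) pr x :
  graded_by G pr -> lspan (fun y => exists n, G n y) x.
Proof.
move=> [Gpr _ /(_ x)[n [_ ->]]]; apply: lsub_sum => i _.
by apply: lspan_in; exists i.
Qed.

End Gradings.

Section TensorGrading.
Variables (k : fieldType) (V : lmodType k).
Local Notation T := (talg V).
Variables (Vdeg : nat -> lsubspace V).
Hypothesis Vgr : is_grading Vdeg.

Lemma Tdeg_one : Tdeg Vdeg 0 1.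
Proof. by apply: lspan_in; exists [::]; split=> //; rewrite big_nil. Qed.

Lemma Tdeg_tinj n v : Vdeg n v -> Tdeg Vdeg n (tinj v).
Proof.
move=> Vv; apply: lspan_in; exists [:: (n, v)]; split=> [p||].
- by rewrite inE => /eqP ->.
- by rewrite /= addn0.
- by rewrite big_seq1.
Qed.

Lemma Tdeg_mul m n x y : Tdeg Vdeg m x -> Tdeg Vdeg n y -> Tdeg Vdeg (m + n) (x * y).
Proof.
apply: (lspan_bilinear (bilinear_mul T)) => {}x {}y.
move=> [s [sV ss ->]] [t [tV st ->]].
apply: lspan_in; exists (s ++ t); split; last by rewrite big_cat.
  by move=> p; rewrite mem_cat => /orP[/sV|/tV].
by rewrite map_cat sumn_cat ss st.
Qed.

Lemma Tdeg_span x : lspan (fun y => exists n, Tdeg Vdeg n y) x.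
Proof.
have [pv gV] := grading_projections Vgr.
apply: (@talg_ind _ _ (lspan (fun y => exists n, Tdeg Vdeg n y))) x => [|v t ht].
  by apply: lspan_in; exists 0%N; apply: Tdeg_one.
pose b := bilinear_pre (@tinj k V : {linear _ -> _}) idfun (bilinear_mul T).
apply: (lspan_bilinear b) (graded_by_span v gV) ht => {}v {}t [m hm] [n hn] /=.
by apply: lspan_in; exists (m + n)%N; apply: Tdeg_mul => //; apply: Tdeg_tinj.
Qed.

(** [Tdeg] is defined by spans, so directness has to come from a map. Letting [v] act on sequences
    by convolution with its own components, and starting from the unit sequence, defines all
    components of a word by [talg_rec]. *)
Lemma tensor_grading : exists pr : {linear T -> sequences T},
  graded_by (Tdeg Vdeg) pr /\
  forall n m x y, Tdeg Vdeg n x ->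
    pr (x * y) m = if (n <= m)%N then x * pr y (m - n)%N else 0.
Proof.
have [pv [Vpv pvE Vfin]] := grading_projections Vgr.
pose act v (s : nat -> T) : nat -> T :=
  fun n => \sum_(i < n.+1) tinj (pv v i) * s (n - i)%N.
have bact : bilinear_map act.
  split=> a u v w; apply/funext => n.
    rewrite -[RHS]/(a *: act u w n + act v w n) /act scaler_sumr -big_split.
    apply: eq_bigr => i _; rewrite linearP -[(a *: pv u + pv v) i]/(a *: pv u i + pv v i).
    by rewrite linearP /= mulrDl scalerAl.
  rewrite -[RHS]/(a *: act u v n + act u w n) /act scaler_sumr -big_split.
  apply: eq_bigr => i _; rewrite -[(a *: v + w) _]/(a *: v (n - i)%N + w (n - i)%N).
  by rewrite mulrDr scalerAr.
have [pr [pr1 prV]] := @talg_rec k V (sequences T) act (fun n => (n == 0%N)%:R : T) bact.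
have prv n m v t : Vdeg n v ->
    pr (tinj v * t) m = if (n <= m)%N then tinj v * pr t (m - n)%N else 0.
  move=> Vv; rewrite prV /act; have [nm|mn] := leqP n m; last first.
    rewrite big1 // => i _; rewrite (pvE n) // ltn_eqF ?linear0 ?mul0r //.
    by apply: leq_ltn_trans mn; rewrite -ltnS.
  rewrite (bigD1 (Ordinal (nm : (n < m.+1)%N))) //= (pvE n) // eqxx big1 ?addr0 //.
  move=> i ne; rewrite (pvE n) // -[_ == n]/(i == Ordinal (nm : (n < m.+1)%N)).
  by rewrite (negbTE ne) linear0 mul0r.
have prs (s : seq (nat * V)) m y : (forall p, p \in s -> Vdeg p.1 p.2) ->
    pr ((\prod_(p <- s) tinj p.2) * y) m =
    if (sumn [seq p.1 | p <- s] <= m)%N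
    then (\prod_(p <- s) tinj p.2) * pr y (m - sumn [seq p.1 | p <- s])%N else 0.
  elim: s m => [|p s IH] m sV; first by rewrite big_nil !mul1r subn0.
  rewrite big_cons -!mulrA (prv p.1) ?IH /=; last 2 first.
  - by move=> q qs; apply: sV; rewrite inE qs orbT.
  - by apply: sV; rewrite mem_head.
  have [pm|mp] := leqP p.1 m; last by rewrite leqNgt (leq_trans mp) ?leq_addr.
  by rewrite leq_subRL // subnDA; case: ifP => // _; rewrite ?mulrA // mulr0.
have prx n m x y : Tdeg Vdeg n x ->
    pr (x * y) m = if (n <= m)%N then x * pr y (m - n)%N else 0.
  have evl j : linear (fun x => pr (x * y) j).
    by move=> a u v; rewrite mulrDl -scalerAl linearP.
  have evr : linear (fun x => if (n <= m)%N then x * pr y (m - n)%N else 0).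
    by move=> a u v; case: ifP => _; rewrite ?scaler0 ?addr0 // mulrDl scalerAl.
  apply: (lspan_eqz (f := mklin (evl m)) (g := mklin evr)) => {}x [s [sV sn ->]] /=.
  by rewrite -sn; apply: prs.
have prE n m x : Tdeg Vdeg n x -> pr x m = if m == n then x else 0.
  move=> hx; rewrite -[x in pr x]mulr1 (prx n) // pr1.
  rewrite subn_eq0 eqn_leq; case: leqP => [_|]; last by rewrite andbF.
  by case: leqP => _; rewrite ?mulr1 ?mulr0.
exists pr; split=> //; split=> //.
- move=> n x.
  have ev : linear (fun x => pr x n) by move=> a u v; rewrite linearP.
  apply: (lspan_morph ev _ (Tdeg_span x)) => {}x [m hx].
  by rewrite (prE m) //; case: eqP => [->|_] //; apply: lsub0.
- move=> x; have := Tdeg_span x; move=> [s sT ->].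
  elim: s sT => [|p s IH] sT.
    by exists 0%N; rewrite big_nil; split=> [i _|]; rewrite ?linear0 ?big_ord0.
  have [q qs|m hm] := IH; first by apply: sT; rewrite inE qs orbT.
  have [n hn] := sT p (mem_head _ _).
  have ps : fin_sum p.2 (pr p.2) n.+1.
    have -> : pr p.2 = (fun m => if m == n then p.2 else 0).
      by apply/funext => i; apply: prE.
    exact: fin_sum_single.
  exists (maxn n.+1 m); rewrite big_cons linearP.
  exact: (fin_sum_linear p.1 ps hm).
Qed.

Lemma tensor_grading_right pr n m x y : graded_by (Tdeg Vdeg) pr ->
  (forall n m x y, Tdeg Vdeg n x ->
    pr (x * y) m = if (n <= m)%N then x * pr y (m - n)%N else 0) ->
  Tdeg Vdeg n y -> pr (x * y) m = if (n <= m)%N then pr x (m - n)%N * y else 0.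
Proof.
move=> [_ prE _] prx hy.
have fl : linear (fun x => pr (x * y) m).
  by move=> a u v; rewrite mulrDl -scalerAl linearP.
have fr : linear (fun x => if (n <= m)%N then pr x (m - n)%N * y else 0).
  move=> a u v; case: ifP => _; rewrite ?scaler0 ?addr0 //.
  by rewrite linearP mulrDl scalerAl.
apply: (lspan_eqz (f := mklin fl) (g := mklin fr)) (Tdeg_span x) => {}x [a hx] /=.
rewrite (prx a) // (prE n) // (prE a) //.
have [am|ma] := leqP a m; have [nm|mn] := leqP n m; rewrite ?mul0r //.
- have -> : (m - a == n)%N = (m - n == a)%N.
    by rewrite -(eqn_add2r a) -[RHS](eqn_add2r n) !subnK // addnC.
  by case: eqP; rewrite ?mul0r ?mulr0.
- case: eqP; rewrite ?mulr0 // => e; move: mn.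
  by rewrite ltnNge -e leq_subr.
- case: eqP; rewrite ?mul0r // => e; move: ma.
  by rewrite ltnNge -e leq_subr.
Qed.

End TensorGrading.

(** * Free factors of products in T *)

(* The product op stands for the multiplication of T or its opposite, so that each statement covers both sides. *)
Section Free.
Variables (k : fieldType) (V : lmodType k).
Local Notation T := (talg V).
Variable op : T -> T -> T.
Hypothesis bop : bilinear_map op.

Definition oprod (X Y : lsubspace T) : lsubspace T :=
  lspan (fun x => exists u v, [/\ X u, Y v & x = op u v]).

(** Injectivity of the multiplication on [W] and T, in the form of a linear left inverse, through
    which maps given on pure tensors can be pulled back to T. *)
Definition factor_free (W : lsubspace T) : Prop :=
  exists D : {linear T -> tensor T T}, forall w t, W w -> D (op w t) = tpure w t.

Lemma free_sub (X Y : lsubspace T) : (forall x, X x -> Y x) -> factor_free Y -> factor_free X.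
Proof. by move=> XY [D hD]; exists D => w t /XY; apply: hD. Qed.

Lemma free_ext W (P Q : {linear T -> T}) : factor_free W ->
  exists F : {linear T -> T}, forall w t, W w -> F (op w t) = op (P w) (Q t).
Proof.
move=> [D hD]; have hb := bilinear_pre P Q bop.
have FL : linear (fun x => tliftL hb (D x)) by move=> a u v; rewrite !linearP.
by exists (mklin FL) => w t Ww; rewrite /= hD // (tlift_pure _ _ hb).
Qed.

(** With [P] from [projection_cap], the map id (x) P fixes [Y Z'] and sends [Y Z] into the product
    of [Y] with the intersection. *)
Lemma oprod_capr Y Z Z' x : factor_free Y ->
  oprod Y Z x -> oprod Y Z' x -> oprod Y (lcap Z Z') x.
Proof.
move=> /free_ext fY YZ YZ'; have [P [PZ' PZ]] := projection_cap Z Z'.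
have [F hF] := fY idfun P.
have <- : F x = x.
  apply: (lspan_eqz (g := idfun)) YZ' => x0 [y [z [Yy Zz ->]]].
  by rewrite hF // PZ'.
apply: (lspan_morph (linearP F) _ YZ) => x0 [y [z [Yy /PZ[Zz Z'z] ->]]].
by rewrite hF //; apply: lspan_in; exists y, (P z).
Qed.

(** Projecting the first factor from [Y] to [X] fixes [X Z'] and sends [Y Z] into [X Z]. This
    narrows a factor such as R^n to J_{2n} without losing what is known about the other factor. *)
Lemma oprod_subl (X Y Z Z' : lsubspace T) x : factor_free Y -> (forall y, X y -> Y y) ->
  oprod X Z' x -> oprod Y Z x -> oprod X Z x.
Proof.
move=> /free_ext fY XY XZ' YZ; have [P [XP PX]] := projection X.
have [F hF] := fY P idfun.
have <- : F x = x.
  apply: (lspan_eqz (g := idfun)) XZ' => x0 [y [z [Xy Zz ->]]].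
  by rewrite hF ?PX //; apply: XY.
apply: (lspan_morph (linearP F) _ YZ) => x0 [y [z [Yy Zz ->]]].
by rewrite hF //; apply: lspan_in; exists (P y), z.
Qed.

Hypotheses (op1 : forall x, op x 1 = x) (op1l : forall x, op 1 x = x).
Hypothesis opA : forall x y z, op (op x y) z = op x (op y z).

Lemma free_one : factor_free (scalars V).
Proof.
have DL : linear (fun t : T => tpure (1 : T) t : tensor T T).
  exact: linear_right (tpure_bilinear T T).
exists (mklin DL) => w t hw /=.
have h1 : linear (fun w => tpure (1 : T) (op w t) : tensor T T).
  by move=> a u v; rewrite (linear_left _ bop) DL.
have h2 : linear (fun w => tpure w t : tensor T T).
  exact: linear_left (tpure_bilinear T T).
apply: (lspan_eqz (f := mklin h1) (g := mklin h2)) hw => {}w /= ->.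
by rewrite op1l.
Qed.

(** [D] detaches the factor in [X], [E] then the one in [Y], and the two are multiplied together
    again. *)
Lemma free_oprod X Y : factor_free X -> factor_free Y -> factor_free (oprod X Y).
Proof.
move=> [D hD] [E hE].
have hb (x : T) : linear (fun z : tensor T T => tlift (fun y t => tpure (op x y) t) z : tensor T T).
  have hbx := bilinear_pre (mklin (linear_right x bop)) idfun (tpure_bilinear T T).
  exact: (linearP (tliftL hbx)).
have hB : bilinear_map (fun x t => tlift (fun y t => tpure (op x y) t) (E t) : tensor T T).
  split=> [a u v t|a x u v]; last by rewrite (linearP E) hb.
  move: (E t) => z; rewrite /tlift scaler_sumr -big_split; apply: eq_bigr => p _ /=.
  by rewrite (linear_left _ bop) (linear_left _ (tpure_bilinear T T)).
have FL : linear (fun x => tliftL hB (D x)) by move=> a u v; rewrite !linearP.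
exists (mklin FL) => w t hw /=.
have h1 : linear (fun w => tliftL hB (D (op w t))).
  by move=> a u v; rewrite (linear_left _ bop) !linearP.
have h2 : linear (fun w => tpure w t : tensor T T).
  exact: linear_left (tpure_bilinear T T).
apply: (lspan_eqz (f := mklin h1) (g := mklin h2)) hw => {}w [x [y [Xx Yy ->]]] /=.
rewrite opA hD // (tlift_pure _ _ hB) hE //.
have hbx := bilinear_pre (mklin (linear_right x bop)) idfun (tpure_bilinear T T).
exact: (tlift_pure _ _ hbx).
Qed.

(* E splits off the last letter; iterating it recovers the tensor that a sum of products comes from. *)
Lemma free_of_minimal (W : lsubspace T) (E : {linear T -> tensor T T}) :
  E 1 = 0 -> (forall t v, E (op t (tinj v)) = tpure t (tinj v)) ->
  (forall Z : lsubspace T, Z 1 -> (forall t v, Z t -> Z (op t (tinj v))) ->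
    forall t, Z t) ->
  (forall x, W x ->
    lspan (fun y => exists w t v, W w /\ y = op w (op t (tinj v))) x -> x = 0) ->
  factor_free W.
Proof.
move=> E1 Ev opind Wmin.
pose W' : lsubspace T := lspan (fun y => exists w t v, W w /\ y = op w (op t (tinj v))).
(* [P] fixes [W] and sends [W'] into the intersection of [W'] and [W], which is 0 by minimality. *)
have [P [PW PW']] := projection_cap W' W.
have {}PW' x : W' x -> P x = 0.
  by move=> /PW'[W'P WP]; apply: Wmin.
have Db (D : {linear T -> tensor T T}) :
    bilinear_map (fun y v => tlift (fun r t => tpure r (op t v)) (D y) : tensor T T).
  have hbv v := bilinear_pre idfun (mklin (linear_left v bop)) (tpure_bilinear T T).
  split=> [a u w v|a y u v].
    by rewrite (linearP D); apply: (linearP (tliftL (hbv v))).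
  rewrite /tlift scaler_sumr -big_split; apply: eq_bigr => p _ /=.
  by rewrite (linear_right _ bop) (linear_right _ (tpure_bilinear T T)).
have stepL (D : {linear T -> tensor T T}) :
    linear (fun x => tpure (P x) (1 : T) + tliftL (Db D) (E (x - P x))).
  move=> a u v; rewrite (linearP P) (linear_left _ (tpure_bilinear T T)).
  by rewrite opprD addrACA -scalerBr !linearP scalerDr addrACA.
(* [P x (x) 1] is the part with nothing after [W]; the rest loses its last letter, is split by the
   previous round and gets the letter back. Thus [n] rounds split [w t] for words [t] of length less
   than [n]. *)
pose D n := iter n (fun D => mklin (stepL D)) \0.
have DS n x : D n.+1 x = tpure (P x) (1 : T) + tliftL (Db (D n)) (E (x - P x)) by [].
pose op' r := mklin (linear_right r bop).
pose pur r := mklin (linear_right r (tpure_bilinear T T)).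
have Dpure r t : W r -> exists n, forall m, (n <= m)%N -> D m (op r t) = tpure r t.
  move=> Wr.
  have cL m : linear (fun t => D m (op r t)) by move=> a u v; rewrite (linear_right _ bop) linearP.
  apply: (opind (leventually (fun m => mklin (cL m)) (fun=> pur r))) => /=.
    exists 1%N => -[//|m] _.
    by rewrite op1 DS PW // subrr linear0 [tliftL _ 0]linear0 addr0.
  move=> {}t v [n hn]; exists n.+1 => -[//|m] nm.
  have W'r : W' (op r (op t (tinj v))) by apply: lspan_in; exists r, t, v.
  rewrite DS PW' // subr0 tpure0l add0r -opA Ev tliftL_pure hn //.
  have hbv := bilinear_pre idfun (mklin (linear_left (tinj v) bop)) (tpure_bilinear T T).
  exact: (tlift_pure _ _ hbv).
have bmu := bilinear_pre (@lsub_val _ _ W : {linear _ -> _}) (idfun : {linear T -> T}) bop.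
pose mu := tliftL bmu.
pose vl := tmapL (@lsub_val _ _ W : {linear _ -> _}) (idfun : {linear T -> T}).
have Dmu z : exists n, forall m, (n <= m)%N -> D m (mu z) = vl z.
  have cL m : linear (fun z => D m (mu z)) by move=> a u v; rewrite !linearP.
  apply: (@tensor_ind _ _ _ (leventually (fun m => mklin (cL m)) (fun=> vl))) => u t.
  rewrite -[lsub_mem _ _]/(exists n, forall m, (n <= m)%N -> D m (mu (tpure u t)) = vl (tpure u t)).
  rewrite /mu /vl tliftL_pure tmapL_pure; apply: Dpure; exact: lsub_valE.
(* Every tensor is recovered from its product by some [D m], so [mu] is injective and [g] is a left
   inverse of it: one linear map replaces the sequence [D]. *)
have [g gmu] := generalized_inverse mu.
have [r rK] := lsub_retraction W.
have vlK z : tmapL r (idfun : {linear T -> T}) (vl z) = z.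
  have cL : linear (fun z => tmapL r (idfun : {linear T -> T}) (vl z)).
    by move=> a u v; rewrite !linearP.
  apply: (tensor_ext_linear (f := mklin cL) (g := idfun)) => u t.
  by rewrite -[LHS]/(tmapL r idfun (vl (tpure u t))) /vl !tmapL_pure rK.
have gK z : g (mu z) = z.
  have [n hn] := Dmu z; have [n' hn'] := Dmu (g (mu z)).
  rewrite -[LHS]vlK -[RHS]vlK -(hn (maxn n n')) ?leq_maxl //.
  by rewrite -(hn' (maxn n n')) ?leq_maxr // gmu.
have FL : linear (fun x => vl (g x)) by move=> a u v; rewrite !linearP.
exists (mklin FL) => w t /lsub_lift[u <-].
rewrite -[LHS]/(vl (g (op (lsub_val u) t))).
have -> : op (lsub_val u) t = mu (tpure u t) by rewrite /mu tliftL_pure.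
by rewrite gK /vl tmapL_pure.
Qed.

End Free.

(** * Products of subspaces of T, and freeness of V and R *)

Section Products.
Variables (k : fieldType) (V : lmodType k).
Local Notation T := (talg V).
Implicit Types X Y Z W : lsubspace T.

Lemma sprod_in X Y u v : X u -> Y v -> sprod X Y (u * v).
Proof. by move=> Xu Yv; apply: lspan_in; exists u, v. Qed.

Lemma sprod_min X Y Z : (forall u v, X u -> Y v -> Z (u * v)) ->
  forall x, sprod X Y x -> Z x.
Proof. by move=> h; apply: lspan_min => x [u [v [Xu Yv ->]]]; apply: h. Qed.

Lemma sprod_mono X Y X' Y' : (forall x, X x -> X' x) -> (forall x, Y x -> Y' x) ->
  forall x, sprod X Y x -> sprod X' Y' x.
Proof.
by move=> hX hY; apply: sprod_min => u v /hX Xu /hY Yv; apply: sprod_in.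
Qed.

Lemma sprodA X Y Z : sprod X (sprod Y Z) = sprod (sprod X Y) Z.
Proof.
apply: lsub_eq => x; split; apply: sprod_min => u v hu hv.
  apply: (lspan_morph (linear_right u (bilinear_mul T)) _ hv) => _ [y [z [Yy Zz ->]]].
  by rewrite mulrA; do 2 apply: sprod_in => //.
apply: (lspan_morph (linear_left v (bilinear_mul T)) _ hu) => _ [y [z [Yy Zz ->]]].
by rewrite -mulrA; do 2 apply: sprod_in => //.
Qed.

Lemma scalars1 : scalars V 1. Proof. exact: lspan_in. Qed.

Lemma scalarsP x : scalars V x -> exists c : k, x = c *: 1.
Proof.
move=> [s hs ->]; exists (\sum_(p <- s) p.1); rewrite scaler_suml.
by rewrite big_seq [RHS]big_seq; apply: eq_bigr => p /hs ->.
Qed.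

Lemma sprod1l X : sprod (scalars V) X = X.
Proof.
apply: lsub_eq => x; split; last by move=> Xx; rewrite -[x]mul1r; apply: sprod_in scalars1 _.
by apply: sprod_min => u v /scalarsP[c ->] Xv; rewrite -scalerAl mul1r; apply: lsubZ.
Qed.

Lemma sprod1r X : sprod X (scalars V) = X.
Proof.
apply: lsub_eq => x; split; last by move=> Xx; rewrite -[x]mulr1; apply: sprod_in scalars1.
by apply: sprod_min => u v Xu /scalarsP[c ->]; rewrite -scalerAr mulr1; apply: lsubZ.
Qed.

Lemma spow1 X : spow X 1 = X. Proof. exact: sprod1r. Qed.

Lemma spowD X m n : spow X (m + n) = sprod (spow X m) (spow X n).
Proof. by elim: m => [|m IH]; rewrite ?sprod1l //= IH sprodA. Qed.

Lemma spowSr X n : spow X n.+1 = sprod (spow X n) X.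
Proof. by rewrite -addn1 spowD spow1. Qed.

Lemma Vsub_tinj v : Vsub V (tinj v). Proof. by apply: lspan_in; exists v. Qed.

Lemma VsubP x : Vsub V x -> exists v, x = tinj v :> T.
Proof.
move: x; apply: (@lspan_min _ _ _ (limage (@tinj k V : {linear _ -> _}))) => x [v ->].
by exists v.
Qed.

(** [rfree W] identifies W T with W (x) T and [lfree W] identifies T W with T (x) W; in the second
    case [t w] is split as w (x) t. *)
Definition rfree W := factor_free (fun x y : T => x * y) W.
Definition lfree W := factor_free (fun x y : T => y * x) W.

Let bmul : bilinear_map (fun x y : T => x * y) := bilinear_mul T.
Let bmulop : bilinear_map (fun x y : T => y * x) := bilinear_flip (bilinear_mul T).

Lemma oprod_flip X Y : oprod (fun x y : T => y * x) X Y = sprod Y X.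
Proof.
apply: lsub_eq => x; split; apply: lspan_mono => y [u [v [Xu Yv ->]]];
by exists v, u.
Qed.

Lemma sprod_capr Y Z Z' x : rfree Y ->
  sprod Y Z x -> sprod Y Z' x -> sprod Y (lcap Z Z') x.
Proof. exact: (@oprod_capr _ _ _ bmul). Qed.

Lemma sprod_capl Y Z Z' x : lfree Y ->
  sprod Z Y x -> sprod Z' Y x -> sprod (lcap Z Z') Y x.
Proof. by rewrite -!oprod_flip; apply: (@oprod_capr _ _ _ bmulop). Qed.

Lemma sprod_subl X Y Z Z' x : rfree Y -> (forall y, X y -> Y y) ->
  sprod X Z' x -> sprod Y Z x -> sprod X Z x.
Proof. exact: (@oprod_subl _ _ _ bmul). Qed.

Lemma sprod_subr X Y Z Z' x : lfree Y -> (forall y, X y -> Y y) ->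
  sprod Z' X x -> sprod Z Y x -> sprod Z X x.
Proof. by rewrite -!oprod_flip; apply: (@oprod_subl _ _ _ bmulop). Qed.

Lemma rfree_ext W (P Q : {linear T -> T}) : rfree W ->
  exists F : {linear T -> T}, forall w t, W w -> F (w * t) = P w * Q t.
Proof. exact: (@free_ext _ _ _ bmul). Qed.

Lemma lfree_ext W (P Q : {linear T -> T}) : lfree W ->
  exists F : {linear T -> T}, forall w t, W w -> F (t * w) = Q t * P w.
Proof. exact: (@free_ext _ _ _ bmulop). Qed.

Lemma rfree_sprod X Y : rfree X -> rfree Y -> rfree (sprod X Y).
Proof. by apply: (free_oprod bmul) => x y z; rewrite mulrA. Qed.

Lemma lfree_sprod X Y : lfree X -> lfree Y -> lfree (sprod X Y).
Proof.
move=> fX fY; rewrite -oprod_flip.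
by apply: (free_oprod bmulop) => // x y z; rewrite mulrA.
Qed.

Lemma rfree_one : rfree (scalars V).
Proof. exact: (free_one bmul (@mul1r _)). Qed.
Lemma lfree_one : lfree (scalars V).
Proof. exact: (free_one bmulop (@mulr1 _)). Qed.

Lemma rfree_spow X n : rfree X -> rfree (spow X n).
Proof. by move=> fX; elim: n => [|n]; [exact: rfree_one|exact: rfree_sprod]. Qed.
Lemma lfree_spow X n : lfree X -> lfree (spow X n).
Proof. by move=> fX; elim: n => [|n]; [exact: lfree_one|exact: lfree_sprod]. Qed.

Lemma eps_T_linear : linear (@eps_T k V : T -> k^o).
Proof. by move=> a x y; rewrite /eps_T talg_liftD talg_liftZ. Qed.
Lemma eps_T1 : @eps_T k V 1 = 1. Proof. exact: (@talg_lift1 k V k^o \0). Qed.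
Lemma eps_TM x y : @eps_T k V (x * y) = eps_T x * eps_T y.
Proof. exact: (@talg_liftM k V k^o \0). Qed.
Lemma eps_T_tinj v : @eps_T k V (tinj v) = 0.
Proof. exact: (@talg_lift_tinj k V k^o \0). Qed.

(** Left induction on [t], applied to the statement that [W] is stable under right multiplication by
    [t]. *)
Lemma talg_ind_right W :
  W 1 -> (forall t v, W t -> W (t * tinj v)) -> forall t, W t.
Proof.
move=> W1 Wv t; rewrite -[t]mul1r; move: W1; move: (1 : T) => u0 Wu0; move: t u0 Wu0.
have h0 u : W u -> W (u * 0) by rewrite mulr0 => _; apply: lsub0.
have hL a x y : (forall u, W u -> W (u * x)) -> (forall u, W u -> W (u * y)) ->
    forall u, W u -> W (u * (a *: x + y)).
  by move=> hx hy u Wu; rewrite mulrDr -scalerAr; apply: lsubL; [apply: hx|apply: hy].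
apply: (@talg_ind _ _ (@LSubspace k T (fun t => forall u, W u -> W (u * t)) h0 hL)) => /=.
  by move=> u Wu; rewrite mulr1.
by move=> v x hx u Wu; rewrite mulrA; apply: hx; apply: Wv.
Qed.

(** [talg_rec] passes on only the value at the tail of a word, so the tail itself is carried along
    in a pair. *)
Lemma split_first : exists E : {linear T -> tensor T T},
  E 1 = 0 /\ forall v t, E (tinj v * t) = tpure t (tinj v).
Proof.
pose N : lmodType k := (T * tensor T T)%type.
pose act (v : V) (z : N) : N := (tinj v * z.1, tpure z.1 (tinj v)).
have [pl pr] := tpure_bilinear T T.
have bact : bilinear_map act.
  split=> a u v w; rewrite /act; congr (_, _); rewrite /= ?linearP ?mulrDl ?mulrDr.
  - by rewrite scalerAl.
  - by rewrite pr.
  - by rewrite scalerAr.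
  - by rewrite pl.
have [f [f1 fV]] := @talg_rec _ _ N act (1, 0) bact.
have ft t : (f t).1 = t.
  have fL : linear (fun t => (f t).1) by move=> a u v; rewrite linearP.
  apply: (talg_ext_linear (f := mklin fL) (g := idfun)) => /= [|v u e]; first by rewrite f1.
  by rewrite fV /= e.
have EL : linear (fun t => (f t).2) by move=> a u v; rewrite linearP.
by exists (mklin EL); split=> [|v t] /=; rewrite ?f1 // fV /= ft.
Qed.

(** A letter put in front of [t] is also the last one exactly when [t] is a scalar, whence the
    summand with [eps_T]; otherwise the last letter is that of the tail. *)
Lemma split_last : exists E : {linear T -> tensor T T},
  E 1 = 0 /\ forall t v, E (t * tinj v) = tpure t (tinj v).
Proof.
pose N : lmodType k := (T * tensor T T)%type.
have [pl pr] := tpure_bilinear T T.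
pose mulL (v : T) := mklin (linear_right v (bilinear_mul T)).
pose act (v : V) (z : N) : N :=
  (tinj v * z.1, tmapL (mulL (tinj v)) idfun z.2 + eps_T z.1 *: tpure (1 : T) (tinj v)).
have tl a u v (z : tensor T T) : tmapL (mulL (tinj (a *: u + v))) idfun z =
    a *: tmapL (mulL (tinj u)) idfun z + tmapL (mulL (tinj v)) idfun z.
  pose g1 : {linear tensor T T -> tensor T T} := tmapL (mulL (tinj (a *: u + v))) idfun.
  have gL : linear (fun z => a *: tmapL (mulL (tinj u)) (idfun : {linear T -> T}) z +
      tmapL (mulL (tinj v)) (idfun : {linear T -> T}) z).
    by move=> b x y; rewrite !(linearP (tmapL _ _)) !scalerDr !scalerA mulrC addrACA.
  apply: (tensor_ext_linear (f := g1) (g := mklin gL)) => x y.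
  rewrite /g1 tmapL_pure -[RHS]/(a *: _ + _) !tmapL_pure -pl; congr tpure.
  by rewrite /= linearP mulrDl scalerAl.
have bact : bilinear_map act.
  split=> a u v w; rewrite /act; congr (_, _).
  - by rewrite linearP mulrDl -[RHS]/(a *: (_ * _) + _) scalerAl.
  - rewrite tl (linearP (@tinj k V : {linear _ -> _})) pr.
    by rewrite -[RHS]/(a *: (_ + _) + (_ + _)) !scalerDr addrACA !scalerA mulrC.
  - by rewrite mulrDr -[RHS]/(a *: (_ * _) + _) scalerAr.
  - rewrite (linearP (tmapL _ _)) eps_T_linear scalerDl addrACA.
    by rewrite -[RHS]/(a *: (_ + _) + (_ + _)) scalerDr scalerA.
have [f [f1 fV]] := @talg_rec _ _ N act (1, 0) bact.
have ft t : (f t).1 = t.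
  have fL : linear (fun t => (f t).1) by move=> a u v; rewrite linearP.
  apply: (talg_ext_linear (f := mklin fL) (g := idfun)) => /= [|v u e]; first by rewrite f1.
  by rewrite fV /= e.
have fV2 v t : (f (tinj v * t)).2 =
    tmapL (mulL (tinj v)) idfun (f t).2 + eps_T t *: tpure (1 : T) (tinj v).
  by rewrite fV -[LHS]/(_ + eps_T (f t).1 *: _) ft.
have f12 : (f 1).2 = 0 by rewrite f1.
have EL : linear (fun t => (f t).2) by move=> a u v; rewrite linearP.
exists (mklin EL); split=> [|t v]; first exact: f12.
have h1 : linear (fun t => (f (t * tinj v)).2).
  by move=> a x y; rewrite mulrDl -scalerAl linearP.
have h2 : linear (fun t : T => tpure t (tinj v) : tensor T T).
  exact: linear_left (tpure_bilinear T T).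
apply: (talg_ext_linear (f := mklin h1) (g := mklin h2)) => [|u x] /=.
  by rewrite mul1r -[tinj v]mulr1 fV2 f12 linear0 add0r eps_T1 scale1r mulr1.
move=> e; rewrite -mulrA fV2 e eps_TM eps_T_tinj mulr0 scale0r addr0.
exact: tmapL_pure.
Qed.

Lemma rfree_V : rfree (Vsub V).
Proof.
have [E [_ Ev]] := split_first.
pose s := tliftL (bilinear_flip (tpure_bilinear T T)).
have sL : linear (fun x => s (E x)) by move=> a u v; rewrite !linearP.
exists (mklin sL) => w t /VsubP[v ->]; rewrite /= Ev.
exact: (tlift_pure _ _ (bilinear_flip (tpure_bilinear T T))).
Qed.

Lemma lfree_V : lfree (Vsub V).
Proof.
have [E [_ Ev]] := split_last.
pose s := tliftL (bilinear_flip (tpure_bilinear T T)).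
have sL : linear (fun x => s (E x)) by move=> a u v; rewrite !linearP.
exists (mklin sL) => w t /VsubP[v ->]; rewrite /= Ev.
exact: (tlift_pure _ _ (bilinear_flip (tpure_bilinear T T))).
Qed.

(* Concentrating V in degree 1 turns the grading of T by word length into a special case. *)
Definition Vlen (n : nat) : lsubspace V := if n == 1%N then lfull V else leqz idfun \0.

Lemma Vlen_grading : is_grading Vlen.
Proof.
split=> [v|n a Ga a0 i ni].
  exists 2, (fun i => if i == 1%N then v else 0); split=> [i|].
    by rewrite /Vlen; case: (i == 1%N).
  by rewrite big_ord_recl big_ord1 /= add0r.
have an j : j != 1%N -> a j = 0 by move=> /negbTE j1; have := Ga j; rewrite /Vlen j1.
have [i1|/an //] := eqVneq i 1%N.
move: a0; rewrite (bigD1 (Ordinal ni)) //= big1 ?addr0 // => j.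
by rewrite -val_eqE /= i1; apply: an.
Qed.

Lemma Tdeg_Vlen n : Tdeg Vlen n = spow (Vsub V) n.
Proof.
apply: lsub_eq => x; split.
  apply: lspan_min => {}x [s [sV <- ->]] {n}.
  elim: s sV => [|p s IH] sV; first by rewrite big_nil; apply: scalars1.
  rewrite big_cons /=; have := sV p (mem_head _ _); rewrite /Vlen.
  case: eqP => [-> _|_ /= ->]; last by rewrite linear0 mul0r; apply: lsub0.
  apply: sprod_in; first exact: Vsub_tinj.
  by apply: IH => q qs; apply: sV; rewrite inE qs orbT.
elim: n x => [|n IH] x.
  by move=> /scalarsP[c ->]; apply/lsubZ/Tdeg_one.
apply: sprod_min => u v /VsubP[w ->] /IH hv.
by apply: (Tdeg_mul (m := 1)) hv; apply: Tdeg_tinj.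
Qed.

Lemma length_grading : exists pr : {linear T -> sequences T},
  [/\ graded_by (spow (Vsub V)) pr,
    forall n m x y, spow (Vsub V) n x ->
      pr (x * y) m = if (n <= m)%N then x * pr y (m - n)%N else 0
    & forall n m x y, spow (Vsub V) n y ->
      pr (x * y) m = if (n <= m)%N then pr x (m - n)%N * y else 0].
Proof.
have [pr [gpr prl]] := tensor_grading Vlen_grading.
have e : Tdeg Vlen = spow (Vsub V) by apply/funext => n; apply: Tdeg_Vlen.
exists pr; rewrite -e; split=> // n m x y.
exact: (tensor_grading_right Vlen_grading).
Qed.

Lemma spow_span (x : T) : lspan (fun y => exists n, spow (Vsub V) n y) x.
Proof.
have := Tdeg_span Vlen_grading x; apply: lspan_mono => y [n].
by rewrite Tdeg_Vlen; exists n.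
Qed.

Lemma Tge1_tinjl v (t : T) : Tge V 1 (tinj v * t).
Proof.
apply: (lspan_morph (linear_right _ bmul) _ (spow_span t)) => {}t [n hn].
apply: lspan_in; exists n.+1 => //; apply: sprod_in hn; exact: Vsub_tinj.
Qed.

Lemma Tge1_tinjr v (t : T) : Tge V 1 (t * tinj v).
Proof.
apply: (lspan_morph (linear_left _ bmul) _ (spow_span t)) => {}t [n hn].
apply: lspan_in; exists n.+1 => //; rewrite spowSr; apply: sprod_in hn _.
exact: Vsub_tinj.
Qed.

Lemma relations_rfree Vdeg (R : lsubspace T) : relation_space Vdeg R -> rfree R.
Proof.
move=> [_ _ Rmin]; have [E [E1 Ev]] := split_last.
apply: (free_of_minimal bmul (@mulr1 _) _ E1 Ev) => [x y z|Z|x Rx h].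
- by rewrite mulrA.
- exact: talg_ind_right.
apply: Rmin Rx _; apply: lspan_mono h => _ [w [t [v [Rw ->]]]]; right.
rewrite -[w * _]mul1r; apply: sprod_in => //; apply: sprod_in Rw _.
exact: Tge1_tinjr.
Qed.

Lemma relations_lfree Vdeg (R : lsubspace T) : relation_space Vdeg R -> lfree R.
Proof.
move=> [_ _ Rmin]; have [E [E1 Ev]] := split_first.
apply: (free_of_minimal bmulop (@mul1r _) _ E1) => [x y z|t v|Z Z1 Zv t|x Rx h].
- by rewrite mulrA.
- exact: Ev.
- by apply: (talg_ind Z1) => v {}t; apply: Zv.
apply: Rmin Rx _; apply: lspan_mono h => _ [w [t [v [Rw ->]]]]; left.
rewrite -[w]mulr1; apply: sprod_in; first exact: Tge1_tinjl.
exact: sprod_in.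
Qed.

End Products.

Section MoreSubspaces.
Variables (k : fieldType) (M : lmodType k).

Section All.
Variables (I : Type) (P : I -> Prop) (F : I -> lsubspace M).
Fact lall0 : forall i, P i -> F i 0.
Proof. by move=> i _; apply: lsub0. Qed.
Fact lallL a u v : (forall i, P i -> F i u) -> (forall i, P i -> F i v) ->
  forall i, P i -> F i (a *: u + v).
Proof. by move=> hu hv i Pi; apply: lsubL; [apply: hu|apply: hv]. Qed.
Definition lall : lsubspace M := @LSubspace k M _ lall0 lallL.
End All.

Lemma lspan_family (W : nat -> lsubspace M) m x :
  lspan (fun y => exists2 n, (m <= n)%N & W n y) x ->
  exists w n, [/\ fin_sum x w n, forall i, W i (w i) & forall i, (i < m)%N -> w i = 0].
Proof.
move=> [s sW ->]; elim: s sW => [|p s IH] sW.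
  exists (fun=> 0), 0%N; rewrite big_nil; split=> //; last by move=> i; apply: lsub0.
  by split=> //; rewrite big_ord0.
have [q qs|w [n [wn Ww w0]]] := IH; first by apply: sW; rewrite inE qs orbT.
have [n' mn Wp] := sW p (mem_head _ _).
exists (fun i => p.1 *: (if i == n' then p.2 else 0) + w i), (maxn n'.+1 n).
rewrite big_cons; split.
- exact: fin_sum_linear (fin_sum_single _ _) wn.
- by move=> i; apply: lsubL => //; case: eqP => [->|_] //; apply: lsub0.
move=> i im; rewrite w0 // ltn_eqF ?(leq_trans im) //.
by rewrite scaler0 addr0.
Qed.

(** Needed when one free letter is absorbed into an odd J, which lowers the index of a component by
    one. *)
Lemma fin_sum_shift (x : M) w n :
  w 0%N = 0 -> fin_sum x w n -> fin_sum x (fun i => w i.+1) n.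
Proof.
move=> w0 h; have [wn _] := h; have [_ ->] := fin_sum_widen (leqnSn n) h.
split=> [i ni|]; first by apply: wn; apply: leq_trans ni _.
by rewrite big_ord_recl w0 add0r.
Qed.

End MoreSubspaces.

(** * The spaces J_i *)

Section JSpaces.
Variables (k : fieldType) (V : lmodType k) (Vdeg : nat -> lsubspace V).
Local Notation T := (talg V).
Variable R : lsubspace T.
Hypothesis hR : relation_space Vdeg R.
Local Notation VV := (spow (Vsub V)).
Local Notation JE := (Jeven R).
Local Notation RR := (spow R).
Local Notation "X ** Y" := (sprod X Y) (at level 40, left associativity).

Definition Jodd n : lsubspace T := lcap (Vsub V ** JE n) (JE n ** Vsub V).

Lemma J_double n : J R n.*2 = JE n.
Proof. by rewrite /J odd_double half_double. Qed.
Lemma J_doubleS n : J R n.*2.+1 = Jodd n.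
Proof. by rewrite /J /= odd_double /= uphalf_double. Qed.

Lemma Jodd0 : Jodd 0 = Vsub V.
Proof.
rewrite /Jodd Jeven0 sprod1l sprod1r.
by apply: lsub_eq => x; split=> [[]|].
Qed.

Lemma Jeven_R n x : JE n x -> RR n x.
Proof.
by case: n => [|[|n]]; [|rewrite Jeven1 spow1|rewrite JevenSS => -[]].
Qed.

Lemma rfree_V_pow n : rfree (VV n). Proof. exact/rfree_spow/rfree_V. Qed.
Lemma lfree_V_pow n : lfree (VV n). Proof. exact/lfree_spow/lfree_V. Qed.
Lemma rfree_R_pow n : rfree (RR n).
Proof. exact/rfree_spow/(relations_rfree hR). Qed.
Lemma lfree_R_pow n : lfree (RR n).
Proof. exact/lfree_spow/(relations_lfree hR). Qed.
Lemma rfree_Jeven n : rfree (JE n).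
Proof. exact: (free_sub (@Jeven_R n) (rfree_R_pow n)). Qed.
Lemma lfree_Jeven n : lfree (JE n).
Proof. exact: (free_sub (@Jeven_R n) (lfree_R_pow n)). Qed.

(* The N-th summand in the definition of J_{2(i+1)}, with the intersection restricted to tuples n having at most two nonzero entries. *)
Definition Jhom i N : lsubspace T :=
  lall (fun q : nat * nat * (nat * nat * nat) =>
          (q.1.1 + q.1.2 = i /\ q.2.1.1 + q.2.1.2 + q.2.2 = N)%N)
       (fun q => VV q.2.1.1 ** (JE q.1.1 ** (VV q.2.1.2 ** (JE q.1.2 ** VV q.2.2)))).

Lemma JhomE i N x a c m1 m2 m3 : Jhom i N x -> (a + c = i)%N -> (m1 + m2 + m3 = N)%N ->
  (VV m1 ** (JE a ** (VV m2 ** (JE c ** VV m3)))) x.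
Proof. by move=> h ac m; apply: (h ((a, c), ((m1, m2), m3))). Qed.

Lemma interleave_tail p m : interleave JE (nseq p 0%N) (m :: nseq p 0%N) = VV m.
Proof. by elim: p m => [//|p IH] m /=; rewrite IH sprod1r sprod1r. Qed.

Lemma Jeven_span i x : JE i.+2 x ->
  lspan (fun y => exists2 N, (1 <= N)%N & Jhom i.+1 N y) x.
Proof.
rewrite JevenSS => -[h _]; apply: lspan_mono h => {}x [N N1 h].
exists N => // -[[a c] [[m1 m2] m3]] [ac mN].
rewrite -[lsub_mem _ _]/((VV m1 ** (JE a ** (VV m2 ** (JE c ** VV m3)))) x).
rewrite /= in ac mN.
(* For [i = 0] the tuples have a single entry: [a] or [c] is 0 and the two powers of V around it
   merge. Otherwise [(a, c)] is padded with zeros. *)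
case: i ac h => [|i] ac h.
  case: a c ac => [|[|a]] [|[|c]] // _.
    rewrite Jeven0 sprod1l sprodA -spowD.
    have := h [tuple 1%N] [tuple (m1 + m2)%N; m3]; rewrite /= ?addn0; exact.
  rewrite Jeven0 sprod1l -spowD.
  have := h [tuple 1%N] [tuple m1; (m2 + m3)%N]; rewrite /= ?addn0 ?addnA; exact.
have sn : size (a :: c :: nseq i 0%N) == i.+2 by rewrite /= size_nseq.
have sm : size (m1 :: m2 :: m3 :: nseq i 0%N) == i.+3 by rewrite /= size_nseq.
have := h (Tuple sn) (Tuple sm); rewrite /= sumn_nseq !addn0 addnA interleave_tail.
exact.
Qed.

Lemma Jeven_decomp i x : JE i.+2 x -> exists w n,
  [/\ fin_sum x w n, forall N, Jhom i.+1 N (w N) & w 0%N = 0].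
Proof.
by move=> /Jeven_span /lspan_family[w [n [wn hw w0]]]; exists w, n; split=> //; apply: w0.
Qed.

(** Placing all free letters between the two chosen factors leaves J_{2a} at the very front;
    [Jeven_suffix] reads such a product from its end. *)
Lemma Jeven_prefix a n x : (a <= n)%N -> JE n x -> (JE a ** lfull T) x.
Proof.
rewrite leq_eqVlt => /orP[/eqP -> Jx|]; first by rewrite -[x]mulr1; apply: sprod_in.
case: n => [//|[|n]].
  by rewrite ltnS leqn0 => /eqP -> _; rewrite Jeven0 sprod1l.
rewrite ltnS => an /Jeven_span; apply: lspan_min => y [N _ hy].
have := JhomE hy (subnKC an) (addn0 (0 + N)); rewrite sprod1l.
exact: sprod_mono.
Qed.

Lemma Jeven_suffix a n x : (a <= n)%N -> JE n x -> (lfull T ** JE a) x.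
Proof.
rewrite leq_eqVlt => /orP[/eqP -> Jx|]; first by rewrite -[x]mul1r; apply: sprod_in.
case: n => [//|[|n]].
  by rewrite ltnS leqn0 => /eqP -> _; rewrite Jeven0 sprod1r.
rewrite ltnS => an /Jeven_span; apply: lspan_min => y [N _ hy].
have := JhomE hy (subnK an) (addn0 (0 + N)); rewrite sprod1r !sprodA.
exact: sprod_mono.
Qed.

(** Inside R^a R^b both factors are free, so the prefix narrows the first to J_{2a} and the suffix
    narrows the second to J_{2b}. *)
Lemma Jeven_add a b x : JE (a + b) x -> (JE a ** JE b) x.
Proof.
move=> Jx; have := Jeven_R Jx; rewrite spowD => Rx.
apply: (sprod_subr (lfree_R_pow b) (@Jeven_R b) (Jeven_suffix (leq_addl a b) Jx)).
exact: (sprod_subl (rfree_R_pow a) (@Jeven_R a) (Jeven_prefix (leq_addr b a) Jx)).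
Qed.

Section Components.
Variable pr : {linear T -> sequences T}.
Hypothesis gpr : graded_by VV pr.

Lemma pr_linear n : linear (fun x => pr x n).
Proof. by move=> a u v; rewrite linearP. Qed.

Lemma right_components (Y : lsubspace T) : rfree Y -> exists F : nat -> {linear T -> T},
  (forall N y t, Y y -> F N (y * t) = y * pr t N) /\
  forall x w n, fin_sum x w n -> (forall i, (Y ** VV i) (w i)) ->
    forall N, F N x = w N.
Proof.
move=> fY; have [_ prE _] := gpr.
have [F hF] := choice (fun N => rfree_ext idfun (mklin (pr_linear N)) fY).
exists F; split=> // x w n [w0 ->] Yw N; rewrite linear_sum.
have Fw i : F N (w i) = if N == i then w i else 0.
  have h : linear (fun x : T => if N == i then x else 0).
    by move=> a u v; case: eqP; rewrite // scaler0 addr0.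
  apply: (lspan_eqz (g := mklin h)) (Yw i) => _ [y [t [Yy Vt ->]]].
  by rewrite hF //= (prE _ _ _ Vt); case: eqP; rewrite ?mulr0.
have [Nn|nN] := ltnP N n.
  rewrite (bigD1 (Ordinal Nn)) //= Fw eqxx big1 ?addr0 // => i.
  by rewrite -val_eqE /= Fw eq_sym => /negbTE ->.
rewrite big1 ?w0 // => i _; rewrite Fw gtn_eqF //.
exact: leq_trans (ltn_ord i) nN.
Qed.

Lemma left_components (Y : lsubspace T) : lfree Y -> exists F : nat -> {linear T -> T},
  (forall N y t, Y y -> F N (t * y) = pr t N * y) /\
  forall x w n, fin_sum x w n -> (forall i, (VV i ** Y) (w i)) ->
    forall N, F N x = w N.
Proof.
move=> fY; have [_ prE _] := gpr.
have [F hF] := choice (fun N => lfree_ext idfun (mklin (pr_linear N)) fY).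
exists F; split=> // x w n [w0 ->] Yw N; rewrite linear_sum.
have Fw i : F N (w i) = if N == i then w i else 0.
  have h : linear (fun x : T => if N == i then x else 0).
    by move=> a u v; case: eqP; rewrite // scaler0 addr0.
  apply: (lspan_eqz (g := mklin h)) (Yw i) => _ [t [y [Vt Yy ->]]].
  by rewrite hF //= (prE _ _ _ Vt); case: eqP; rewrite ?mul0r.
have [Nn|nN] := ltnP N n.
  rewrite (bigD1 (Ordinal Nn)) //= Fw eqxx big1 ?addr0 // => i.
  by rewrite -val_eqE /= Fw eq_sym => /negbTE ->.
rewrite big1 ?w0 // => i _; rewrite Fw gtn_eqF //.
exact: leq_trans (ltn_ord i) nN.
Qed.

Lemma relation_components r n : R r -> (n < 2)%N -> pr r n = 0.
Proof.
have [_ prE _] := gpr.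
have [hT _ _] := hR; move=> /hT h n2.
apply: (lspan_eqz (f := mklin (pr_linear n)) (g := \0)) h => {}r [m m2 hm] /=.
by rewrite (prE _ _ _ hm) ltn_eqF //; apply: leq_trans m2.
Qed.

(* The components of an element of J_{2i+1} with respect to J_{2i} V and to V J_{2i} agree, since V J_{2i-2} T is the direct sum of the V J_{2i-2} V^n. *)
Lemma Jodd_split2 j x : Jodd j.+2 x -> (R ** (Vsub V ** JE j.+1)) x.
Proof.
move=> [xl xr]; set B := JE j.+1.
have [w [n [wn wJ w0]]] : exists w n, [/\ fin_sum x w n,
    forall N, (Jhom j.+1 N ** Vsub V) (w N) & forall N, (N < 1)%N -> w N = 0].
  apply: lspan_family; move: xr; apply: lspan_min => _ [y [v [/Jeven_span Jy Vv ->]]].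
  apply: (lspan_morph (linear_left v (bilinear_mul T)) _ Jy).
  by move=> y0 [N N1 hy]; apply: lspan_in; exists N => //; apply: sprod_in.
have [w' [n' [wn' wJ' w0']]] : exists w n, [/\ fin_sum x w n,
    forall N, (Vsub V ** Jhom j.+1 N) (w N) & forall N, (N < 1)%N -> w N = 0].
  apply: lspan_family; move: xl; apply: lspan_min => _ [v [y [Vv /Jeven_span Jy ->]]].
  apply: (lspan_morph (linear_right v (bilinear_mul T)) _ Jy).
  by move=> y0 [N N1 hy]; apply: lspan_in; exists N => //; apply: sprod_in.
have hom N m1 m2 y : Jhom j.+1 N y -> (m1 + m2 = N)%N -> (VV m1 ** B ** VV m2) y.
  move=> hy e.
  have := JhomE hy (addn0 j.+1) (etrans (addn0 (m1 + m2)%N) e).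
  by rewrite Jeven0 sprod1l sprod1r sprodA.
have fB : rfree (Vsub V ** B) by apply: rfree_sprod (rfree_V V) (rfree_Jeven _).
have fB' : lfree (B ** Vsub V) by apply: lfree_sprod (lfree_Jeven _) (lfree_V V).
have ww' N : w N = w' N.
  have [F [_ hF]] := right_components fB.
  rewrite -(hF x w n wn) => [|[|i]].
  - apply: (hF x w' n' wn') => -[|i]; first by rewrite w0' //; apply: lsub0.
    rewrite -sprodA; apply: sprod_mono (wJ' i.+1) => // y hy.
    by have := hom _ 0%N i.+1 y hy erefl; rewrite sprod1l.
  - by rewrite w0 //; apply: lsub0.
  - rewrite spowSr sprodA; apply: sprod_mono (wJ i.+1) => // y hy.
    by have := hom _ 1%N i y hy erefl; rewrite spow1.
have xR : (R ** (B ** Vsub V)) x.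
  rewrite sprodA; apply: sprod_mono xr => // y /(@Jeven_add 1 j.+1).
  by rewrite Jeven1.
have [F [hF Fw]] := left_components fB'.
have {}Fw N : F N x = w N.
  apply: (Fw _ _ _ wn) => i; rewrite sprodA; apply: sprod_mono (wJ i) => // y hy.
  by have := hom _ i 0%N y hy (addn0 i); rewrite sprod1r.
have wVB N : (VV N ** (Vsub V ** B)) (w N).
  rewrite ww' sprodA -spowSr -[VV N.+1]/(Vsub V ** VV N) -sprodA.
  apply: sprod_mono (wJ' N) => // y hy.
  by have := hom _ N 0%N y hy (addn0 N); rewrite sprod1r.
(* [x] lies in R (B V), and its second factor has to be brought into V B. The test map id (x) (1 -
   P) makes sense on R T, as [L], and on each V^N T, as [X N], which links R to the components. *)
have [P [PB BP]] := projection (Vsub V ** B).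
have QL : linear (fun x => x - P x).
  by move=> a u v; rewrite (linearP P) opprD addrACA scalerBr.
have [X hX] := choice (fun N => rfree_ext idfun (mklin QL) (rfree_V_pow N)).
have [L hL] := rfree_ext idfun (mklin QL) (relations_rfree hR).
have [L' hL'] := rfree_ext idfun P (relations_rfree hR).
(* If r is the sum of its components r_i, then [L (r z)] is the sum of the [X i (r_i z)], and [F i]
   extracts [r_i z]. For [x] these are the [w i], which lie in V^i (V B), where [X i] vanishes. *)
have L0 : L x = 0.
  have sumL m : linear (fun x => \sum_(i < m) X i (F i x)).
    move=> a u v; rewrite scaler_sumr -big_split; apply: eq_bigr => i _.
    by rewrite (linearP (F i)) (linearP (X i)).
  have [m hm] : leventually (fun m => mklin (sumL m)) (fun=> L) x.
    apply: lspan_min xR => _ [r [z [Rr Bz ->]]].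
    have [_ _ /(_ r)[m rm]] := gpr; exists m => m' mm' /=.
    have [_ er] := fin_sum_widen mm' rm.
    rewrite hL //= {2}er mulr_suml; apply: eq_bigr => i _.
    by rewrite hF // hX //=; have [] := gpr.
  rewrite -(hm m) //= big1 // => i _; rewrite Fw.
  apply: (lspan_eqz (g := \0)) (wVB i) => _ [y [z [Vy Bz ->]]].
  by rewrite hX //= BP // subrr mulr0.
have -> : x = L' x.
  rewrite -[RHS]add0r -L0; apply: (lspan_eqz (f := idfun) (g := L \+ L')) xR.
  by move=> _ [r [z [Rr _ ->]]] /=; rewrite hL // hL' //= -mulrDr subrK.
apply: (lspan_morph (linearP L') _ xR) => _ [r [z [Rr _ ->]]].
by rewrite hL' //; apply: sprod_in.
Qed.

Lemma Jodd_cons n x : Jodd n.+1 x -> (R ** Jodd n) x.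
Proof.
case: n => [[_ xr]|n Jx]; first by rewrite Jodd0.
apply: (sprod_capr (relations_rfree hR)); first exact: Jodd_split2.
have [_ xr] := Jx; rewrite sprodA; apply: sprod_mono xr => // y.
by move=> /(@Jeven_add 1 n.+1); rewrite Jeven1.
Qed.

(** Peeling off relations one at a time with [Jodd_cons] gives R^a V J_{2b}; since [x] also begins
    with J_{2a}, the free factor R^a narrows to J_{2a}. *)
Lemma Jodd_mid a b x : Jodd (a + b) x -> (JE a ** (Vsub V ** JE b)) x.
Proof.
elim: a b x => [|a IH] b x Jx; first by rewrite Jeven0 sprod1l; have [] := Jx.
have xR : (RR a.+1 ** (Vsub V ** JE b)) x.
  rewrite -[RR a.+1]/(R ** RR a) -sprodA.
  apply: sprod_mono (Jodd_cons Jx) => // y /IH.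
  by apply: sprod_mono => // z; apply: Jeven_R.
apply: (sprod_subl (rfree_R_pow a.+1) (@Jeven_R a.+1) _ xR (Z' := lfull T)).
have [_] := Jx; apply: sprod_min => u v /(Jeven_prefix (leq_addr b a.+1)).
move=> Ju Vv; apply: (lspan_morph (linear_left v (bilinear_mul T)) _ Ju).
by move=> _ [y [z [Jy _ ->]]]; rewrite -mulrA; apply: sprod_in.
Qed.

Lemma Jodd_add_even a b x : Jodd (a + b) x -> (Jodd a ** JE b) x.
Proof.
move=> Jx; apply: (sprod_capl (lfree_Jeven b)).
  by rewrite -sprodA; have [xl _] := Jx; apply: sprod_mono xl => // y /Jeven_add.
by rewrite -sprodA; apply: Jodd_mid.
Qed.

Lemma Jeven_add_odd a b x : Jodd (a + b) x -> (JE a ** Jodd b) x.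
Proof.
move=> Jx; apply: (sprod_capr (rfree_Jeven a)); first exact: Jodd_mid.
by rewrite sprodA; have [_ xr] := Jx; apply: sprod_mono xr => // y /Jeven_add.
Qed.

Lemma rfree_Jodd n : rfree (Jodd n).
Proof.
apply: (@free_sub _ _ _ _ (Vsub V ** JE n)); first by move=> x [].
exact: rfree_sprod (rfree_V V) (rfree_Jeven n).
Qed.

Lemma lfree_Jodd n : lfree (Jodd n).
Proof.
apply: (@free_sub _ _ _ _ (JE n ** Vsub V)); first by move=> x [].
exact: lfree_sprod (lfree_Jeven n) (lfree_V V).
Qed.

(* There are no components of length at most 1, because relations start in length 2. *)
Lemma Jeven_decomp2 i x : JE i.+2 x -> exists w n,
  [/\ fin_sum x w n, forall N, Jhom i.+1 N (w N) & forall N, (N < 2)%N -> w N = 0].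
Proof.
move=> Jx; have [w [n [wn wJ w0]]] := Jeven_decomp Jx; exists w, n; split=> //.
have [F [hF Fw]] := left_components (lfree_R_pow i.+1).
move=> N N2; rewrite -(Fw x w n wn) => [|m].
  apply: (lspan_eqz (g := \0)) (Jeven_R Jx) => _ [r [z [Rr Rz ->]]].
  by rewrite hF // relation_components // mul0r.
have := JhomE (wJ m) (addn0 i.+1) (etrans (addn0 _) (addn0 m)).
rewrite Jeven0 !sprod1r; apply: sprod_mono => // y.
exact: Jeven_R.
Qed.

(** One free letter is placed directly before or directly after J_{2j}; between free powers of V the
    two placements intersect in J_{2j+1}. The vanishing of [w 0] ensures that at least one letter
    stays outside J_{2j+1}. *)
Lemma Jeven_split_odd j x : JE j.+1 x -> exists w n,
  [/\ fin_sum x w n, w 0%N = 0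
    & forall N l, (l <= N)%N -> (VV l ** (Jodd j ** VV (N - l))) (w N)].
Proof.
case: j => [|j] Jx.
  have [hT _ _] := hR; have Rx : R x := Jx.
  have [w [n [wn wV w0]]] := @lspan_family _ _ VV 2 x (hT x Rx).
  exists (fun i => w i.+1), n; split; [|exact: w0|].
    by apply: fin_sum_shift => //; apply: w0.
  move=> N l lN; rewrite Jodd0 sprodA -spowSr -spowD addSn subnKC //.
have [w [n [wn wJ w0]]] := Jeven_decomp2 Jx.
exists (fun i => w i.+1), n; split; [|exact: w0|].
  by apply: fin_sum_shift => //; apply: w0.
move=> N l lN; apply: (sprod_mono (X := VV l) (Y := Jodd j.+1 ** VV (N - l))) => //.
have hA := JhomE (wJ N.+1) (addn0 j.+1) (m1 := l.+1) (m2 := (N - l)%N) (m3 := 0%N).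
have hB := JhomE (wJ N.+1) (addn0 j.+1) (m1 := l) (m2 := (N - l).+1) (m3 := 0%N).
have {}hA : (VV l ** ((Vsub V ** JE j.+1) ** VV (N - l))) (w N.+1).
  rewrite -sprodA [_ ** (_ ** (JE _ ** _))]sprodA -spowSr.
  by move: hA; rewrite Jeven0 !sprod1r addn0 addSn subnKC //; apply.
have {}hB : (VV l ** ((JE j.+1 ** Vsub V) ** VV (N - l))) (w N.+1).
  rewrite -sprodA.
  by move: hB; rewrite Jeven0 !sprod1r addn0 addnS subnKC //; apply.
have := sprod_capr (rfree_V_pow l) hA hB; apply: sprod_mono => // y [yl yr].
exact: sprod_capl (lfree_V_pow _) yl yr.
Qed.

(** Two of the free letters are distributed on either side of J_{2a} and of J_{2b}, the others
    staying in front. The four placements intersect in the product of the two odd spaces; having two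
    letters to place is what [Jeven_decomp2] secures. *)
Lemma Jodd_add_odd a b x : JE (a + b).+1 x -> (lfull T ** (Jodd a ** Jodd b)) x.
Proof.
case e: (a + b)%N => [|i] Jx.
  have [hT _ _] := hR; have Rx : R x := Jx.
  move: e => /eqP; rewrite addn_eq0 => /andP[/eqP -> /eqP ->]; rewrite Jodd0.
  apply: lspan_min (hT x Rx) => y [[|[|n]]] // _.
  by rewrite -addn2 spowD -[VV 2]/(Vsub V ** VV 1) spow1; apply: sprod_mono.
have [w [n [[_ ->] wJ w0]]] := Jeven_decomp2 Jx.
apply: lsub_sum => -[N lt_N] _; rewrite -[nat_of_ord _]/N.
case: N {lt_N} => [|[|N]]; [by rewrite w0 //; apply: lsub0|by rewrite w0 //; apply: lsub0|].
have h m1 m2 m3 : (m1 + m2 + m3 = N.+2)%N ->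
    (VV m1 ** (JE a ** (VV m2 ** (JE b ** VV m3)))) (w N.+2).
  exact: JhomE (wJ N.+2) e.
have h1 : (VV N ** ((Vsub V ** JE a) ** (Vsub V ** JE b))) (w N.+2).
  have := h N.+1 1%N 0%N; rewrite addn1 addn0 => /(_ erefl).
  by rewrite spow1 sprod1r spowSr !sprodA.
have h2 : (VV N ** ((JE a ** Vsub V) ** (Vsub V ** JE b))) (w N.+2).
  have := h N 2 0%N; rewrite addn2 addn0 => /(_ erefl).
  by rewrite -[VV 2]/(Vsub V ** VV 1) spow1 sprod1r !sprodA.
have h3 : (VV N ** ((Vsub V ** JE a) ** (JE b ** Vsub V))) (w N.+2).
  have := h N.+1 0%N 1%N; rewrite addn1 addn0 => /(_ erefl).
  by rewrite spow1 sprod1l spowSr !sprodA.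
have h4 : (VV N ** ((JE a ** Vsub V) ** (JE b ** Vsub V))) (w N.+2).
  have := h N 1%N 1%N; rewrite !addn1 => /(_ erefl).
  by rewrite spow1 !sprodA.
have fV := rfree_V_pow N.
apply: sprod_mono (sprod_capr fV (sprod_capr fV h1 h2) (sprod_capr fV h3 h4)) => //.
move=> y [[y1 y2] [y3 y4]]; apply: (sprod_capr (rfree_Jodd a)).
  by apply: (sprod_capl _ y1 y2); apply: lfree_sprod (lfree_V V) (lfree_Jeven b).
by apply: (sprod_capl _ y3 y4); apply: lfree_sprod (lfree_Jeven b) (lfree_V V).
Qed.

End Components.
End JSpaces.

(** * Factorizations of J_{i+i'} in all parities *)

Section JFactors.
Variables (k : fieldType) (V : lmodType k) (Vdeg : nat -> lsubspace V).
Local Notation T := (talg V).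
Variable R : lsubspace T.
Hypothesis hR : relation_space Vdeg R.
Local Notation J := (J R).
Local Notation Jt := (Jt R).

Lemma J_parity (P : nat -> lsubspace T -> Prop) :
  (forall n, P n.*2 (Jeven R n)) -> (forall n, P n.*2.+1 (Jodd R n)) ->
  forall i, P i (J i).
Proof.
move=> Pe Po i; rewrite -(odd_double_half i); case: (odd i).
  by rewrite add1n J_doubleS.
by rewrite add0n J_double.
Qed.

Lemma lfree_J i : lfree (J i).
Proof.
apply: (J_parity (P := fun _ W => lfree W)) => n; first exact: lfree_Jeven hR n.
exact: lfree_Jodd hR n.
Qed.

Lemma J_add i i' x : J (i + i') x ->
  if odd i && odd i' then sprod (lfull T) (sprod (J i) (J i')) x
  else sprod (J i) (J i') x.
Proof.
have [pr [gpr _ _]] := length_grading V.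
rewrite -(odd_double_half i) -(odd_double_half i').
case: (odd i); case: (odd i'); rewrite ?add1n ?add0n /= ?odd_double ?addSn ?addnS
  -?doubleD -?doubleS ?J_double ?J_doubleS => Jx.
- exact: (Jodd_add_odd hR gpr Jx).
- exact: (Jodd_add_even hR gpr Jx).
- exact: (Jeven_add_odd hR gpr Jx).
- exact: (Jeven_add hR Jx).
Qed.

Lemma J_add_full i i' x : J (i + i') x ->
  sprod (lfull T) (sprod (J i) (J i')) x.
Proof.
by move=> /J_add; case: ifP => // _ hx; rewrite -[x]mul1r; apply: sprod_in.
Qed.

Definition aug_ker : lsubspace T := leqz (mklin (@eps_T_linear k V)) \0.

Lemma aug_kerE x : aug_ker x = (eps_T x = 0).
Proof. by []. Qed.

Lemma aug_ker_V x : Vsub V x -> aug_ker x.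
Proof. by move=> /VsubP[v ->]; rewrite /= eps_T_tinj. Qed.

Lemma aug_kerM x y : aug_ker x -> aug_ker (x * y).
Proof. by rewrite /= eps_TM => ->; rewrite mul0r. Qed.

Lemma aug_ker_spow n x : spow (Vsub V) n.+1 x -> aug_ker x.
Proof.
by apply: sprod_min => u v /aug_ker_V hu _; apply: aug_kerM.
Qed.

(** For even [i + 1], all free letters of [Jeven_split_odd] are put in front, and there is at least
    one. That the left factor has no constant term is the minimality of the left complex. *)
Lemma J_succ i x : J i.+1 x -> sprod aug_ker (J i) x.
Proof.
have [pr [gpr _ _]] := length_grading V.
rewrite -(odd_double_half i); case: (odd i); rewrite ?add1n ?add0n.
  rewrite -doubleS J_double J_doubleS => /(Jeven_split_odd hR gpr).
  move=> [w [n [[_ ->] w0 hw]]]; apply: lsub_sum => -[N lt_N] _; rewrite -[nat_of_ord _]/N.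
  case: N {lt_N} => [|N]; first by rewrite w0; apply: lsub0.
  have := hw N.+1 N.+1 (leqnn _); rewrite subnn sprod1r.
  by apply: sprod_mono => // y; apply: aug_ker_spow.
rewrite J_double J_doubleS => -[+ _].
by apply: sprod_mono => // y; apply: aug_ker_V.
Qed.

Lemma split_exists i : exists D : {linear T -> tensor T (Jt i)},
  forall t u, D (t * lsub_val u) = tpure t u.
Proof.
have [D hD] := lfree_J i; have [r rK] := lsub_retraction (J i).
have b := bilinear_flip (bilinear_pre r (idfun : {linear T -> T})
  (bilinear_flip (tpure_bilinear T (Jt i)))).
have L : linear (fun x => tliftL (bilinear_flip b) (D x)) by move=> a u v; rewrite !linearP.
exists (mklin L) => t u; rewrite /= hD; last exact: lsub_valE.
by rewrite (tlift_pure _ _ (bilinear_flip b)) rK.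
Qed.

(** The inverse of T (x) J_i -> T J_i, extended to T in an unspecified way; it is evaluated through
    [split_rightE] on T J_i. *)
Definition split_right i : {linear T -> tensor T (Jt i)} := projT1 (cid (split_exists i)).

Lemma split_rightE i t u : split_right i (t * lsub_val u) = tpure t u.
Proof. exact: (projT2 (cid (split_exists i))). Qed.

End JFactors.

(** * The differential of the left complex *)

Section Differential.
Variables (k : fieldType) (V : lmodType k) (Vdeg : nat -> lsubspace V).
Local Notation T := (talg V).
Variables (R : lsubspace T) (A : algType k) (p : {lrmorphism T -> A}).
Hypothesis hR : relation_space Vdeg R.
Hypothesis hp : is_presentation R p.
Local Notation J := (J R).
Local Notation Jt := (Jt R).
Local Notation K := (K R A).
Local Notation KLR := (KLR R A).
Local Notation eps_A := (eps_A p).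
Local Notation delta := (delta p).

(** Relations have no constant term, so [eps_T] descends to A and the [xget] defining [eps_A] has a
    witness. *)
Lemma eps_A_exists : exists e : A -> k^o, linear e /\ forall t, e (p t) = eps_T t.
Proof.
have [psurj pker] := hp.
have Req r : R r -> eps_T r = 0.
  have [hT _ _] := hR; rewrite -aug_kerE; move=> /hT; move: r.
  by apply: lspan_min => x [[|n] // _]; apply: aug_ker_spow.
have I0 x : sprod (lfull T) (sprod R (lfull T)) x -> eps_T x = 0.
  rewrite -aug_kerE; move: x; apply: sprod_min => u v _.
  rewrite aug_kerE eps_TM => hv.
  suff -> : eps_T v = 0 by rewrite mulr0.
  rewrite -aug_kerE; move: v hv; apply: sprod_min => r t /Req er _.
  exact: aug_kerM.
have [||a u v y z [s [<- ->]] [t [<- ->]]|e he] :=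
  @linear_choice k A k^o (fun a c => exists t, p t = a /\ c = eps_T t).
- by move=> a; have [t <-] := psurj a; exists (eps_T t), t.
- move=> a _ _ [s [<- ->]] [t [/esym st ->]].
  apply/eqP; rewrite -subr_eq0; apply/eqP.
  rewrite -scaleN1r addrC -eps_T_linear; apply: I0; apply/pker.
  by rewrite linearP /= scaleN1r st addNr.
- by exists (a *: s + t); rewrite linearP eps_T_linear.
exists e; split=> [|t]; first exact: linearP.
have [s [ps ->]] := he (p t).
apply/eqP; rewrite -subr_eq0; apply/eqP.
rewrite -scaleN1r addrC -eps_T_linear; apply: I0; apply/pker.
by rewrite linearP /= scaleN1r ps addNr.
Qed.

Lemma eps_A_p t : eps_A (p t) = eps_T t.
Proof.
have [e he] := eps_A_exists.
rewrite /Defs.eps_A; case: xgetP => [f _ [_ ->] //|h].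
by case: (h e).
Qed.

Lemma eps_A1 : eps_A 1 = 1.
Proof. by rewrite -(rmorph1 p) eps_A_p eps_T1. Qed.

Lemma eps_AM a b : eps_A (a * b) = eps_A a * eps_A b.
Proof.
have [psurj _] := hp; have [s <-] := psurj a; have [t <-] := psurj b.
by rewrite -rmorphM !eps_A_p eps_TM.
Qed.

Lemma K_lact_pure i a b (w : Jt i) : K_lact a (tpure b w) = tpure (a * b) w :> K i.
Proof.
apply: (tlift_pure (b := fun u w => tpure (a * u) (idfun w))).
apply: tmap_bilinear => // c u v.
exact: (linear_right a (bilinear_mul A)).
Qed.

Lemma K_lact_bilinear i : bilinear_map (@K_lact k V R A i).
Proof.
split=> [a u v x|a u x y]; last exact: K_lact_linear.
have L : linear (fun x : K i => a *: K_lact u x + K_lact v x).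
  by move=> c y z; rewrite !K_lact_linear !scalerDr !scalerA mulrC; apply: addrACA.
apply: (tensor_ext_linear (f := mklin (@K_lact_linear _ _ R A i (a *: u + v)))
  (g := mklin L)) => b w /=.
rewrite !K_lact_pure mulrDl -scalerAl.
exact: (linear_left w (tpure_bilinear A (Jt i))).
Qed.

Lemma K_lactZ i a c (x : K i) : K_lact a (c *: x) = c *: K_lact a x.
Proof. exact: (bilinearZl c x a (bilinear_flip (K_lact_bilinear i))). Qed.

Lemma K_lactM i a b (x : K i) : K_lact a (K_lact b x) = K_lact (a * b) x.
Proof.
have L : linear (fun x : K i => K_lact a (K_lact b x)).
  by move=> c y z; rewrite !K_lact_linear.
apply: (tensor_ext_linear (f := mklin L)
  (g := mklin (@K_lact_linear _ _ R A i (a * b)))) => c w /=.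
by rewrite !K_lact_pure mulrA.
Qed.

Lemma K_lact1 i (x : K i) : K_lact 1 x = x.
Proof.
apply: (tensor_ext_linear (f := mklin (@K_lact_linear _ _ R A i 1)) (g := idfun)) => b w /=.
by rewrite K_lact_pure mul1r.
Qed.

Lemma eps_A_K_bilinear i : bilinear_map (fun (a : A) (w : Jt i) => eps_A a *: w).
Proof.
split=> [a u v w|a u w z]; first by rewrite (eps_A_linear p) scalerDl scalerA.
by rewrite scalerDr !scalerA mulrC.
Qed.

(* The map K_i = A (x) J_i -> k (x)_A K_i = J_i. *)
Definition eps_K i : {linear K i -> Jt i} := tliftL (@eps_A_K_bilinear i).

Lemma eps_K_pure i a (w : Jt i) : eps_K i (tpure a w) = eps_A a *: w.
Proof. exact: tliftL_pure. Qed.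

Lemma eps_K_lact i a (x : K i) : eps_K i (K_lact a x) = eps_A a *: eps_K i x.
Proof.
have L1 : linear (fun x : K i => eps_K i (K_lact a x)).
  by move=> c y z; rewrite K_lact_linear; apply: (linearP (eps_K i)).
have L2 : linear (fun x : K i => eps_A a *: eps_K i x).
  by move=> c y z; rewrite (linearP (eps_K i)) scalerDr !scalerA mulrC.
apply: (tensor_ext_linear (f := mklin L1) (g := mklin L2)) => b w.
rewrite -[LHS]/(eps_K i (K_lact a (tpure b w))) -[RHS]/(_ *: eps_K i (tpure b w)).
by rewrite K_lact_pure !eps_K_pure eps_AM scalerA.
Qed.

Lemma proj_tpure_bilinear i : bilinear_map (fun (t : T) (u : Jt i) => tpure (p t) u : K i).
Proof. exact: (bilinear_pre p idfun (tpure_bilinear A (Jt i))). Qed.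

(* For x in T J_i = T (x) J_i, its image in A (x) J_i. *)
Definition proj_K i (x : T) : K i := tliftL (@proj_tpure_bilinear i) (split_right hR i x).

Lemma proj_K_linear i : linear (proj_K i).
Proof.
move=> a u v; rewrite /proj_K (linearP (split_right hR i)).
exact: (linearP (tliftL (@proj_tpure_bilinear i))).
Qed.

Lemma proj_KM i t (u : Jt i) : proj_K i (t * lsub_val u) = tpure (p t) u.
Proof. by rewrite /proj_K split_rightE; apply: tliftL_pure. Qed.

Lemma eps_K_proj i x : sprod (aug_ker V) (J i) x -> eps_K i (proj_K i x) = 0.
Proof.
have L : linear (fun x => eps_K i (proj_K i x)).
  by move=> a u v; rewrite proj_K_linear; apply: (linearP (eps_K i)).
apply: (lspan_eqz (f := mklin L) (g := \0)) => {}x [t [_ [et /lsub_lift[u <-] ->]]].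
rewrite -[LHS]/(eps_K i (proj_K i (t * lsub_val u))) proj_KM eps_K_pure eps_A_p.
by rewrite (et : eps_T t = 0) scale0r.
Qed.

Lemma K_of_KLR_pure i a (w : Jt i) c : K_of_KLR p (KLR_pure a w c) = eps_A c *: tpure a w.
Proof.
rewrite /K_of_KLR /KLR_pure tlift_pure; last exact: K_of_KLR_outer.
by rewrite tlift_pure //; apply: K_of_KLR_inner.
Qed.

Lemma K_of_KLR_linear i : linear (@K_of_KLR k V R A p i).
Proof. exact: (linearP (tliftL (K_of_KLR_outer R p i))). Qed.

Lemma K_of_KLR_lact i a (x : KLR i) : K_of_KLR p (KLR_lact a x) = K_lact a (K_of_KLR p x).
Proof.
have lL : linear (@KLR_lact k V R A i a).
  apply: tlift_linear; apply: tmap_bilinear => // c u v.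
  exact: (linear_right a (bilinear_mul A)).
have L1 : linear (fun x : KLR i => K_of_KLR p (KLR_lact a x)).
  by move=> c y z; rewrite lL K_of_KLR_linear.
have L2 : linear (fun x : KLR i => K_lact a (K_of_KLR p x)).
  by move=> c y z; rewrite K_of_KLR_linear K_lact_linear.
apply: (tensor_ext_linear (f := mklin L1) (g := mklin L2)) => b y /=.
have L3 : linear (fun y => K_of_KLR p (KLR_lact a (tpure b y)) : K i).
  by move=> c y1 y2; rewrite (linear_right _ (tpure_bilinear _ _)) L1.
have L4 : linear (fun y => K_lact a (K_of_KLR p (tpure b y)) : K i).
  by move=> c y1 y2; rewrite (linear_right _ (tpure_bilinear _ _)) L2.
apply: (tensor_ext_linear (f := mklin L3) (g := mklin L4)) => w d /=.
have -> : KLR_lact a (tpure b (tpure w d)) = KLR_pure (a * b) w d.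
  apply: (tlift_pure (b := fun u w => tpure (a * u) (idfun w))).
  apply: tmap_bilinear => // c u v.
  exact: (linear_right a (bilinear_mul A)).
rewrite K_of_KLR_pure -[tpure b _]/(KLR_pure b w d) K_of_KLR_pure.
by rewrite K_lactZ K_lact_pure.
Qed.

(** The scalars are absorbed into the terms, because the specifications of [deltab] speak of
    unweighted sums of admissible data. *)
Lemma lspan_sum_seq (Q : eqType) (ok : Q -> Prop) (h : Q -> T) (sc : k -> Q -> Q)
    (S : T -> Prop) x :
  (forall a q, ok q -> ok (sc a q)) -> (forall a q, h (sc a q) = a *: h q) ->
  (forall x, S x -> exists2 q, ok q & x = h q) -> lspan S x ->
  exists2 s : seq Q, (forall q, q \in s -> ok q) & x = \sum_(q <- s) h q.
Proof.
move=> oksc hsc hS [s sS ->]; elim: s sS => [|u s IH] sS.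
  by exists [::] => //; rewrite !big_nil.
have [q qs|t tok et] := IH; first by apply: sS; rewrite inE qs orbT.
have [q qok eq] := hS _ (sS u (mem_head _ _)).
exists (sc u.1 q :: t); last by rewrite !big_cons hsc et eq.
by move=> r; rewrite inE => /orP[/eqP ->|/tok //]; apply: oksc.
Qed.

(** The subtracted terms carry a letter in the right-hand copy of A, where the augmentation kills
    it; the remaining terms reassemble [w]. *)
Lemma delta_odd i (w : Jt i.+1) : ~~ odd i -> deltab_spec p (@deltab k V R A p i) ->
  delta (tpure 1 w) = proj_K i (lsub_val w).
Proof.
move=> ev [_]; rewrite (negbTE ev) => spec.
have [xl xr] : (sprod (Vsub V) (J i)) (lsub_val w) /\ (sprod (J i) (Vsub V)) (lsub_val w).
  have := lsub_valE w; rewrite {1}/Defs.J /= ev /Defs.J (negbTE ev).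
  by rewrite uphalf_half (negbTE ev) add0n.
have [s _ es] : exists2 s : seq (V * Jt i), (forall q, q \in s -> True) &
    lsub_val w = \sum_(q <- s) tinj q.1 * lsub_val q.2.
  apply: (lspan_sum_seq (sc := fun a q => (a *: q.1, q.2))) xl => // [a q|].
    by rewrite linearZ_LR -scalerAl.
  by move=> _ [_ [_ [/VsubP[v ->] /lsub_lift[u <-] ->]]]; exists (v, u).
have [t _ et] : exists2 s : seq (Jt i * V), (forall q, q \in s -> True) &
    lsub_val w = \sum_(q <- s) lsub_val q.1 * tinj q.2.
  apply: (lspan_sum_seq (sc := fun a q => (q.1, a *: q.2))) xr => // [a q|].
    by rewrite linearZ_LR -scalerAr.
  by move=> _ [_ [_ [/lsub_lift[u <-] /VsubP[v ->] ->]]]; exists (u, v).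
rewrite /delta /KLR_of_K tlift_pure; last exact: KLR_of_K_bilinear.
rewrite (spec w s t es et).
pose kk := mklin (@K_of_KLR_linear i); have kE x : K_of_KLR p x = kk x by [].
rewrite kE (linearB kk) !(linear_sum kk).
rewrite [X in _ - X]big1 ?subr0 => [|q _]; last first.
  by rewrite -kE K_of_KLR_pure eps_A_p eps_T_tinj scale0r.
rewrite es -[RHS]/(mklin (@proj_K_linear i) _) linear_sum.
by apply: eq_bigr => q _; rewrite -kE K_of_KLR_pure eps_A1 scale1r -proj_KM.
Qed.

Lemma sprod3_span (X Y Z : lsubspace T) x : sprod X (sprod Y Z) x ->
  lspan (fun x => exists a b c, [/\ X a, Y b, Z c & x = a * b * c]) x.
Proof.
move: x; apply: sprod_min => a y Xa Yy.
apply: (lspan_morph (linear_right a (bilinear_mul T)) _ Yy) => _ [b [c [Yb Zc ->]]].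
by apply: lspan_in; exists a, b, c; rewrite mulrA.
Qed.

Lemma delta_even i (w : Jt i.+1) : odd i -> deltab_spec p (@deltab k V R A p i) ->
  delta (tpure 1 w) = proj_K i (lsub_val w).
Proof.
move=> od [_]; rewrite od => spec.
have [pr [gpr _ _]] := length_grading V.
have Ji : J i = Jodd R i./2 by rewrite -{1}(odd_double_half i) od add1n J_doubleS.
have [wN [n [[_ wE] _ hw]]] : exists wN n, [/\ fin_sum (lsub_val w) wN n, wN 0%N = 0
    & forall N l, (l <= N)%N -> sprod (spow (Vsub V) l)
        (sprod (J i) (spow (Vsub V) (N - l))) (wN N)].
  rewrite Ji; apply: (Jeven_split_odd hR gpr).
  have := lsub_valE w; rewrite {1}/Defs.J /= od /= uphalfE.
  by rewrite -{1}(odd_double_half i) od add1n -doubleS doubleK.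
have hex (q : nat * nat) : exists s : seq (T * Jt i * T), (q.2 <= q.1)%N ->
    (forall r, r \in s -> spow (Vsub V) q.2 r.1.1 /\ spow (Vsub V) (q.1 - q.2) r.2) /\
    wN q.1 = \sum_(r <- s) r.1.1 * lsub_val r.1.2 * r.2.
  case: q => N l /=; case: (leqP l N) => [lN|_]; last by exists [::].
  have [|||s sok es] := lspan_sum_seq
    (ok := fun r : T * Jt i * T => spow (Vsub V) l r.1.1 /\ spow (Vsub V) (N - l) r.2)
    (h := fun r => r.1.1 * lsub_val r.1.2 * r.2)
    (sc := fun a r => (a *: r.1.1, r.1.2, r.2)) _ _ _ (sprod3_span (hw N l lN)).
  - by move=> a r [r1 r2]; split=> //=; apply: lsubZ.
  - by move=> a r; rewrite /= -!scalerAl.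
  - by move=> _ [a [_ [c [ha /lsub_lift[u <-] hc ->]]]]; exists (a, u, c).
  by exists s.
have [s hs] := choice hex.
have hs' N l : (N < n)%N -> (l <= N)%N ->
    (forall r, r \in s (N, l) -> spow (Vsub V) l r.1.1 /\ spow (Vsub V) (N - l) r.2) /\
    wN N = \sum_(r <- s (N, l)) r.1.1 * lsub_val r.1.2 * r.2.
  by move=> _; apply: (hs (N, l)).
rewrite /delta /KLR_of_K tlift_pure; last exact: KLR_of_K_bilinear.
rewrite (spec w n wN (fun N l => s (N, l)) wE hs').
pose kk := mklin (@K_of_KLR_linear i); have kE x : K_of_KLR p x = kk x by [].
rewrite kE (linear_sum kk) wE -[RHS]/(mklin (@proj_K_linear i) _) linear_sum.
(* Only [l = N] survives: for [l < N] the right-hand factor lies in a positive power of V, which the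
   augmentation kills. *)
apply: eq_bigr => N _; rewrite (linear_sum kk) big_ord_recr /= big1 ?add0r => [|l _].
  have [hN ->] := hs (nat_of_ord N, nat_of_ord N) (leqnn _).
  rewrite kE (linear_sum kk) -[RHS]/(mklin (@proj_K_linear i) _) linear_sum.
  rewrite big_seq [RHS]big_seq; apply: eq_bigr => r /hN[_ /=].
  rewrite subnn => /scalarsP[c ->].
  rewrite -?kE K_of_KLR_pure eps_A_p -scalerAr mulr1.
  rewrite -[RHS]/(mklin (@proj_K_linear i) _) linearZ_LR /= proj_KM.
  rewrite -[eps_T _]/(mklin (@eps_T_linear k V) _) linearZ_LR /= eps_T1.
  by rewrite -[c *: _]/(c * 1) mulr1.
rewrite kE (linear_sum kk) big_seq big1 // => r.
have [hN _] := hs (nat_of_ord N, nat_of_ord l) (ltnW (ltn_ord l)).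
move=> /hN[_ /=]; have : (0 < N - l)%N by rewrite subn_gt0.
case: (N - l)%N => [//|m] _ /aug_ker_spow; rewrite aug_kerE => e.
by rewrite -?kE K_of_KLR_pure eps_A_p e scale0r.
Qed.

Lemma delta_lact i a (x : K i.+1) : deltab_spec p (@deltab k V R A p i) ->
  delta (K_lact a x) = K_lact a (delta x).
Proof.
move=> [[_ bl _] _]; rewrite /delta -K_of_KLR_lact -bl; congr (K_of_KLR p (deltab p _)).
have lL : linear (@KLR_lact k V R A i.+1 a).
  apply: tlift_linear; apply: tmap_bilinear => // c u v.
  exact: (linear_right a (bilinear_mul A)).
have kL : linear (@KLR_of_K k V R A i.+1) := tlift_linear (KLR_of_K_bilinear R A i.+1).
have L1 : linear (fun x : K i.+1 => KLR_of_K (K_lact a x)).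
  by move=> c y z; rewrite K_lact_linear kL.
have L2 : linear (fun x : K i.+1 => KLR_lact a (KLR_of_K x)).
  by move=> c y z; rewrite kL lL.
apply: (tensor_ext_linear (f := mklin L1) (g := mklin L2)) => b w /=.
rewrite K_lact_pure /KLR_of_K !tlift_pure; try exact: KLR_of_K_bilinear.
apply/esym; apply: (tlift_pure (b := fun u w => tpure (a * u) (idfun w))).
apply: tmap_bilinear => // c u v.
exact: (linear_right a (bilinear_mul A)).
Qed.

Lemma delta_spec_pure i a (w : Jt i.+1) : deltab_spec p (@deltab k V R A p i) ->
  delta (tpure a w) = K_lact a (proj_K i (lsub_val w)).
Proof.
move=> spec; rewrite -[a]mulr1 -K_lact_pure delta_lact // mulr1.
by case: (boolP (odd i)) => oi; [rewrite delta_even|rewrite delta_odd].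
Qed.

(** The second alternative is the default value of [xget]; [delta_pure] disposes of it by exactness
    instead of constructing the bimodule differential. *)
Lemma deltab_dichotomy i : deltab_spec p (@deltab k V R A p i) \/
  forall x : K i.+1, delta x = 0.
Proof.
rewrite /delta /deltab; case: xgetP => [f _ hf|_]; [by left|right=> x].
by rewrite -[K_of_KLR p 0]/(mklin (@K_of_KLR_linear i) 0) linear0.
Qed.

(** Minimality, by [J_succ]. It covers both cases of [deltab_dichotomy], since the degenerate case
    of [delta_pure] relies on it. *)
Lemma eps_K_delta i (x : K i.+1) : eps_K i (delta x) = 0.
Proof.
have [spec|d0] := deltab_dichotomy i; last by rewrite d0 linear0.
have L : linear (fun x : K i.+1 => eps_K i (delta x)).
  by move=> a u v; rewrite delta_linear; apply: (linearP (eps_K i)).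
apply: (tensor_ext_linear (f := mklin L) (g := \0)) => a w.
rewrite -[LHS]/(eps_K i (delta (tpure a w))) delta_spec_pure // eps_K_lact.
by rewrite eps_K_proj ?scaler0 //; apply/(J_succ hR)/lsub_valE.
Qed.

Hypothesis hK : multi_koszul R p.

(* Should no map satisfy the specification of deltab, exactness would force J_{i+1} = 0. *)
Lemma delta_pure i a (w : Jt i.+1) :
  delta (tpure a w) = K_lact a (proj_K i (lsub_val w)).
Proof.
have [spec|d0] := deltab_dichotomy i; first exact: delta_spec_pure.
have [_ _ ex] := hK.
suff -> : w = 0.
  rewrite lsub_val0 (bilinear0r _ (tpure_bilinear _ _)) linear0.
  rewrite -[proj_K i 0]/(mklin (@proj_K_linear i) 0) linear0.
  by rewrite (bilinear0r _ (K_lact_bilinear i)).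
have /ex[y ey] := d0 (tpure 1 w).
have := eps_K_delta y; rewrite -ey eps_K_pure eps_A1 scale1r.
exact.
Qed.

Lemma delta_A_linear i : A_linear (@Defs.delta k V R A p i).
Proof.
split=> [|a x]; first exact: delta_linear.
have L1 : linear (fun x : K i.+1 => delta (K_lact a x)).
  by move=> c y z; rewrite K_lact_linear delta_linear.
have L2 : linear (fun x : K i.+1 => K_lact a (delta x)).
  by move=> c y z; rewrite delta_linear K_lact_linear.
apply: (tensor_ext_linear (f := mklin L1) (g := mklin L2)) => b w /=.
by rewrite K_lact_pure !delta_pure K_lactM.
Qed.

Lemma delta_delta i (x : K i.+2) : delta (delta x) = 0.
Proof. by have [_ _ ex] := hK; apply/ex; exists x. Qed.

Lemma delta0_delta (x : K 1) : delta0 p (delta x) = 0.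
Proof. by have [_ ex _] := hK; apply/ex; exists x. Qed.

End Differential.

(** * The grading of the spaces J_i *)

Section GradedSubspaces.
Variables (k : fieldType) (V : lmodType k) (Vdeg : nat -> lsubspace V).
Hypothesis Vgr : is_grading Vdeg.
Local Notation T := (talg V).
Local Notation Tdeg := (Tdeg Vdeg).
Variable R : lsubspace T.
Hypothesis hR : relation_space Vdeg R.

Definition graded_sub (W : lsubspace T) : Prop :=
  forall x, W x -> lspan (fun y => W y /\ exists n, Tdeg n y) x.

Lemma graded_sub_component (W : lsubspace T) pr x n : graded_by Tdeg pr -> graded_sub W ->
  W x -> W (pr x n).
Proof.
move=> [_ prE _] gW /gW hx.
have L : linear (fun x => pr x n) by move=> a u v; rewrite linearP.
apply: (lspan_morph L _ hx) => y [Wy [m hy]].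
by rewrite (prE m) //; case: eqP => // _; apply: lsub0.
Qed.

Lemma component_graded_sub (W : lsubspace T) pr : graded_by Tdeg pr ->
  (forall x n, W x -> W (pr x n)) -> graded_sub W.
Proof.
move=> [Gpr _ fin] hW x Wx; have [n [_ ->]] := fin x.
by apply: lsub_sum => i _; apply: lspan_in; split; [apply: hW|exists i].
Qed.

Lemma graded_sub_scalars : graded_sub (scalars V).
Proof.
move=> x /scalarsP[c ->]; apply/lsubZ/lspan_in; split; first exact: scalars1.
exists 0%N; exact: Tdeg_one.
Qed.

Lemma graded_sub_V : graded_sub (Vsub V).
Proof.
have [pv gV] := grading_projections Vgr.
move=> x /VsubP[v ->]; have := graded_by_span v gV.
apply: lspan_morph; first exact: tinj_linear.
move=> {}v [n hv]; apply: lspan_in; split; first exact: Vsub_tinj.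
by exists n; apply: Tdeg_tinj.
Qed.

Lemma graded_sub_sprod X Y : graded_sub X -> graded_sub Y -> graded_sub (sprod X Y).
Proof.
move=> gX gY; apply: sprod_min => u v /gX Xu /gY Yv.
apply: (lspan_bilinear (bilinear_mul T) _ Xu Yv) => x y [Xx [m hm]] [Yy [n hn]].
apply: lspan_in; split; first exact: sprod_in.
by exists (m + n)%N; apply: Tdeg_mul.
Qed.

Lemma graded_sub_spow X n : graded_sub X -> graded_sub (spow X n).
Proof.
move=> gX; elim: n => [|n]; first exact: graded_sub_scalars.
exact: graded_sub_sprod.
Qed.

Lemma graded_sub_cap X Y : graded_sub X -> graded_sub Y -> graded_sub (lcap X Y).
Proof.
have [pr [gpr _]] := tensor_grading Vgr.
move=> gX gY; apply: (component_graded_sub gpr) => x n [Xx Yx].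
by split; apply: (graded_sub_component _ gpr).
Qed.

Lemma graded_sub_relations : graded_sub R.
Proof. by have [_ ? _] := hR. Qed.

Lemma graded_sub_interleave Je n m : (forall a, (a <= sumn n)%N -> graded_sub (Je a)) ->
  graded_sub (interleave Je n m).
Proof.
elim: n m => [|a n IH] [|b m] h; try exact: graded_sub_scalars.
  exact/graded_sub_spow/graded_sub_V.
apply: graded_sub_sprod; first exact/graded_sub_spow/graded_sub_V.
apply: graded_sub_sprod; first by apply: h; apply: leq_addr.
by apply: IH => c le_c; apply: h; apply: leq_trans le_c (leq_addl _ _).
Qed.

(** Being graded amounts to stability under taking components, a form that passes to intersections.
    Strong induction, since every earlier J_{2a} may occur in an interleaved product. *)
Lemma graded_sub_Jeven n : graded_sub (Jeven R n).
Proof.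
have [pr [gpr _]] := tensor_grading Vgr.
elim/ltn_ind: n => -[|[|n]] IH; first exact: graded_sub_scalars.
  exact: graded_sub_relations.
rewrite JevenSS; apply: graded_sub_cap; last exact/graded_sub_spow/graded_sub_relations.
apply: (component_graded_sub gpr) => x i.
have L : linear (fun x => pr x i) by move=> a u v; rewrite linearP.
apply: (lspan_morph L) => y [N N1 hy]; apply: lspan_in; exists N => // t m st sm.
apply: (graded_sub_component _ gpr); last exact: hy.
apply: graded_sub_interleave => a; rewrite st => an.
exact: IH.
Qed.

Lemma graded_sub_J i : graded_sub (J R i).
Proof.
apply: (J_parity (P := fun _ W => graded_sub W)) => n; first exact: graded_sub_Jeven.
by apply: graded_sub_cap; apply: graded_sub_sprod;
  do [exact: graded_sub_V|exact: graded_sub_Jeven].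
Qed.

End GradedSubspaces.

(** * Lifting functionals to cocycles *)

Section ExplicitCocycle.
Variables (k : fieldType) (V : lmodType k) (Vdeg : nat -> lsubspace V).
Hypothesis Vgr : is_grading Vdeg.
Local Notation T := (talg V).
Variables (R : lsubspace T) (A : algType k) (p : {lrmorphism T -> A}).
Hypothesis hR : relation_space Vdeg R.
Hypothesis hp : is_presentation R p.
Hypothesis hK : multi_koszul R p.
Local Notation J := (J R).
Local Notation Jt := (Jt R).
Local Notation K := (K R A).
Local Notation proj_K := (proj_K p hR).
Local Notation Tdeg := (Tdeg Vdeg).
Variable d : nat.

Lemma contract_bilinear (g : {linear Jt d -> k^o}) :
  bilinear_map (fun (t : T) (v : Jt d) => (g v : k) *: t).
Proof.
have := bilinear_flip (bilinear_pre g (idfun : {linear T -> T}) (@bilinear_scale k T)).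
exact.
Qed.

Definition contract (g : {linear Jt d -> k^o}) (x : T) : T :=
  tliftL (contract_bilinear g) (split_right hR d x).

Lemma contractE g t (v : Jt d) : contract g (t * lsub_val v) = (g v : k) *: t.
Proof. by rewrite /contract split_rightE; apply: tliftL_pure. Qed.

Lemma contract_linear g : linear (contract g).
Proof.
move=> a u v; rewrite /contract (linearP (split_right hR d)).
exact: (linearP (tliftL (contract_bilinear g))).
Qed.

(* t u v |-> g(v) pi(t) (x) u on T J_l J_d *)
Definition cap_K (g : {linear Jt d -> k^o}) l (x : T) : K l := proj_K l (contract g x).

Lemma cap_KE g l t (u : Jt l) (v : Jt d) :
  cap_K g l (t * (lsub_val u * lsub_val v)) = (g v : k) *: tpure (p t) u.
Proof.
rewrite /cap_K mulrA contractE -[LHS]/(mklin (proj_K_linear p hR l) _).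
by rewrite linearZ_LR /= proj_KM.
Qed.

Lemma cap_K_linear g l : linear (cap_K g l).
Proof. by move=> a u v; rewrite /cap_K contract_linear proj_K_linear. Qed.

Definition TJJ l := sprod (lfull T) (sprod (J l) (J d)).

Lemma TJJ_eq l (M : lmodType k) (f g : T -> M) (fL : linear f) (gL : linear g) :
  (forall t (u : Jt l) (v : Jt d), f (t * (lsub_val u * lsub_val v)) =
     g (t * (lsub_val u * lsub_val v))) ->
  forall x, TJJ l x -> f x = g x.
Proof.
move=> h; apply: (lspan_eqz (f := mklin fL) (g := mklin gL)) => x [t [y [_ Jy ->]]] /=.
have L1 : linear (fun y => f (t * y)).
  by move=> a u v; rewrite (linear_right t (bilinear_mul T)) fL.
have L2 : linear (fun y => g (t * y)).
  by move=> a u v; rewrite (linear_right t (bilinear_mul T)) gL.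
apply: (lspan_eqz (f := mklin L1) (g := mklin L2)) Jy.
by move=> _ [_ [_ [/lsub_lift[u <-] /lsub_lift[v <-] ->]]] /=.
Qed.

Lemma cap_K_lact g l s x : TJJ l x -> cap_K g l (s * x) = K_lact (p s) (cap_K g l x).
Proof.
apply: (TJJ_eq (f := fun x => cap_K g l (s * x)) (g := fun x => K_lact (p s) (cap_K g l x))).
- by move=> a u v; rewrite (linear_right s (bilinear_mul T)) cap_K_linear.
- by move=> a u v; rewrite cap_K_linear K_lact_linear.
by move=> t u v; rewrite mulrA !cap_KE K_lactZ K_lact_pure rmorphM.
Qed.

(** Write u in J_{l+1} as a sum of products s w with w in J_l: both sides become g(v) pi(t s) (x)
    w. *)
Lemma delta_cap_K g l x : TJJ l.+1 x -> delta p (cap_K g l.+1 x) = cap_K g l x.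
Proof.
apply: (TJJ_eq (f := fun x => delta p (cap_K g l.+1 x)) (g := cap_K g l)).
- by move=> a u v; rewrite cap_K_linear delta_linear.
- exact: cap_K_linear.
move=> t u v; rewrite cap_KE linearZ_LR /= (delta_pure hR hp hK).
have := J_succ hR (lsub_valE u).
have L1 : linear (fun x => (g v : k) *: K_lact (p t) (proj_K l x)).
  move=> a y z; rewrite proj_K_linear K_lact_linear scalerDr !scalerA.
  by rewrite mulrC.
have L2 : linear (fun x => cap_K g l (t * (x * lsub_val v))).
  move=> a y z; rewrite (linear_left _ (bilinear_mul T)) (linear_right _ (bilinear_mul T)).
  exact: cap_K_linear.
apply: (lspan_eqz (f := mklin L1) (g := mklin L2)) => _ [s [_ [_ /lsub_lift[w <-] ->]]] /=.
by rewrite proj_KM K_lact_pure -rmorphM -(mulrA s) (mulrA t) cap_KE.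
Qed.

(** A cap product with [g], extended A-linearly. It is meant for [j = l + d]; leaving [j] free keeps
    index arithmetic out of its type. *)
Definition cap_map_lift g j l : K j -> K l :=
  tlift (fun a (w : Jt j) => K_lact a (cap_K g l (lsub_val w))).

Lemma cap_map_bilinear g j l :
  bilinear_map (fun a (w : Jt j) => K_lact a (cap_K g l (lsub_val w))).
Proof.
apply: (bilinear_pre (idfun : {linear A -> A})
  (mklin (f := fun w : Jt j => cap_K g l (lsub_val w)) _) (@K_lact_bilinear _ _ R A l)).
by move=> a u v; rewrite lsub_val_linear cap_K_linear.
Qed.

Lemma cap_map_pure g j l a (w : Jt j) :
  cap_map_lift g l (tpure a w) = K_lact a (cap_K g l (lsub_val w)).
Proof. exact: (tlift_pure _ _ (cap_map_bilinear g j l)). Qed.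

Lemma cap_map_linear g j l : linear (@cap_map_lift g j l).
Proof. exact: (tlift_linear (cap_map_bilinear g j l)). Qed.

Lemma cap_map_A_linear g j l : A_linear (@cap_map_lift g j l).
Proof.
split=> [|a x]; first exact: cap_map_linear.
have L1 : linear (fun x : K j => cap_map_lift g l (K_lact a x)).
  by move=> c y z; rewrite K_lact_linear cap_map_linear.
have L2 : linear (fun x : K j => K_lact a (cap_map_lift g l x)).
  by move=> c y z; rewrite cap_map_linear K_lact_linear.
apply: (tensor_ext_linear (f := mklin L1) (g := mklin L2)) => b w /=.
by rewrite K_lact_pure !cap_map_pure K_lactM.
Qed.

Lemma cap_map_chain g l (x : K (l + d).+1) :
  delta p (cap_map_lift g l.+1 x) = cap_map_lift g l (delta p x).
Proof.
have L1 : linear (fun x : K (l + d).+1 => delta p (cap_map_lift g l.+1 x)).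
  by move=> c y z; rewrite cap_map_linear delta_linear.
have L2 : linear (fun x : K (l + d).+1 => cap_map_lift g l (delta p x)).
  by move=> c y z; rewrite delta_linear cap_map_linear.
apply: (tensor_ext_linear (f := mklin L1) (g := mklin L2)) => b w /=.
rewrite cap_map_pure (delta_pure hR hp hK).
have [_ dA] := delta_A_linear hR hp hK l.
have [_ cA] := cap_map_A_linear g (l + d) l.
rewrite dA cA; congr K_lact.
rewrite delta_cap_K; last exact: (J_add_full hR (i := l.+1) (lsub_valE w)).
have := J_succ hR (lsub_valE w).
have L3 : linear (fun x => cap_map_lift g l (proj_K (l + d) x)).
  by move=> a y z; rewrite proj_K_linear cap_map_linear.
apply: (lspan_eqz (f := mklin (@cap_K_linear g l)) (g := mklin L3)).
move=> _ [t [_ [_ /lsub_lift[u <-] ->]]] /=.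
by rewrite proj_KM cap_map_pure cap_K_lact //; apply: (J_add_full hR (lsub_valE u)).
Qed.

Lemma TJJ_homogeneous l x : TJJ l x ->
  lspan (fun x => exists t (u : Jt l) (v : Jt d), (exists d1 d2 d3,
    [/\ Tdeg d1 t, Tdeg d2 (lsub_val u) & Tdeg d3 (lsub_val v)]) /\
    x = t * (lsub_val u * lsub_val v)) x.
Proof.
move: x; apply: sprod_min => t y _.
apply: (lspan_morph (linear_right t (bilinear_mul T))) => _ [u0 [v0 [Ju Jv ->]]].
have hu := graded_sub_J Vgr hR Ju; have hv := graded_sub_J Vgr hR Jv.
have L1 : bilinear_map (fun u v : T => t * (u * v)).
  exact: (bilinear_comp (mklin (linear_right t (bilinear_mul T))) (bilinear_mul T)).
apply: (lspan_bilinear L1 _ hu hv) => u v [/lsub_lift[{}u <-] [d2 h2]] [/lsub_lift[{}v <-] [d3 h3]].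
have L2 := linear_left (lsub_val u * lsub_val v) (bilinear_mul T).
apply: (lspan_morph L2 _ (Tdeg_span Vgr t)) => s [d1 h1].
by apply: lspan_in; exists s, u, v; split=> //; exists d1, d2, d3.
Qed.

Lemma cap_K_degree (g : {linear Jt d -> k^o}) n l r x :
  (forall m (v : Jt d), Tdeg m (lsub_val v) -> m != n -> g v = 0) ->
  TJJ l x -> Tdeg r x -> Kdeg Vdeg R p l (r%:Z - n%:Z) (cap_K g l x).
Proof.
move=> gn /TJJ_homogeneous Jx hx.
have [pr [[_ prE _] _]] := tensor_grading Vgr.
(* A decomposition of [x] into homogeneous products may involve other degrees; taking the component
   of degree [r] removes them. *)
have -> : x = pr x r by rewrite (prE r) // eqxx.
have L : linear (fun x => cap_K g l (pr x r)).
  by move=> a u v; rewrite linearP; apply: cap_K_linear.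
apply: (lspan_morph L _ Jx) => _ [t [u [v [[d1 [d2 [d3 [h1 h2 h3]]]] ->]]]].
have ht : Tdeg (d1 + (d2 + d3)) (t * (lsub_val u * lsub_val v)).
  by apply: Tdeg_mul => //; apply: Tdeg_mul.
rewrite (prE _ _ _ ht); case: eqP => [e|_]; last first.
  by rewrite -[cap_K g l 0]/(mklin (cap_K_linear g l) 0) linear0; apply: lsub0.
rewrite cap_KE; have [d3n|/gn -> //] := eqVneq d3 n; last by rewrite scale0r; apply: lsub0.
apply/lsubZ/lspan_in; exists d1, d2, (p t), u; split=> //.
  by apply: lspan_in; exists t.
by rewrite e -d3n addnA PoszD addrK.
Qed.

Lemma Kdeg_lact l (a : A) q n (x : K l) : Adeg Vdeg p q a -> Kdeg Vdeg R p l n x ->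
  Kdeg Vdeg R p l (q%:Z + n) (K_lact a x).
Proof.
move=> ha; apply: lspan_morph; first exact: K_lact_linear.
move=> _ [q1 [q2 [b [w [hb hw -> ->]]]]]; rewrite K_lact_pure.
apply: lspan_in; exists (q + q1)%N, q2, (a * b), w; split=> //.
  apply: (lspan_bilinear (bilinear_mul A) _ ha hb) => _ _ [t ht ->] [s hs ->].
  by apply: lspan_in; exists (t * s); rewrite ?rmorphM //; apply: Tdeg_mul.
by rewrite !PoszD addrA.
Qed.

Lemma cap_map_hom_deg (g : {linear Jt d -> k^o}) n l :
  (forall m (v : Jt d), Tdeg m (lsub_val v) -> m != n -> g v = 0) ->
  hom_deg Vdeg p (- n%:Z) (@cap_map_lift g (l + d) l).
Proof.
move=> gn; split; first exact: cap_map_A_linear.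
move=> m x; apply: lspan_morph; first exact: cap_map_linear.
move=> _ [q [r [a [w [ha hw -> ->]]]]]; rewrite cap_map_pure PoszD -addrA.
apply: Kdeg_lact => //; apply: cap_K_degree => //.
exact: (J_add_full hR (lsub_valE w)).
Qed.

Lemma hom_degZ i j e c (f : K i -> K j) : hom_deg Vdeg p e f ->
  hom_deg Vdeg p e (fun x => c *: f x).
Proof.
move=> [[fl fA] fd]; split; last by move=> n x /fd hx; apply: lsubZ.
split=> [a u v|a x]; last by rewrite fA K_lactZ.
by rewrite fl scalerDr !scalerA mulrC.
Qed.

(** [gn n] evaluates [g] on the n-th component, which stays in J_d because J_d is graded; the bound
    in [graded_dual] leaves finitely many of them, as [graded_hom] demands. *)
Lemma dual_components (g : {linear Jt d -> k^o}) : graded_dual Vdeg (g : Jt d -> k) ->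
  exists N (gn : nat -> {linear Jt d -> k^o}),
    (forall n m v, Tdeg m (lsub_val v) -> m != n -> gn n v = 0) /\
    forall v, g v = \sum_(n < N) gn n v.
Proof.
move=> [_ [N gN]]; have [pr [gpr _]] := tensor_grading Vgr.
have [prT prE fin] := gpr.
have [r rK] := lsub_retraction (J d).
have prJ n (v : Jt d) : lsub_val (r (pr (lsub_val v) n)) = pr (lsub_val v) n.
  have /lsub_lift[u <-] := graded_sub_component n gpr (graded_sub_J Vgr hR (i := d)) (lsub_valE v).
  by rewrite rK.
have L n : linear (fun v : Jt d => g (r (pr (lsub_val v) n)) : k^o).
  move=> a u v; rewrite lsub_val_linear (linearP pr).
  by rewrite -[(a *: _ + _) n]/(a *: pr (lsub_val u) n + pr (lsub_val v) n) (linearP r) (linearP g).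
exists N, (fun n => mklin (L n)); split=> [n m v hv mn|v] /=.
  by rewrite (prE m) // eq_sym (negbTE mn) !linear0.
have [M hM] := fin (lsub_val v).
have [M0 eM] := fin_sum_widen (leq_maxr N M) hM.
have ev : v = \sum_(n < maxn N M) r (pr (lsub_val v) n).
  apply: lsub_inj; rewrite (linear_sum (@lsub_val _ _ (J d) : {linear _ -> _})) {1}eM.
  by apply: eq_bigr => n _; apply/esym/prJ.
rewrite {1}ev (linear_sum g).
rewrite (big_ord_widen _ (fun n => g (r (pr (lsub_val v) n))) (leq_maxl N M)).
rewrite [LHS](bigID (fun i : 'I_(maxn N M) => (i < N)%N)) /= [X in _ + X]big1 ?addr0 // => n.
by rewrite -leqNgt => Nn; apply: (gN n) => //; rewrite prJ.
Qed.

Lemma cap_map_graded_hom (g : {linear Jt d -> k^o}) c l :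
  graded_dual Vdeg (g : Jt d -> k) ->
  graded_hom Vdeg p (fun x => c *: @cap_map_lift g (l + d) l x).
Proof.
move=> /dual_components[N [gn [ghom gsum]]].
exists [seq (- n%:Z, fun x => c *: @cap_map_lift (gn n) (l + d) l x) | n <- iota 0 N].
  by move=> q /mapP[n _ ->]; apply/hom_degZ/cap_map_hom_deg/ghom.
move=> x; rewrite big_map /= -scaler_sumr; congr (_ *: _).
rewrite -[N]subn0 -/(index_iota 0 N) big_mkord.
have csum y : contract g y = \sum_(n < N) contract (gn n) y.
  rewrite /contract; set z := split_right _ _ _.
  have L : linear (fun z => \sum_(n < N) tliftL (contract_bilinear (gn n)) z).
    move=> a u v; rewrite scaler_sumr -big_split; apply: eq_bigr => n _.
    exact: (linearP (tliftL _)).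
  apply: (tensor_ext_linear (f := tliftL (contract_bilinear g)) (g := mklin L)) => t v.
  rewrite -[RHS]/(\sum_(n < N) tliftL (contract_bilinear (gn n)) (tpure t v)).
  rewrite tliftL_pure gsum scaler_suml; apply: eq_bigr => n _.
  by rewrite tliftL_pure.
have L : linear (fun x => \sum_(n < N) @cap_map_lift (gn n) (l + d) l x).
  move=> a u v; rewrite scaler_sumr -big_split; apply: eq_bigr => n _.
  exact: cap_map_linear.
apply: (tensor_ext_linear (f := mklin (@cap_map_linear g (l + d) l)) (g := mklin L)) => a w /=.
rewrite cap_map_pure /cap_K csum.
rewrite -[proj_K l _]/(mklin (proj_K_linear p hR l) _) linear_sum.
rewrite -[K_lact a _]/(mklin (@K_lact_linear _ _ R A l a) _) linear_sum.
by apply: eq_bigr => n _; rewrite cap_map_pure.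
Qed.

(* The signs turn commutation with delta into the cocycle condition, and make delta_0 recover g on J_d. *)
Definition cap_cochain (g : {linear Jt d -> k^o}) : matrices R A := fun j l x =>
  if j == (l + d)%N then (-1) ^+ (d * l.+1) *: cap_map_lift g l x else 0.

Lemma cap_cocycle (g : {linear Jt d -> k^o}) : graded_dual Vdeg (g : Jt d -> k) ->
  is_cocycle Vdeg p d%:Z (cap_cochain g).
Proof.
move=> gdual; split; first split=> [j l|j l ne x].
- rewrite /cap_cochain; case: eqP => [->|_]; last exact: graded_hom0.
  exact: cap_map_graded_hom.
- rewrite /cap_cochain; case: eqP => // e; case: ne.
  by rewrite e PoszD addrC addKr.
apply: matrices_ext => j l x; rewrite -[RHS]/(0 : K l) /cdiff /cap_cochain.
case: j x => [|j] x /=; first by rewrite linear0 scaler0 subr0.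
rewrite addSn eqSS; case: eqP => [e|_]; last by rewrite linear0 scaler0 subr0.
move: x; rewrite e => x; rewrite linearZ_LR /= cap_map_chain.
(* The signs must satisfy s_{l+1} = (-1)^d s_l, and s_0 = (-1)^d cancels the sign in [ext_to_dual];
   hence the exponent d (l + 1). *)
rewrite scalerA -exprnP -exprD -mulnS subrr //.
Qed.

End ExplicitCocycle.

(** * The Yoneda product *)

Section YonedaProduct.
Variables (k : fieldType) (V : lmodType k) (Vdeg : nat -> lsubspace V).
Hypothesis Vgr : is_grading Vdeg.
Local Notation T := (talg V).
Variables (R : lsubspace T) (A : algType k) (p : {lrmorphism T -> A}).
Hypothesis hR : relation_space Vdeg R.
Hypothesis hp : is_presentation R p.
Hypothesis hK : multi_koszul R p.
Local Notation J := (J R).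
Local Notation Jt := (Jt R).
Local Notation K := (K R A).
Local Notation proj_K := (proj_K p hR).
Local Notation eps_K := (eps_K R p).
Local Notation cap_K := (cap_K p hR).
Local Notation Tdeg := (Tdeg Vdeg).

(** [K m] is free on 1 (x) J_m, so values on generators are lifted by a generalized inverse of
    [delta]. The lift is A-linear only, which is enough to control it modulo the augmentation
    ideal. *)
Lemma A_linear_lift m n (f : K m -> K n) : A_linear f ->
  (forall x, exists y, f x = delta p y) ->
  exists h : K m -> K n.+1, A_linear h /\ forall x, f x = delta p (h x).
Proof.
move=> [fl fA] fim.
have [g hg] := generalized_inverse (@delta k V R A p n : {linear K n.+1 -> K n}).
have [_ dA] := delta_A_linear hR hp hK n.
have L : linear (fun w : Jt m => g (f (tpure 1 w))).
  by move=> a u v; rewrite (linear_right _ (tpure_bilinear _ _)) fl (linearP g).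
have hb : bilinear_map (fun a (w : Jt m) => K_lact a (g (f (tpure 1 w)))).
  exact: (bilinear_pre (idfun : {linear A -> A}) (mklin L) (K_lact_bilinear R A n.+1)).
pose h := tliftL hb; have hE a w : h (tpure a w) = K_lact a (g (f (tpure 1 w))).
  exact: tliftL_pure.
exists h; split; first split=> [|a x]; first exact: (linearP h).
  have L1 : linear (fun x : K m => h (K_lact a x)).
    by move=> c y z; rewrite K_lact_linear (linearP h).
  have L2 : linear (fun x : K m => K_lact a (h x)).
    by move=> c y z; rewrite (linearP h) K_lact_linear.
  apply: (tensor_ext_linear (f := mklin L1) (g := mklin L2)) => b w.
  rewrite -[LHS]/(h (K_lact a (tpure b w))) -[RHS]/(K_lact a (h (tpure b w))).
  by rewrite K_lact_pure !hE K_lactM.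
have L3 : linear (fun x => delta p (h x)).
  by move=> c y z; rewrite (linearP h) delta_linear.
apply: (tensor_ext_linear (f := mklin fl) (g := mklin L3)) => a w.
rewrite -[LHS]/(f (tpure a w)) -[RHS]/(delta p (h (tpure a w))) hE dA.
have [y ey] := fim (tpure 1 w).
have -> : delta p (g (f (tpure 1 w))) = f (tpure 1 w) by rewrite ey; apply: hg.
by rewrite -fA K_lact_pure mulr1.
Qed.

Lemma graded_hom_A_linear m n (f : K m -> K n) : graded_hom Vdeg p f -> A_linear f.
Proof.
move=> hf; split; first exact: graded_hom_linear hf.
have [s hs fs] := hf => a x; rewrite !fs.
rewrite -[RHS]/(mklin (@K_lact_linear _ _ R A n a) _) linear_sum.
by rewrite big_seq [RHS]big_seq; apply: eq_bigr => q /hs[[_ qA] _]; apply: qA.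
Qed.

Lemma cocycle_delta i F j l (x : K j.+1) : is_cocycle Vdeg p i F ->
  delta p (F j.+1 l.+1 x) = (-1) ^ i *: F j l (delta p x).
Proof.
move=> [_ /(congr1 (fun G : matrices R A => G j.+1 l x)) /eqP].
by rewrite -[X in _ == X]/(0 : K l) subr_eq0 => /eqP.
Qed.

Lemma eps_K_A_linear m n (h : K m -> K n) x : A_linear h ->
  sprod (aug_ker V) (J m) x -> eps_K n (h (proj_K m x)) = 0.
Proof.
move=> [hl hA]; have L : linear (fun x => eps_K n (h (proj_K m x))).
  by move=> a u v; rewrite proj_K_linear hl; apply: (linearP (eps_K n)).
apply: (lspan_eqz (f := mklin L) (g := \0)) => {}x [t [_ [et /lsub_lift[u <-] ->]]].
rewrite -[LHS]/(eps_K n (h (proj_K m (t * lsub_val u)))) proj_KM.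
rewrite -[p t]mulr1 -K_lact_pure hA (eps_K_lact hR hp) (eps_A_p hR hp).
by move: et; rewrite aug_kerE => ->; rewrite scale0r.
Qed.

Lemma delta0_bilinear : bilinear_map (fun (a : A) (w : Jt 0) =>
  eps_A p a * eps_T (lsub_val w) : k^o).
Proof.
split=> [a u v w|a u w z]; first by rewrite eps_A_linear mulrDl scalerAl.
by rewrite lsub_val_linear eps_T_linear mulrDr scalerAr.
Qed.

Lemma delta0_pure a (w : Jt 0) : delta0 p (tpure a w) = eps_A p a * eps_T (lsub_val w).
Proof. exact: (tlift_pure _ _ delta0_bilinear). Qed.

Lemma delta0_linear : linear (@delta0 k V R A p : K 0 -> k^o).
Proof. exact: tlift_linear delta0_bilinear. Qed.

Lemma delta0B x y : delta0 p (x - y : K 0) = delta0 p x - delta0 p y.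
Proof. exact: (linearB (mklin delta0_linear)). Qed.
Lemma delta0Z c x : delta0 p (c *: x : K 0) = c * delta0 p x.
Proof. exact: (linearZ_LR (mklin delta0_linear)). Qed.

(** The functional [delta0 f] factors through k (x)_A K_m = J_m, so only the reduction of [y] modulo
    the augmentation ideal matters. *)
Lemma delta0_eps_K m (f : K m -> K 0) y : A_linear f ->
  delta0 p (f y) = delta0 p (f (tpure 1 (eps_K m y))).
Proof.
move=> [fl fA].
have L1 : linear (fun y => delta0 p (f y) : k^o).
  by move=> a u v; rewrite fl delta0_linear.
have L2 : linear (fun y => delta0 p (f (tpure 1 (eps_K m y))) : k^o).
  move=> a u v; rewrite (linearP (eps_K m)) (linear_right _ (tpure_bilinear _ _)).
  by rewrite fl delta0_linear.
apply: (tensor_ext_linear (f := mklin L1) (g := mklin L2)) => a w.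
rewrite -[LHS]/(delta0 p (f (tpure a w))) -[RHS]/(delta0 p (f (tpure 1 (eps_K m (tpure a w))))).
rewrite eps_K_pure -[in LHS](mulr1 a) -K_lact_pure fA.
have -> : tpure 1 (eps_A p a *: w) = eps_A p a *: tpure 1 w :> K m.
  exact: (bilinearZl _ _ _ (bilinear_flip (tpure_bilinear A (Jt m)))).
rewrite -[f (_ *: _)]/(mklin fl _) linearZ_LR /=.
rewrite -[RHS]/(mklin delta0_linear _) linearZ_LR /=.
move: (f _) => z.
have L3 : linear (fun z : K 0 => delta0 p (K_lact a z) : k^o).
  by move=> c u v; rewrite K_lact_linear delta0_linear.
have L4 : linear (fun z : K 0 => eps_A p a * delta0 p z : k^o).
  by move=> c u v; rewrite delta0_linear mulrDr scalerAr.
apply: (tensor_ext_linear (f := mklin L3) (g := mklin L4)) => b u /=.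
by rewrite K_lact_pure !delta0_pure (eps_AM hR hp) mulrA.
Qed.

(* Such a D is null-homotopic, and boundaries of homotopies vanish modulo the augmentation ideal; h is the homotopy in degree l. *)
Lemma cocycle_null d (D : matrices R A) : is_cocycle Vdeg p d%:Z D ->
  (forall w : Jt d, delta0 p (D d 0%N (tpure 1 w)) = 0) ->
  forall l (w : Jt (l + d)), eps_K l (D (l + d)%N l (tpure 1 w)) = 0.
Proof.
move=> cD D0 l.
have [[DA _] _] := cD; have {}DA j i : A_linear (D j i).
  exact: graded_hom_A_linear.
(* The homotopy relation is kept only on the image of [delta], where the term with the preceding
   homotopy drops out by delta^2 = 0. *)
suff [h [_ _ e]] : exists h : K (l + d) -> K l.+1, [/\ A_linear h,
    forall y, D (l + d)%N l (delta p y) = delta p (h (delta p y))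
    & forall w, eps_K l (D (l + d)%N l (tpure 1 w)) = 0] by [].
elim: l => [|l [h [hA hD _]]].
  have [|h [hA hD]] := @A_linear_lift d 0 (D d 0%N) (DA _ _).
    move=> x; have [_ ex _] := hK; apply/ex.
    by rewrite delta0_eps_K // D0.
  exists h; split=> // w; rewrite -[(0 + d)%N]/d hD.
  exact: (eps_K_delta hR hp).
have [hl hlA] := hA; have [Dl DlA] := DA (l + d).+1 l.+1.
have [dl dA] := delta_A_linear hR hp hK (l + d).
(* By the cocycle relation and [hD], [delta] annihilates [X]; exactness then lifts it to the next
   homotopy. *)
pose X (x : K (l + d).+1) := D (l + d).+1 l.+1 x - (-1) ^ d%:Z *: h (delta p x).
have XA : A_linear X.
  split=> [a u v|a x]; rewrite /X.
    by rewrite Dl dl hl scalerDr opprD addrACA scalerBr !scalerA [_ * a]mulrC.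
  rewrite DlA dA hlA -K_lactZ.
  by rewrite -[RHS]/(mklin (@K_lact_linear _ _ R A l.+1 a) _) linearB.
have [|h' [hA' hX]] := @A_linear_lift _ _ X XA.
  move=> x; have [_ _ ex] := hK; apply/ex.
  by rewrite /X linearB linearZ_LR /= (cocycle_delta _ _ cD) hD subrr.
have eD x : D (l + d).+1 l.+1 x = delta p (h' x) + (-1) ^ d%:Z *: h (delta p x).
  by rewrite -hX subrK.
exists h'; split=> // [y|w].
  rewrite -[LHS]/(D (l + d).+1 l.+1 (delta p y)) eD (delta_delta hK).
  by rewrite -[h 0]/(mklin hl 0) linear0 scaler0 addr0.
rewrite -[D _ _ _]/(D (l + d).+1 l.+1 (tpure 1 w)) eD linearD.
have e0 : eps_K l.+1 (h (delta p (tpure 1 w))) = 0.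
  rewrite (delta_pure hR hp hK) K_lact1; apply: eps_K_A_linear => //.
  exact/(J_succ hR)/lsub_valE.
rewrite (eps_K_delta hR hp) add0r; apply: etrans (linearZ_LR (eps_K l.+1) _ _) _.
by rewrite e0 scaler0.
Qed.

(** [repr] may return another cocycle of the class. The difference consists, up to sign, of
    [delta H] and [H delta]: [delta0] kills the first because delta0 delta = 0, the second by
    minimality. *)
Lemma ext_to_dual_pi i (c : cocycle Vdeg R p i%:Z) (w : Jt i) :
  ext_to_dual (\pi_(Ext Vdeg R p i) c)%qT w =
  (-1) ^+ i * delta0 p (cocycle_val c 0%N (tpure 1 w : K i)).
Proof.
rewrite /ext_to_dual; set c' := repr _; congr (_ * _).
have : c' - c \in in_coboundaries (i := i%:Z).
  by rewrite Quotient.idealrBE; apply/eqP; rewrite reprK.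
rewrite unfold_in => /asboolP[H [HA _] eH].
have {}HA m n : A_linear (H m n) by apply: graded_hom_A_linear (HA m n).
have e : cocycle_val c' 0%N (tpure 1 w : K i) - cocycle_val c 0%N (tpure 1 w : K i) =
    cdiff p (i%:Z - 1) H 0%N (tpure 1 w : K i).
  exact: (congr1 (fun F : matrices R A => F i 0%N (tpure 1 w)) eH).
apply/eqP; rewrite -subr_eq0; apply/eqP.
rewrite -delta0B e /cdiff delta0B (delta0_delta hK) sub0r delta0Z.
suff -> : delta0 p (precomp_delta p H 0%N (tpure 1 w : K i)) = 0 by rewrite mulr0 oppr0.
clear c c' e eH; case: i w H HA => [|j] v H HA /=.
  exact: (linear0 (mklin delta0_linear)).
rewrite delta0_eps_K // (eps_K_delta hR hp).
rewrite (bilinear0r _ (tpure_bilinear _ _)).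
have [hl _] := HA j 0%N; rewrite -[H _ _ 0]/(mklin hl 0) linear0.
exact: (linear0 (mklin delta0_linear)).
Qed.

(** Ensures that the [xget] in [split2] returns a genuine preimage; [sprod3_tensor] does the same
    for [split3]. *)
Lemma sprod_tensor i i' x : sprod (J i) (J i') x ->
  exists t : tensor (Jt i) (Jt i'), tlift (fun u v => lsub_val u * lsub_val v) t = x.
Proof.
have hb : bilinear_map (fun (u : Jt i) (v : Jt i') => lsub_val u * lsub_val v).
  exact: (bilinear_pre (@lsub_val _ _ (J i) : {linear _ -> _})
    (@lsub_val _ _ (J i') : {linear _ -> _}) (bilinear_mul T)).
move=> hx; suff [t ->] : limage (tliftL hb) x by exists t.
move: x hx; apply: sprod_min => _ _ /lsub_lift[u <-] /lsub_lift[v <-].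
by exists (tpure u v); rewrite tliftL_pure.
Qed.

Lemma sprod3_bilinear i i' : bilinear_map (fun (x : T) (y : tensor (Jt i) (Jt i')) =>
  tlift (fun (u : Jt i) (v : Jt i') => x * (lsub_val u * lsub_val v)) y).
Proof.
have hb : bilinear_map (fun (u : Jt i) (v : Jt i') => lsub_val u * lsub_val v).
  exact: (bilinear_pre (@lsub_val _ _ (J i) : {linear _ -> _})
    (@lsub_val _ _ (J i') : {linear _ -> _}) (bilinear_mul T)).
split=> [a x z y|a x y z].
  rewrite /tlift scaler_sumr -big_split; apply: eq_bigr => q _ /=.
  by rewrite mulrDl scalerAl.
exact: (linearP (tliftL (bilinear_comp (mklin (linear_right x (bilinear_mul T))) hb))).
Qed.

Lemma sprod3_tensor i i' x : sprod (lfull T) (sprod (J i) (J i')) x ->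
  exists t : tensor T (tensor (Jt i) (Jt i')), tlift (fun x =>
    tlift (fun (u : Jt i) (v : Jt i') => x * (lsub_val u * lsub_val v))) t = x.
Proof.
move=> hx; suff [t ->] : limage (tliftL (@sprod3_bilinear i i')) x by exists t.
move: x hx; apply: sprod_min => t y _ /sprod_tensor[z <-].
exists (tpure t z); rewrite tliftL_pure.
have hb : bilinear_map (fun (u : Jt i) (v : Jt i') => lsub_val u * lsub_val v).
  exact: (bilinear_pre (@lsub_val _ _ (J i) : {linear _ -> _})
    (@lsub_val _ _ (J i') : {linear _ -> _}) (bilinear_mul T)).
have L : linear (fun z => t * tliftL hb z).
  by move=> a u v; rewrite (linearP (tliftL hb)) (linear_right _ (bilinear_mul T)).
apply: (tensor_ext_linear (f := mklin L)
  (g := tliftL (bilinear_comp (mklin (linear_right t (bilinear_mul T))) hb))) => u v.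
rewrite -[LHS]/(t * tliftL hb (tpure u v)).
by rewrite !tliftL_pure.
Qed.

Lemma canon_bilinear i i' (f : {linear Jt i -> k^o}) (g : {linear Jt i' -> k^o}) :
  bilinear_map (fun v w => (-1) ^+ (i * i') * ((f v : k) * g w) : k^o).
Proof.
split=> [a u v w|a u w z].
  rewrite (linearP f) -[a *: f u]/(a * (f u : k)) mulrDl mulrDr -[RHS]/(a * _ + _).
  by rewrite -mulrA mulrCA.
rewrite (linearP g) -[a *: g w]/(a * (g w : k)) !mulrDr -[RHS]/(a * _ + _).
by rewrite (mulrCA _ a) (mulrCA _ a).
Qed.

(** The right-hand side depends on the product in T alone, so it may be compared on the pure tensors
    of whichever preimage was selected. For odd [i] and [i'] the leftover factor x in T contributes
    [eps_T x] on both sides; otherwise x = 1. *)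
Lemma canon_iota i i' (f : {linear Jt i -> k^o}) (g : {linear Jt i' -> k^o})
    (w : Jt (i + i')) :
  canon f g (iota_J w) =
  (-1) ^+ (i * i') * (f (eps_K i (cap_K g i (lsub_val w))) : k).
Proof.
have Lf : linear (fun x => (-1) ^+ (i * i') * (f (eps_K i (cap_K g i x)) : k) : k^o).
  move=> a x y; rewrite cap_K_linear (linearP (eps_K i)) (linearP f).
  by rewrite -[a *: _]/(a * _) mulrDr mulrCA.
have canonL : linear (canon f g : _ -> k^o) := tlift_linear (canon_bilinear f g).
have canonE u v : canon f g (tpure u v) = (-1) ^+ (i * i') * ((f u : k) * g v).
  exact: (tlift_pure _ _ (canon_bilinear f g)).
have pureE (x : T) (u : Jt i) (v : Jt i') :
    f (eps_K i (cap_K g i (x * (lsub_val u * lsub_val v)))) = eps_T x * (f u * g v : k).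
  rewrite cap_KE; have -> : eps_K i ((g v : k) *: tpure (p x) u) =
      ((g v : k) * eps_T x) *: u.
    apply: etrans (linearZ_LR (eps_K i) _ _) _.
    by rewrite eps_K_pure (eps_A_p hR hp) scalerA.
  apply: etrans (linearZ_LR f _ _) _; rewrite -[LHS]/((g v : k) * eps_T x * f u).
  by rewrite mulrAC mulrC [g v * _]mulrC.
have Jw := J_add hR (lsub_valE w).
rewrite /iota_J; case: ifP Jw => _ Jw.
  rewrite /split3; set t := xget _ _.
  have : tlift (fun x => tlift (fun (u : Jt i) (v : Jt i') => x * (lsub_val u * lsub_val v))) t = lsub_val w.
    exact: (xgetPex 0 (sprod3_tensor Jw)).
  move: t => t <-.
  have iotaB := bilinear_pre (mklin (@eps_T_linear k V)) idfun
    (@bilinear_scale k (tensor (Jt i) (Jt i'))).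
  have L1 : linear (fun t => canon f g (tliftL iotaB t) : k^o).
    by move=> a x y; rewrite (linearP (tliftL iotaB)) canonL.
  have L2 : linear (fun t => (-1) ^+ (i * i') *
      (f (eps_K i (cap_K g i (tliftL (@sprod3_bilinear i i') t))) : k) : k^o).
    by move=> a x y; rewrite (linearP (tliftL _)) Lf.
  apply: (tensor_ext_linear (f := mklin L1) (g := mklin L2)) => x y.
  rewrite -[LHS]/(canon f g (tliftL iotaB (tpure x y))).
  rewrite -[RHS]/((-1) ^+ (i * i') * (f (eps_K i (cap_K g i (tliftL (@sprod3_bilinear i i') (tpure x y)))) : k)).
  rewrite !tliftL_pure.
  have L3 : linear (fun y => canon f g (eps_T x *: y) : k^o).
    by move=> a u v; rewrite scalerDr scalerA mulrC -scalerA canonL.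
  have L4 : linear (fun y => (-1) ^+ (i * i') *
      (f (eps_K i (cap_K g i (tlift (fun (u : Jt i) (v : Jt i') => x * (lsub_val u * lsub_val v)) y))) : k) : k^o).
    move=> a u v; have [_ hr] := @sprod3_bilinear i i'.
    by rewrite hr Lf.
  apply: (tensor_ext_linear (f := mklin L3) (g := mklin L4)) => u v /=.
  have -> : tlift (fun (u : Jt i) (v : Jt i') => x * (lsub_val u * lsub_val v)) (tpure u v) =
      x * (lsub_val u * lsub_val v).
    apply: (tlift_pure (b := fun (u : Jt i) (v : Jt i') => x * (lsub_val u * lsub_val v))).
    apply: (bilinear_comp (mklin (linear_right x (bilinear_mul T)))).
    exact: (bilinear_pre (@lsub_val _ _ (J i) : {linear _ -> _})
      (@lsub_val _ _ (J i') : {linear _ -> _}) (bilinear_mul T)).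
  rewrite pureE; apply: etrans (linearZ_LR (mklin canonL) _ _) _.
  by rewrite /= canonE -[LHS]/(eps_T x * _) mulrCA.
rewrite /split2; set t := xget _ _.
have : tlift (fun u v => lsub_val u * lsub_val v) t = lsub_val w.
  exact: (xgetPex 0 (sprod_tensor Jw)).
move: t => t <-.
have hb : bilinear_map (fun (u : Jt i) (v : Jt i') => lsub_val u * lsub_val v).
  exact: (bilinear_pre (@lsub_val _ _ (J i) : {linear _ -> _})
    (@lsub_val _ _ (J i') : {linear _ -> _}) (bilinear_mul T)).
have L : linear (fun t => (-1) ^+ (i * i') *
    (f (eps_K i (cap_K g i (tliftL hb t))) : k) : k^o).
  by move=> a x y; rewrite (linearP (tliftL hb)) Lf.
apply: (tensor_ext_linear (f := mklin canonL) (g := mklin L)) => u v.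
rewrite -[LHS]/(canon f g (tpure u v)) canonE.
rewrite -[RHS]/((-1) ^+ (i * i') * (f (eps_K i (cap_K g i (tliftL hb (tpure u v)))) : k)).
by rewrite tliftL_pure -[lsub_val u * _]mul1r pureE eps_T1 mul1r.
Qed.

Lemma cap_K0 d (g : {linear Jt d -> k^o}) w : delta0 p (cap_K g 0 (lsub_val w)) = g w.
Proof.
have [u u1] : exists u : Jt 0, lsub_val u = 1 by apply: lsub_lift; apply: scalars1.
rewrite -[lsub_val w]mul1r -[X in 1 * X]mul1r -{2}u1 cap_KE delta0Z delta0_pure.
by rewrite rmorph1 (eps_A1 hR hp) u1 eps_T1 !mulr1.
Qed.

Lemma dual_of_cap_cochain d (g : {linear Jt d -> k^o}) (w : Jt d) :
  (-1) ^+ d * delta0 p (cap_cochain p hR g 0%N (tpure 1 w : K d)) = g w.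
Proof.
rewrite /cap_cochain eqxx muln1 cap_map_pure K_lact1 delta0Z cap_K0 mulrA.
by rewrite -expr2 sqrr_sign mul1r.
Qed.

(** The explicit cocycle is a witness for the [xget] in [dual_to_ext], so the selected class does
    represent [g]. *)
Lemma dual_to_extK d (g : Jt d -> k) : graded_dual Vdeg g ->
  ext_to_dual (dual_to_ext Vdeg p g) = g.
Proof.
move=> hg; have [gl _] := hg; pose g' : {linear Jt d -> k^o} := mklin gl.
apply: (xgetPex 0 (P := [set x | ext_to_dual x = g]%classic)).
have c : cap_cochain p hR g' \in in_cocycles Vdeg p d%:Z.
  by rewrite unfold_in; apply/asboolP; apply: cap_cocycle.
exists (\pi_(Ext Vdeg R p d) (Cocycle c))%qT; apply/funext => w.
by rewrite ext_to_dual_pi; apply: dual_of_cap_cochain.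
Qed.

(** [delta0 F] sees the value of [G] only modulo the augmentation ideal, where [cocycle_null]
    replaces [G] by the explicit cocycle of [g]. [F] and [G] are arbitrary representatives, since
    [repr] and [dual_to_ext] select unspecified ones. *)
Lemma cocycle_comp_dual i i' (f : {linear Jt i -> k^o}) (g : {linear Jt i' -> k^o})
    (F G : matrices R A) (w : Jt (i + i')) :
  is_cocycle Vdeg p i%:Z F -> is_cocycle Vdeg p i'%:Z G ->
  graded_dual Vdeg (g : Jt i' -> k) ->
  (forall u, (-1) ^+ i * delta0 p (F i 0%N (tpure 1 u)) = f u) ->
  (forall v, (-1) ^+ i' * delta0 p (G i' 0%N (tpure 1 v)) = g v) ->
  (-1) ^+ (i + i') * delta0 p (ccomp i' F G 0%N (tpure 1 w : K (i + i'))) =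
  canon f g (iota_J w).
Proof.
move=> cF cG hg fF gG.
have FA : A_linear (F i 0%N) by have [[FA _] _] := cF; apply: graded_hom_A_linear.
have -> : ccomp i' F G 0%N (tpure 1 w : K (i + i')) = F i 0%N (G (i + i')%N i (tpure 1 w)).
  (* [(i + i') - i'] is not convertible to [i] and occurs in types, hence the generalization over
     [j]. *)
  rewrite /ccomp; have : (i + i' - i')%N = i by rewrite addnK.
  by move: (_ - _)%N => j ->.
rewrite delta0_eps_K //.
pose D : matrices R A := G - cap_cochain p hR g.
have cD : is_cocycle Vdeg p i'%:Z D.
  have [cG1 cG2] := cG; have [cC1 cC2] := cap_cocycle Vgr hR hp hK hg.
  by split; [apply: cochainB|rewrite cdiffB cG2 cC2 subrr].
have D0 v : delta0 p (D i' 0%N (tpure 1 v)) = 0.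
  rewrite -[D _ _ _]/(G i' 0%N (tpure 1 v) - cap_cochain p hR g 0%N (tpure 1 v : K i')).
  rewrite delta0B; apply/eqP; rewrite subr_eq0; apply/eqP.
  have s0 : (-1) ^+ i' != 0 :> k by rewrite signr_eq0.
  by apply: (mulfI s0); rewrite gG dual_of_cap_cochain.
have := cocycle_null cD D0 (l := i) w.
rewrite -[D _ _ _]/(G (i + i')%N i (tpure 1 w) - cap_cochain p hR g i (tpure 1 w : K (i + i'))).
rewrite linearB => /eqP; rewrite subr_eq0 => /eqP ->.
rewrite /cap_cochain eqxx cap_map_pure K_lact1 canon_iota -fF.
set y := cap_K g i _.
have -> : eps_K i ((-1) ^+ (i' * i.+1) *: y) = (-1) ^+ (i' * i.+1) *: eps_K i y.
  exact: linearZ_LR.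
have -> : tpure 1 ((-1) ^+ (i' * i.+1) *: eps_K i y) =
    (-1) ^+ (i' * i.+1) *: tpure 1 (eps_K i y) :> K i.
  exact: (bilinearZl _ _ _ (bilinear_flip (tpure_bilinear A (Jt i)))).
have [fl _] := FA.
rewrite -[F i 0%N (_ *: _)]/(mklin fl _) linearZ_LR /= delta0Z !mulrA -!exprD.
(* The exponents (i + i') + i' (i + 1) and i i' + i have the same parity. *)
congr (_ * _); rewrite -signr_odd -[RHS]signr_odd; congr ((-1) ^+ nat_of_bool _).
by rewrite !oddD !oddM /=; case: (odd i); case: (odd i').
Qed.

Lemma yoneda_dualE i i' (f : Jt i -> k) (g : Jt i' -> k) :
  graded_dual Vdeg f -> graded_dual Vdeg g ->
  yoneda_dual Vdeg p f g = (fun w : Jt (i + i') => canon f g (iota_J w)).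
Proof.
move=> hf hg; have [fl _] := hf; have [gl _] := hg.
apply/funext => w; rewrite /yoneda_dual /yoneda ext_to_dual_pi.
have /asboolP cF := cocycle_valP (repr (dual_to_ext Vdeg p f)).
have /asboolP cG := cocycle_valP (repr (dual_to_ext Vdeg p g)).
apply: (cocycle_comp_dual (f := mklin fl) (g := mklin gl) _ cF cG hg) => u.
  exact: (congr1 (fun h : Jt i -> k => h u) (dual_to_extK hf)).
exact: (congr1 (fun h : Jt i' -> k => h u) (dual_to_extK hg)).
Qed.

End YonedaProduct.

Theorem theorem4p1 (k : fieldType) (V : lmodType k)
    (Vdeg : nat -> lsubspace V) (R : lsubspace (talg V))
    (A : algType k) (p : {lrmorphism talg V -> A}) :
  pos_graded_lfd Vdeg ->
  relation_space Vdeg R ->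
  is_presentation R p ->
  multi_koszul R p ->
  forall (i i' : nat) (f : Jt R i -> k) (g : Jt R i' -> k),
    graded_dual Vdeg f -> graded_dual Vdeg g ->
    yoneda_dual Vdeg p f g = (fun w : Jt R (i + i') => canon f g (iota_J w)).
Proof. by move=> [Vgr _ _] hR hp hK i i' f g; apply: yoneda_dualE. Qed.
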